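(* Let $w$ be an admissible weight on $\mathbb{R}^d$. Then the embedding $\mathcal{A}_w \hookrightarrow B(L^p(\mathbb{R}^d))$ is spectral for every $p\in[1,\infty]$. In other words: if $\mathcal{M}=\sum_{x} m_xT_x \in \mathcal{A}_w$ defines an invertible operator in $B(L^p(\mathbb{R}^d))$ for some $p\in[1,\infty]$, then $\mathcal{M}^{-1}\in\mathcal{A}_w$, i.e. the inverse is of the form $\mathcal{M}^{-1}=\sum_{x\in\mathbb{R}^d} n_xT_x$ with $n_x\in L^\infty(\mathbb{R}^d)$ and $\sum_{x\in\mathbb{R}^d}\|n_x\|_{\infty}\,w(x)<\infty$.
   Context: A weight is a continuous function $w:\mathbb{R}^d\to(0,\infty)$ with $w(x)=w(-x)$. A weight $w$ is admissible if $w(0)=1$, $w(x+y)\le w(x)w(y)$ for all $x,y\in\mathbb{R}^d$, and $\lim_{k\to\infty}w(kx)^{1/k}=1$ for all $x\in\mathbb{R}^d$ (these imply $w\ge1$). $T_xf(y)=f(y-x)$ denotes translation. For $m\in L^\infty(\mathbb{R}^d)$, $m$ also denotes the operator of multiplication by $m$. $B(E)$ is the algebra of bounded linear operators on a Banach space $E$. $\mathcal{A}_w$ is the set of all families $\mathcal{M}=(m_x)_{x\in\mathbb{R}^d}$ of functions $m_x\in L^\infty(\mathbb{R}^d)$ with $\|\mathcal{M}\|_{\mathcal{A}_w}=\sum_{x\in\mathbb{R}^d}\|m_x\|_{\infty}w(x)<\infty$ (so only countably many $m_x$ are nonzero). Such a family is identified with the operator $\mathcal{M}=\sum_x m_xT_x$,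 $f\mapsto\sum_x m_x f(\cdot-x)$, which is bounded on every $L^p(\mathbb{R}^d)$, $1\le p\le\infty$; this identification is one-to-one. The product in $\mathcal{A}_w$ is composition of operators. *)

(* Defs.v *)
From HB Require Import structures.
From mathcomp Require Import all_boot all_order all_algebra.
From mathcomp Require Import finmap.
From mathcomp Require Import all_classical all_reals all_analysis.
From mathcomp Require Import complex.

Set Implicit Arguments.
Unset Strict Implicit.
Unset Printing Implicit Defensive.
Import Order.TTheory GRing.Theory Num.Theory.
Import numFieldNormedType.Exports.

Local Open Scope classical_set_scope.
Local Open Scope ring_scope.

(* R^d is 'rV[R]_d; its sigma-algebra is generated by the d coordinates. *)
Section measurable_rV.
Variables (R : realType) (d : nat).

Definition coord_rV (i : 'I_d) (x : 'rV[R]_d) : measurableTypeR R := x ord0 i.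

Let rV_set0 : g_sigma_preimage coord_rV set0.
Proof. exact: sigma_algebra0. Qed.

Let rV_setC A : g_sigma_preimage coord_rV A -> g_sigma_preimage coord_rV (~` A).
Proof. exact: sigma_algebraC. Qed.

Let rV_bigcup (F : _^nat) : (forall i, g_sigma_preimage coord_rV (F i)) ->
  g_sigma_preimage coord_rV (\bigcup_i (F i)).
Proof. exact: sigma_algebra_bigcup. Qed.

HB.instance Definition _ := @isMeasurable.Build default_measure_display
  'rV[R]_d (g_sigma_preimage coord_rV) rV_set0 rV_setC rV_bigcup.

End measurable_rV.

Section lebesgue_rV.
Variable R : realType.

Lemma measurable_coord_rV d (i : 'I_d) :
  measurable_fun [set: 'rV[R]_d] (@coord_rV R d i).
Proof.
move=> _ A mA; apply: sub_sigma_algebra.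
case: d i => [[] //|d i].
rewrite -bigcup_mkord_ord; exists i; first exact: ltn_ord.
by exists A => //; rewrite inord_val.
Qed.

Lemma measurable_fun_rVP d dT (T : measurableType dT) (f : T -> 'rV[R]_d) :
  (forall i, measurable_fun [set: T] (@coord_rV R d i \o f)) ->
  measurable_fun [set: T] f.
Proof.
move=> mf.
have H : g_sigma_preimage (fun i => @coord_rV R d i \o f) `<=` measurable.
  apply: smallest_sub; first exact: sigma_algebra_measurable.
  case: d f mf => [|d] f mf; first by rewrite big_ord0.
  rewrite -bigcup_mkord_ord; apply: bigcup_sub => i Ii.
  by move=> A [B mB <-]; exact: mf.
move=> _ A mA; apply: H.
rewrite g_sigma_preimage_comp; by exists A.
Qed.

Definition cons_rV d (tv : measurableTypeR R * 'rV[R]_d) : 'rV[R]_d.+1 :=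
  row_mx (tv.1 : R)%:M tv.2 : 'rV[R]_(1 + d).

Definition uncons_rV d (x : 'rV[R]_d.+1) : measurableTypeR R * 'rV[R]_d :=
  (x ord0 ord0, rsubmx (x : 'rV[R]_(1 + d))).

Lemma cons_rVK d : cancel (@cons_rV d) (@uncons_rV d).
Proof.
move=> [t v]; rewrite /uncons_rV /cons_rV /= row_mxKr; congr pair.
rewrite (_ : ord0 = lshift d (ord0 : 'I_1)); last exact/val_inj.
by rewrite (@row_mxEl _ _ 1 d) mxE eqxx mulr1n.
Qed.

Lemma measurable_cons_rV d :
  measurable_fun [set: measurableTypeR R * 'rV[R]_d] (@cons_rV d).
Proof.
apply: measurable_fun_rVP => i.
case: (splitP (i : 'I_(1 + d))) => [j ij|k ik].
  rewrite (_ : _ \o _ = fst); first exact: measurable_fst.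
  apply/funext => tv /=; rewrite -[in RHS](cons_rVK tv) /=; congr (_ _ _).
  by apply: val_inj; rewrite /= ij ord1.
rewrite (_ : _ \o _ = @coord_rV R d k \o snd).
  apply: measurableT_comp; last exact: measurable_snd.
  exact: measurable_coord_rV.
have -> : i = rshift 1 k by exact: val_inj.
by apply/funext => tv /=; rewrite -[in RHS](cons_rVK tv) /coord_rV /= [in RHS]mxE.
Qed.

Lemma measurable_uncons_rV d : measurable_fun [set: 'rV[R]_d.+1] (@uncons_rV d).
Proof.
apply: measurable_fun_pair.
  exact: (@measurable_coord_rV d.+1 ord0).
apply: measurable_fun_rVP => i.
rewrite (_ : _ \o _ = @coord_rV R d.+1 (rshift 1 i)).
  exact: measurable_coord_rV.
by apply/funext => x; rewrite /coord_rV /= mxE.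
Qed.

Section cons_measure.
Variables (d : nat) (mu : {sigma_finite_measure set 'rV[R]_d -> \bar R}).

Definition cons_measure : set 'rV[R]_d.+1 -> \bar R :=
  pushforward (@lebesgue_measure R \x mu)%E (@cons_rV d).

Let cons_measure0 : cons_measure set0 = 0%E.
Proof. by rewrite /cons_measure /pushforward preimage_set0 measure0. Qed.

Let cons_measure_ge0 A : (0 <= cons_measure A)%E.
Proof. by rewrite /cons_measure /pushforward measure_ge0. Qed.

Let cons_measure_sigma_additive : semi_sigma_additive cons_measure.
Proof.
move=> F mF tF mUF.
have mpre A : measurable A -> measurable (@cons_rV d @^-1` A).
  by move=> mA; rewrite -[X in measurable X]setTI; exact: measurable_cons_rV.
rewrite /cons_measure /pushforward preimage_bigcup.
apply: measure_semi_sigma_additive => [n||]; first exact: mpre.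
- apply/trivIsetP => /= i j _ _ ij; rewrite -preimage_setI.
  by move/trivIsetP : tF => /(_ _ _ _ _ ij) ->//; rewrite preimage_set0.
- by rewrite -preimage_bigcup; exact: mpre.
Qed.

HB.instance Definition _ := isMeasure.Build _ _ _ cons_measure
  cons_measure0 cons_measure_ge0 cons_measure_sigma_additive.

Let cons_measure_sigma_finite : sigma_finite setT cons_measure.
Proof.
have /sigma_finiteP[F [TF ndF Foo]] := sigma_finiteT (@lebesgue_measure R).
have /sigma_finiteP[G [TG ndG Goo]] := sigma_finiteT mu.
exists (fun n => @uncons_rV d @^-1` (F n `*` G n)).
  rewrite -preimage_bigcup -(preimage_setT (@uncons_rV d)); congr (_ @^-1` _).
  apply/esym; rewrite -subTset => -[t v] _.
  have [n _ Fn] : (\bigcup_n F n) t by rewrite -TF.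
  have [k _ Gk] : (\bigcup_n G n) v by rewrite -TG.
  exists (maxn n k) => //; split => /=.
    by move: t Fn; exact/subsetPset/ndF/leq_maxl.
  by move: v Gk; exact/subsetPset/ndG/leq_maxr.
move=> n; have [mF Fn] := Foo n; have [mG Gn] := Goo n; split.
  by rewrite -[X in measurable X]setTI; apply: measurable_uncons_rV => //;
    exact: measurableX.
rewrite /cons_measure /pushforward -comp_preimage.
rewrite (_ : _ \o _ = id); last by apply/funext => x /=; rewrite cons_rVK.
by rewrite preimage_id product_measure1E// lte_mul_pinfty// ge0_fin_numE.
Qed.

HB.instance Definition _ := Measure_isSigmaFinite.Build _ _ _ cons_measure
  cons_measure_sigma_finite.

End cons_measure.

(* Lebesgue measure on R^d, as the d-fold product of the one on R *)
Fixpoint lebesgue_rV d : {sigma_finite_measure set 'rV[R]_d -> \bar R} :=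
  match d with
  | 0 => \d_(0 : 'rV[R]_0)
  | d'.+1 => cons_measure (lebesgue_rV d')
  end.

End lebesgue_rV.

Arguments lebesgue_rV {R} d.

Definition weight (R : realType) (d : nat) (w : 'rV[R]_d -> R) :=
  [/\ continuous w, forall x, 0 < w x & forall x, w (- x) = w x].

Definition admissible (R : realType) (d : nat) (w : 'rV[R]_d -> R) :=
  [/\ w 0 = 1,
      forall x y, w (x + y) <= w x * w y &
      forall x, (w (k%:R *: x) `^ (k%:R)^-1 @[k --> \oo] --> (1 : R))].

Section Lp.
Variables (R : realType) (d : nat).
Local Notation Rd := 'rV[R]_d.
Local Notation C := (complex R).
Local Notation lambda := (lebesgue_rV d).

(* modulus as a real number: `|z| lies in C *)
Definition cmod (z : C) : R := complex.Re `|z|.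

Definition cmeasurable (f : Rd -> C) :=
  measurable_fun [set: Rd] (fun y => complex.Re (f y)) /\
  measurable_fun [set: Rd] (fun y => complex.Im (f y)).

Definition Lp_norm (p : \bar R) (f : Rd -> C) : \bar R :=
  'N[lambda]_p[EFin \o (cmod \o f)]%E.

(* Functions, not classes: members of L^p are these modulo equality a.e. *)
Definition in_Lp (p : \bar R) (f : Rd -> C) :=
  cmeasurable f /\ (Lp_norm p f < +oo)%E.

(* A bounded linear operator on L^p, acting on representatives; its values
   outside in_Lp are irrelevant. *)
Record bounded_op (p : \bar R) := BoundedOp {
  op_fun :> (Rd -> C) -> (Rd -> C) ;
  op_in_Lp : forall f, in_Lp p f -> in_Lp p (op_fun f) ;
  op_ae : forall f g, in_Lp p f -> in_Lp p g ->
    f = g %[ae lambda] -> op_fun f = op_fun g %[ae lambda] ;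
  op_linear : forall (a : C) f g, in_Lp p f -> in_Lp p g ->
    op_fun (fun y => a * f y + g y) =
      (fun y => a * op_fun f y + op_fun g y) %[ae lambda] ;
  op_bounded : exists K : R, forall f, in_Lp p f ->
    (Lp_norm p (op_fun f) <= K%:E * Lp_norm p f)%E
}.

Definition is_inverse (p : \bar R) (A B : bounded_op p) :=
  forall f, in_Lp p f ->
    A (B f) = f %[ae lambda] /\ B (A f) = f %[ae lambda].

Definition translation (x : Rd) (f : Rd -> C) : Rd -> C := fun y => f (y - x).

Definition in_Aw (w : Rd -> R) (m : Rd -> Rd -> C) :=
  (forall x, in_Lp +oo (m x)) /\
  (\esum_(x in [set: Rd]) (Lp_norm +oo (m x) * (w x)%:E) < +oo)%E.

Definition partial_op (m : Rd -> Rd -> C) (F : {fset Rd}) (f : Rd -> C) :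
    Rd -> C :=
  fun y => \sum_(x <- F) m x y * translation x f y.

(* A = \sum_x m_x T_x on L^p: for each f, the series \sum_x m_x f(. - x)
   converges unconditionally to A f in L^p. *)
Definition is_op_series (p : \bar R) (m : Rd -> Rd -> C) (A : bounded_op p) :=
  forall f, in_Lp p f -> forall eps : R, 0 < eps ->
    exists F0 : {fset Rd}, forall F : {fset Rd}, (F0 `<=` F)%fset ->
      (Lp_norm p (A f \- partial_op m F f)%R <= eps%:E)%E.

End Lp.

(* Main.v *)
(* Let M be bounded below on L^p, and let a_j be its truncations to finitely
   many translations, all lying in a countable group Gamma of translations.

   For almost every y the coefficients m_x (y + g), g in Gamma, are almost
   constant on a small set E of positive measure around y, so that testing the
   lower bound on the functions sum_g v(g) 1_(E + g) bounds the matrix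
   (m_x (y + g)) below on finitely supported v, in the translation-invariant
   solid norm v |-> || sum_g v(g) 1_(E + g) ||_p. Localizing with the weights
   phi(g) = th^|g|, which almost commute with translations by a fixed finite
   set, and summing squares over all translates of phi, turns this into a lower
   bound on l^2(y + Gamma), uniform in y and j.

   On l^2 of the discrete group R^d the operator T = 1 - delta a_j^* a_j is then
   a strict contraction. Splitting T = b + r with b finitely supported and r
   small in A_w, a word in b and the atoms of r has support of polynomial size,
   and each of its coefficients is at most its l^2-norm; since w grows
   subexponentially, the powers of T decay geometrically in A_w. The Neumann
   series gives approximate left inverses of a_j that form a Cauchy sequence in
   A_w, and their limit is M^-1. *)

From HB Require Import structures.
Require Import Defs.
From mathcomp Require Import all_boot all_order all_algebra.
From mathcomp Require Import finmap.
From mathcomp Require Import all_classical all_reals all_analysis.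
From mathcomp Require Import measurable_realfun ess_sup_inf complex.
From mathcomp Require Import zify ring lra.

Set Implicit Arguments.
Unset Strict Implicit.
Unset Printing Implicit Defensive.
Import Order.TTheory GRing.Theory Num.Theory.
Import numFieldNormedType.Exports.

Local Open Scope classical_set_scope.
Local Open Scope ring_scope.

(** * Finitely supported functions on a discrete group *)

(** Only left inverses are built. With h = N f one has f = M h, so if b is an approximate left
    inverse of a truncation a, then N f - b f = (h - b (a h)) + b (a h - f) is small. Hence a lower
    bound for M suffices, which the boundedness of N provides; no adjoint of M on L^p enters, and p
    = oo is treated like the rest.

    The exponent disappears in l^2 of the discrete group, where adjoints exist and a matrix entry is
    at most the operator norm. The obstacle is that points have measure 0: coefficients given almost
    everywhere do not act there. They are changed to 0 on a null set Z, which can be made invariant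
    because Gamma is countable, and multiplication by the indicator of the complement of Z replaces
    the identity.

    All approximants are finite sums of atoms, that is, explicit operators on arbitrary functions
    R^d -> C. One derivation of [Aw] therefore gives a bound on discrete l^2 and one on L^p, and
    pointwise identities between such operators hold in both spaces. *)

Section cmod_theory.
Variable R : realType.
Local Notation C := (complex R).
Implicit Types z t : C.

Lemma cmodE z : cmod z = Num.sqrt ((complex.Re z) ^+ 2 + (complex.Im z) ^+ 2).
Proof. by rewrite /cmod normc_def. Qed.

Lemma cmod_ge0 z : 0 <= cmod z.
Proof. by rewrite cmodE sqrtr_ge0. Qed.

Lemma sqr_cmod z : cmod z ^+ 2 = (complex.Re z) ^+ 2 + (complex.Im z) ^+ 2.
Proof. by rewrite cmodE sqr_sqrtr// addr_ge0// sqr_ge0. Qed.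

Lemma cmod0 : cmod (0 : C) = 0.
Proof. by rewrite /cmod normr0. Qed.

Lemma cmod1 : cmod (1 : C) = 1.
Proof. by rewrite /cmod normr1. Qed.

Lemma cmod_real (r : R) : cmod (r%:C)%C = `|r|.
Proof. by rewrite cmodE /= expr0n addr0 sqrtr_sqr. Qed.

Lemma cmodM z t : cmod (z * t) = cmod z * cmod t.
Proof. by rewrite /cmod normrM !normc_def /= mulr0 subr0. Qed.

Lemma cmodN z : cmod (- z) = cmod z.
Proof. by rewrite /cmod normrN. Qed.

Lemma cmodJ z : cmod (conjc z) = cmod z.
Proof. by case: z => a b; rewrite !cmodE /= sqrrN. Qed.

Lemma ler_cmodD z t : cmod (z + t) <= cmod z + cmod t.
Proof. by have := ler_normD z t; rewrite /cmod !normc_def -rmorphD lecR. Qed.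

Lemma cmod_eq0 z : cmod z = 0 -> z = 0.
Proof.
move=> z0; apply/eqP; rewrite -normr_eq0 normc_def.
by move: z0; rewrite /cmod normc_def => /= ->.
Qed.

Lemma ler_cmod_sum (I : Type) (s : seq I) (F : I -> C) :
  cmod (\sum_(i <- s) F i) <= \sum_(i <- s) cmod (F i).
Proof.
elim: s => [|i s IH]; first by rewrite !big_nil cmod0.
by rewrite !big_cons (le_trans (ler_cmodD _ _))// lerD2l.
Qed.

Lemma ler_cmod_Re z : `|complex.Re z| <= cmod z.
Proof. by have := normc_ge_Re z; rewrite /cmod normc_def lecR. Qed.

Lemma ler_cmod_Im z : `|complex.Im z| <= cmod z.
Proof.
by rewrite cmodE -sqrtr_sqr ler_sqrt ?addr_ge0 ?sqr_ge0// lerDr sqr_ge0.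
Qed.

Lemma ler_cmod_ReIm z : cmod z <= `|complex.Re z| + `|complex.Im z|.
Proof.
rewrite -(@ler_pXn2r _ 2) ?nnegrE ?cmod_ge0 ?addr_ge0//.
rewrite sqr_cmod sqrrD !real_normK ?num_real//.
by rewrite -addrA [_ *+ 2 + _]addrC addrA lerDl mulrn_wge0// mulr_ge0.
Qed.

End cmod_theory.

(* Finite sums over a discrete group: a sum over an infinite support is 0. *)
Section gsum.
Variables (R : realType) (G : zmodType).
Implicit Types (g h : G -> R).

Definition finsupp (V : nmodType) (f : G -> V) :=
  exists s : seq G, forall y, y \notin s -> f y = 0.

Definition gsum (V : nmodType) (g : G -> V) : V := \sum_(y \in [set: G]) g y.

Lemma gsumE (V : nmodType) (s : seq G) (g : G -> V) :
  uniq s -> (forall y, y \notin s -> g y = 0) ->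
  gsum g = \sum_(y <- s) g y.
Proof.
move=> us g0; rewrite /gsum (fsbigE s)//; last by move=> i _; exact: g0.
by apply: eq_bigl => i; rewrite in_setT.
Qed.

Lemma finsupp_uniq (V : nmodType) (f : G -> V) : finsupp f ->
  exists2 s, uniq s & forall y, y \notin s -> f y = 0.
Proof.
move=> [s sf]; exists (undup s); first exact: undup_uniq.
by move=> y; rewrite mem_undup; exact: sf.
Qed.

Lemma finsupp2 (V W : nmodType) (f : G -> V) (g : G -> W) :
  finsupp f -> finsupp g -> exists s, [/\ uniq s,
    forall y, y \notin s -> f y = 0 & forall y, y \notin s -> g y = 0].
Proof.
move=> [s sf] [t tg]; exists (undup (s ++ t)); split.
- exact: undup_uniq.
- by move=> y; rewrite mem_undup mem_cat negb_or => /andP[/sf].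
- by move=> y; rewrite mem_undup mem_cat negb_or => /andP[_ /tg].
Qed.

Lemma finsupp_op2 (U V W : nmodType) (op : U -> V -> W)
    (f : G -> U) (g : G -> V) :
  op 0 0 = 0 -> finsupp f -> finsupp g -> finsupp (fun y => op (f y) (g y)).
Proof.
move=> op0 ff fg; have [s [_ sf sg]] := finsupp2 ff fg.
by exists s => y ys; rewrite sf// sg.
Qed.

Lemma finsupp_dom (V W : nmodType) (f : G -> V) (g : G -> W) : finsupp f ->
  (forall y, f y = 0 -> g y = 0) -> finsupp g.
Proof. by move=> [s sf] fg; exists s => y /sf /fg. Qed.

Lemma finsuppD (V : nmodType) (f g : G -> V) : finsupp f -> finsupp g ->
  finsupp (fun y => f y + g y).
Proof. by apply: finsupp_op2; rewrite addr0. Qed.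

Lemma finsupp0 (V : nmodType) : finsupp (fun _ => 0 : V).
Proof. by exists [::]. Qed.

Lemma finsupp_shift (V : nmodType) (f : G -> V) (x : G) : finsupp f ->
  finsupp (fun y => f (y - x)).
Proof.
move=> [s sf]; exists [seq z + x | z <- s] => y ys; apply: sf.
by apply: contra ys => ys; apply/mapP; exists (y - x) => //; rewrite subrK.
Qed.

Lemma finsupp_sum (V : nmodType) (I : Type) (s : seq I) (f : I -> G -> V) :
  (forall i, finsupp (f i)) -> finsupp (fun y => \sum_(i <- s) f i y).
Proof.
move=> ff; elim: s => [|i s IH].
  by exists [::] => y _; rewrite big_nil.
have [t tf] := finsuppD (ff i) IH.
by exists t => y /tf; rewrite big_cons.
Qed.

Lemma gsumD (V : nmodType) (g h : G -> V) : finsupp g -> finsupp h ->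
  gsum (fun y => g y + h y) = gsum g + gsum h.
Proof.
move=> fg fh; have [s [us sg sh]] := finsupp2 fg fh.
rewrite !(gsumE us)// ?big_split// => y ys.
by rewrite sg// sh// addr0.
Qed.

Lemma gsumZ (V : pzRingType) (k : V) (g : G -> V) : finsupp g ->
  gsum (fun y => k * g y) = k * gsum g.
Proof.
move=> /finsupp_uniq[s us sg]; rewrite !(gsumE us)// ?mulr_sumr// => y ys.
by rewrite sg// mulr0.
Qed.

Lemma gsum_ge0 g : finsupp g -> (forall y, 0 <= g y) -> 0 <= gsum g.
Proof. by move=> /finsupp_uniq[s us sg] g0; rewrite (gsumE us)// sumr_ge0. Qed.

Lemma ler_gsum g h : finsupp g -> finsupp h -> (forall y, g y <= h y) ->
  gsum g <= gsum h.
Proof.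
move=> fg fh gh; have [s [us sg sh]] := finsupp2 fg fh.
by rewrite !(gsumE us)//; exact: ler_sum.
Qed.

Lemma gsum_shift (V : nmodType) (g : G ->
  V) (x : G) : gsum (fun y => g (y - x)) = gsum g.
Proof.
rewrite /gsum [RHS](reindex_fsbigT (fun y => y - x))//.
by exists (+%R^~ x) => y; rewrite ?subrK ?addrK.
Qed.

Lemma gsum_sum (V : nmodType) (I : Type) (s : seq I) (f : I -> G -> V) :
  (forall i, finsupp (f i)) ->
  gsum (fun y => \sum_(i <- s) f i y) = \sum_(i <- s) gsum (f i).
Proof.
move=> ff; elim: s => [|i s IH].
  rewrite big_nil (@gsumE _ [::])// ?big_nil// => y _; exact: big_nil.
rewrite big_cons -IH -gsumD//; last exact: finsupp_sum.
by congr gsum; apply/funext => y; rewrite big_cons.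
Qed.

Lemma gsum_ge1 g y : finsupp g -> (forall y, 0 <= g y) -> g y <= gsum g.
Proof.
move=> [t tg] g0; rewrite (@gsumE _ (undup (y :: t))) ?undup_uniq//; last first.
  by move=> z; rewrite mem_undup inE negb_or => /andP[_ /tg].
have yt : y \in undup (y :: t) by rewrite mem_undup mem_head.
by rewrite (big_rem _ yt)/= lerDl sumr_ge0.
Qed.

Lemma ler_cmod_gsum (f : G -> complex R) : finsupp f ->
  cmod (gsum f) <= gsum (fun y => cmod (f y)).
Proof.
move=> /finsupp_uniq[s us sf]; rewrite !(gsumE us)// => [|y ys].
  exact: ler_cmod_sum.
by rewrite sf// cmod0.
Qed.

End gsum.

(** * Band operators *)

Section cmeasurable_theory.
Variables (R : realType) (d : nat).
Local Notation Rd := 'rV[R]_d.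
Local Notation C := (complex R).
Implicit Types (m : Rd -> C).

Lemma measurable_translation (x : Rd) :
  measurable_fun [set: Rd] (fun y : Rd => y - x).
Proof.
apply: measurable_fun_rVP => i.
rewrite (_ : _ \o _ = fun y : Rd => (@coord_rV R d i y : R) - x ord0 i).
  by apply: measurable_funB => //; exact: measurable_coord_rV.
by apply/funext => y; rewrite /coord_rV /= !mxE.
Qed.

Lemma cmeasurable_shift m x : cmeasurable m -> cmeasurable (fun y => m (y - x)).
Proof.
by move=> [mr mi]; split;
  [apply: (measurableT_comp mr) | apply: (measurableT_comp mi)];
  exact: measurable_translation.
Qed.

Lemma cmeasurable_cst (c : C) : cmeasurable (fun _ : Rd => c).
Proof. by split; exact: measurable_cst. Qed.

Lemma cmeasurableD m1 m2 : cmeasurable m1 -> cmeasurable m2 ->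
  cmeasurable (fun y => m1 y + m2 y).
Proof.
move=> [r1 i1] [r2 i2]; split.
  under eq_fun do rewrite raddfD /=; exact: measurable_funD.
under eq_fun do rewrite raddfD /=; exact: measurable_funD.
Qed.

Lemma cmeasurableM m1 m2 : cmeasurable m1 -> cmeasurable m2 ->
  cmeasurable (fun y => m1 y * m2 y).
Proof.
move=> [r1 i1] [r2 i2]; split.
  rewrite (_ : (fun y => _) = fun y => complex.Re (m1 y) * complex.Re (m2 y) -
      complex.Im (m1 y) * complex.Im (m2 y)).
    by apply: measurable_funB; apply: measurable_funM.
  by apply/funext => y; case: (m1 y) => ? ?; case: (m2 y).
rewrite (_ : (fun y => _) = fun y => complex.Re (m1 y) * complex.Im (m2 y) +
    complex.Im (m1 y) * complex.Re (m2 y)).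
  by apply: measurable_funD; apply: measurable_funM.
by apply/funext => y; case: (m1 y) => ? ?; case: (m2 y).
Qed.

Lemma cmeasurable_conj m : cmeasurable m -> cmeasurable (fun y => conjc (m y)).
Proof.
move=> [mr mi]; split.
  by rewrite (_ : (fun y => _) = fun y => complex.Re (m y))//;
    apply/funext => y; case: (m y).
rewrite (_ : (fun y => _) = fun y => - complex.Im (m y)).
  exact: measurable_funN.
by apply/funext => y; case: (m y).
Qed.

Lemma measurable_cmod m : cmeasurable m ->
  measurable_fun [set: Rd] (fun y => cmod (m y)).
Proof.
move=> [mr mi]; under eq_fun do rewrite cmodE.
apply: (measurableT_comp (f := @Num.sqrt R)).
  by apply: continuous_measurable_fun; exact: sqrt_continuous.
by apply: measurable_funD; apply: measurable_funX.
Qed.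

End cmeasurable_theory.

(** * The l^2 norm of finitely supported functions *)

Section square_norm.
Variables (R : realType) (G : zmodType).
Local Notation C := (complex R).
Implicit Types f g : G -> C.

Definition sqnorm f : R := gsum (fun y => cmod (f y) ^+ 2).

Lemma finsupp_cmod2 f : finsupp f -> finsupp (fun y => cmod (f y) ^+ 2).
Proof. by move=> ff; apply: finsupp_dom ff _ => y ->; rewrite cmod0 expr0n. Qed.
Local Hint Resolve finsupp_cmod2 : core.

Lemma sqnorm_ge0 f : finsupp f -> 0 <= sqnorm f.
Proof. by move=> ff; apply: gsum_ge0 => [|y];
  [exact: finsupp_cmod2|exact: sqr_ge0]. Qed.

Lemma ler_cmod_sqnorm f y : finsupp f -> cmod (f y) ^+ 2 <= sqnorm f.
Proof.
move=> ff; apply: (gsum_ge1 (g := fun y => cmod (f y) ^+ 2)) => [|z].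
  exact: finsupp_cmod2.
exact: sqr_ge0.
Qed.

Lemma sqnorm_shift f x : sqnorm (fun y => f (y - x)) = sqnorm f.
Proof. exact: (gsum_shift (fun y => cmod (f y) ^+ 2)). Qed.

Lemma sqnorm_le f g (k : R) : finsupp f -> finsupp g -> 0 <= k ->
  (forall y, cmod (f y) <= k * cmod (g y)) -> sqnorm f <= k ^+ 2 * sqnorm g.
Proof.
move=> ff fg k0 fkg; rewrite /sqnorm -gsumZ; last exact: finsupp_cmod2.
apply: ler_gsum; first exact: finsupp_cmod2.
  by apply: finsupp_dom fg _ => y ->; rewrite cmod0 expr0n mulr0.
move=> y; rewrite -exprMn ler_pXn2r ?nnegrE ?mulr_ge0 ?cmod_ge0//.
Qed.


(** The triangle inequality for squared norms, from a b (|f| + |g|)^2 <= (a + b) (b |f|^2 + a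
    |g|^2), where the difference of the two sides is the square of b |f| - a |g|. If a or b is 0,
    the corresponding function vanishes. *)
Lemma sqnorm_add f g (a b X : R) : finsupp f -> finsupp g -> 0 <= a -> 0 <= b ->
  sqnorm f <= a ^+ 2 * X -> sqnorm g <= b ^+ 2 * X ->
  sqnorm (fun y => f y + g y) <= (a + b) ^+ 2 * X.
Proof.
move=> ff fg a0 b0 fX gX.
have zero h : finsupp h -> sqnorm h <= 0 -> forall y, h y = 0.
  move=> fh h0 y; apply: cmod_eq0; apply/eqP.
  by rewrite -sqrf_eq0 eq_le sqr_ge0 andbT (le_trans (ler_cmod_sqnorm _ fh)).
have [a_eq0|an0] := eqVneq a 0.
  move: fX gX; rewrite a_eq0 expr0n/= mul0r add0r => fX gX.
  have f0 := zero _ ff fX.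
  by under eq_fun do rewrite f0 add0r.
have [b_eq0|bn0] := eqVneq b 0.
  move: fX gX; rewrite b_eq0 expr0n/= mul0r addr0 => fX gX.
  have g0 := zero _ fg gX.
  by under eq_fun do rewrite g0 addr0.
have {an0}a_gt0 : 0 < a by rewrite lt_def an0.
have {bn0}b_gt0 : 0 < b by rewrite lt_def bn0.
have pt y : (a * b) * cmod (f y + g y) ^+ 2 <=
    ((a + b) * b) * cmod (f y) ^+ 2 + ((a + b) * a) * cmod (g y) ^+ 2.
  apply: (@le_trans _ _ ((a * b) * (cmod (f y) + cmod (g y)) ^+ 2)).
    rewrite ler_pM2l ?mulr_gt0// ler_pXn2r ?nnegrE ?addr_ge0 ?cmod_ge0//.
    exact: ler_cmodD.
  rewrite -subr_ge0.
  rewrite (_ : _ - _ = (b * cmod (f y) - a * cmod (g y)) ^+ 2); last by ring.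
  exact: sqr_ge0.
have ffg := finsuppD ff fg.
have Z (k : R) (h : G -> C) : finsupp h ->
    finsupp (fun y => k * cmod (h y) ^+ 2).
  by move=> fh; apply: finsupp_dom fh _ => y ->; rewrite cmod0 expr0n mulr0.
have h : (a * b) * sqnorm (fun y => f y + g y) <=
    ((a + b) * b) * sqnorm f + ((a + b) * a) * sqnorm g.
  rewrite /sqnorm -!gsumZ; try exact: finsupp_cmod2.
  rewrite -gsumD; try exact: Z.
  apply: ler_gsum => //; first exact: (Z _ _ ffg).
  by apply: finsuppD; exact: Z.
rewrite -(ler_pM2l (mulr_gt0 a_gt0 b_gt0)); apply: le_trans h _.
apply: (@le_trans _ _ ((a + b) * b * (a ^+ 2 * X) + (a + b) * a * (b ^+ 2 *
  X))).
  by apply: lerD; rewrite ler_pM2l// mulr_gt0// addr_gt0.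
by rewrite le_eqVlt; apply/orP; left; apply/eqP; ring.
Qed.

Definition delta (x : G) : G -> C := fun y => (y == x)%:R.

Lemma finsupp_delta x : finsupp (delta x).
Proof. by exists [:: x] => y; rewrite inE /delta => /negbTE ->. Qed.

Lemma sqnorm_delta x : sqnorm (delta x) = 1.
Proof.
rewrite /sqnorm (@gsumE _ _ [:: x])// => [|y].
  by rewrite big_seq1 /delta eqxx cmod1 expr1n.
by rewrite inE /delta => /negbTE ->; rewrite cmod0 expr0n.
Qed.

End square_norm.

Section band_operators.
Variables (R : realType) (d : nat).
Local Notation Rd := 'rV[R]_d.
Local Notation C := (complex R).
Local Notation op := ((Rd -> C) -> (Rd -> C)).
Variable w : Rd -> R.
Hypotheses (w0 : w 0 = 1) (w_ge1 : forall x, 1 <= w x)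
  (wD : forall x y, w (x + y) <= w x * w y).
Implicit Types (P : set Rd) (L : op) (l u : R) (f g : Rd -> C).

Let w_ge0 x : 0 <= w x. Proof. exact: le_trans (w_ge1 x). Qed.

(* Finite sums of atoms m T_x with x in P; l bounds the A_w-norm. *)
Inductive Aw P : op -> R -> Prop :=
| Aw0 l : 0 <= l -> Aw P (fun _ _ => 0) l
| Aw_cons x m u L k l : P x -> cmeasurable m -> (forall y, cmod (m y) <= u) ->
    Aw P L k -> u * w x + k <= l ->
    Aw P (fun f y => m y * f (y - x) + L f y) l.

Let bound_ge0 (m : Rd -> C) u : (forall y, cmod (m y) <= u) -> 0 <= u.
Proof. by move=> mu; apply: le_trans (cmod_ge0 _) (mu 0). Qed.

Lemma Aw_ge0 P L l : Aw P L l -> 0 <= l.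
Proof.
elim=> // x m u {}L k {}l Px _ mu _ k0; apply: le_trans.
by rewrite addr_ge0// mulr_ge0// (bound_ge0 mu).
Qed.

Lemma Aw_le P L l l' : l <= l' -> Aw P L l -> Aw P L l'.
Proof.
move=> ll' AL; case: AL ll' => [k k0|x m u L1 k k' Px mm mu AL1 h] ll'.
  by apply: Aw0; apply: le_trans ll'.
by apply: Aw_cons Px mm mu AL1 _; apply: le_trans ll'.
Qed.

Lemma Aw_ext P L L' l : L =2 L' -> Aw P L l -> Aw P L' l.
Proof. by move=> LL'; rewrite (_ : L = L')//; by do 2!apply/funext => ?;
  exact: LL'. Qed.

Lemma Aw_sub P P' L l : P `<=` P' -> Aw P L l -> Aw P' L l.
Proof.
move=> PP'; elim=> [k|x m u {}L k k' /PP' Px mm mu _ IH]; first exact: Aw0.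
exact: Aw_cons.
Qed.

Lemma Aw_add P L1 L2 l1 l2 : Aw P L1 l1 -> Aw P L2 l2 ->
  Aw P (fun f y => L1 f y + L2 f y) (l1 + l2).
Proof.
move=> A1 A2; elim: A1 => [k k0|x m u L k k' Px mm mu _ IH kk'].
  apply: Aw_ext (Aw_le _ A2); last by rewrite lerDr.
  by move=> f y; rewrite add0r.
apply: (@Aw_ext _ (fun f y => m y * f (y - x) + (L f y + L2 f y))).
  by move=> f y; rewrite addrA.
by apply: Aw_cons Px mm mu IH _; rewrite addrA lerD2r.
Qed.

Lemma Aw_atom P x m u : P x -> cmeasurable m -> (forall y, cmod (m y) <= u) ->
  Aw P (fun f y => m y * f (y - x)) (u * w x).
Proof.
move=> Px mm mu; apply: (@Aw_ext _ (fun f y => m y * f (y - x) + 0)).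
  by move=> f y; rewrite addr0.
by apply: Aw_cons Px mm mu (Aw0 P (lexx 0)) _; rewrite addr0.
Qed.

(** The product of m T_x and m' T_x' is the atom m m'(. - x) T_(x + x'), and w is submultiplicative.
    The supports have separate predicates because the word expansion has to track them. *)
Lemma Aw_comp P1 P2 P L1 L2 l1 l2 :
  (forall x y, P1 x -> P2 y -> P (x + y)) -> Aw P1 L1 l1 -> Aw P2 L2 l2 ->
  Aw P (L1 \o L2) (l1 * l2).
Proof.
move=> PD A1 A2; have l2_ge0 := Aw_ge0 A2.
elim: A1 => [k k0|x m u L k k' Px mm mu _ IH kk'].
  by apply: Aw0; exact: mulr_ge0.
have u0 := bound_ge0 mu.
have {PD} : Aw P (fun f y => m y * L2 f (y - x)) (u * w x * l2).
  elim: A2 {IH} => [j j0|x' m' u' L' j j' Px' mm' mu' _ IH' jj'].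
    apply: (@Aw_ext _ (fun _ _ => 0)); first by move=> f y; rewrite mulr0.
    by apply: Aw0; rewrite !mulr_ge0.
  have u0' := bound_ge0 mu'.
  apply: (@Aw_ext _ (fun f y =>
      (m y * m' (y - x)) * f (y - (x + x')) + m y * L' f (y - x))).
    by move=> f y; rewrite mulrDr mulrA opprD addrA.
  apply: Aw_cons (PD _ _ Px Px') _ _ IH' _.
  - by apply: cmeasurableM => //; exact: cmeasurable_shift.
  - by move=> y; rewrite cmodM; apply: ler_pM (cmod_ge0 _) (cmod_ge0 _) (mu _)
    (mu' _).
  - apply: le_trans (_ : u * w x * (u' * w x' + j) <= _); last first.
      by rewrite ler_wpM2l// mulr_ge0.
    rewrite mulrDr lerD2r mulrACA ler_wpM2l// mulr_ge0//.
move=> /Aw_add /(_ IH); apply: Aw_le.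
by rewrite -mulrDl ler_wpM2r.
Qed.

Lemma Aw_id P : P 0 -> Aw P id 1.
Proof.
move=> P0; have := @Aw_atom P 0 (fun _ => 1) 1 P0 (cmeasurable_cst d 1).
rewrite w0 mulr1 => H.
apply: Aw_ext (H _) => [f y|y]; last by rewrite cmod1.
by rewrite mul1r subr0.
Qed.

Lemma Aw_scale P L l (c : C) : Aw P L l ->
  Aw P (fun f y => c * L f y) (cmod c * l).
Proof.
move=> AL.
have A0 : Aw [set 0] (fun f y => c * f (y - 0)) (cmod c * w 0).
  by apply: Aw_atom => //; exact: cmeasurable_cst.
have := @Aw_comp _ _ P _ _ _ _ _ A0 AL; rewrite w0 mulr1 => H.
apply: Aw_ext (H _) => [f y|x y -> Py]; first by rewrite /= subr0.
by rewrite add0r.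
Qed.

Lemma Aw_sub_op P L1 L2 l1 l2 : Aw P L1 l1 -> Aw P L2 l2 ->
  Aw P (fun f y => L1 f y - L2 f y) (l1 + l2).
Proof.
move=> A1 /(Aw_scale (-1)); rewrite cmodN cmod1 mul1r => /(Aw_add A1).
by apply: Aw_ext => f y; rewrite mulN1r.
Qed.

Lemma Aw_linear P L l (c : C) f g : Aw P L l ->
  L (fun y => c * f y + g y) = fun y => c * L f y + L g y.
Proof.
elim=> [k k0|x m u {}L k k' Px mm mu _ IH kk'].
  by apply/funext => y; rewrite mulr0 addr0.
by apply/funext => y; rewrite IH; ring.
Qed.

Lemma Aw_linearD P L l f g : Aw P L l ->
  L (fun y => f y + g y) = fun y => L f y + L g y.
Proof.
move=> AL; have := Aw_linear 1 f g AL.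
under eq_fun do rewrite mul1r.
by move=> ->; apply/funext => y; rewrite mul1r.
Qed.

Lemma Aw_linearB P L l f g : Aw P L l ->
  L (fun y => f y - g y) = fun y => L f y - L g y.
Proof.
move=> AL; have := Aw_linear (-1) g f AL.
under eq_fun do rewrite mulN1r addrC.
by move=> ->; apply/funext => y; rewrite mulN1r addrC.
Qed.

Lemma Aw_linear0 P L l : Aw P L l -> L (fun _ => 0) = fun _ => 0.
Proof.
move=> AL; have := Aw_linearB (fun _ => 0) (fun _ => 0) AL.
under eq_fun do rewrite subrr.
by move=> ->; apply/funext => y; rewrite subrr.
Qed.

Lemma Aw_linearZ P L l (c : C) f : Aw P L l ->
  L (fun y => c * f y) = fun y => c * L f y.
Proof.
move=> AL; have := Aw_linear c f (fun _ => 0) AL.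
under eq_fun do rewrite addr0.
by move=> ->; apply/funext => y; rewrite (Aw_linear0 AL) addr0.
Qed.

Lemma Aw_finsupp P L l f : Aw P L l -> finsupp f -> finsupp (L f).
Proof.
move=> AL ff; elim: AL => [k k0|x m u {}L k k' Px mm mu _ IH kk'].
  exact: finsupp0.
apply: finsuppD => //; apply: finsupp_dom (finsupp_shift x ff) _ => y ->.
by rewrite mulr0.
Qed.

Lemma Aw_sqnorm P L l f : Aw P L l -> finsupp f -> sqnorm (L f) <=
  l ^+ 2 * sqnorm f.
Proof.
move=> AL ff; have f0 := sqnorm_ge0 ff.
elim: AL => [k k0|x m u {}L k k' Px mm mu AL IH kk'].
  rewrite /sqnorm (@gsumE _ _ [::])// => [|y _]; last by rewrite cmod0 expr0n.
  by rewrite big_nil mulr_ge0// sqr_ge0.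
have u0 := bound_ge0 mu; have k0 := Aw_ge0 AL.
apply: (@le_trans _ _ ((u + k) ^+ 2 * sqnorm f)).
  apply: sqnorm_add => //.
  - by apply: finsupp_dom (finsupp_shift x ff) _ => y ->; rewrite mulr0.
  - exact: Aw_finsupp AL ff.
  - rewrite -(sqnorm_shift f x); apply: sqnorm_le => //.
    + by apply: finsupp_dom (finsupp_shift x ff) _ => y ->; rewrite mulr0.
    + exact: finsupp_shift.
    + by move=> y; rewrite cmodM ler_wpM2r// cmod_ge0.
apply: ler_wpM2r => //; rewrite ler_pXn2r ?nnegrE ?addr_ge0//; last first.
  by apply: le_trans kk'; rewrite addr_ge0// mulr_ge0.
by apply: le_trans kk'; rewrite lerD2r ler_peMr.
Qed.

(** The coefficient of T_x at y, read off as the matrix entry (y, y - x). A derivation of [Aw] may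
    contain several atoms with the same x, so the functions in its atoms are not intrinsic. *)
Definition opcoef L (x : Rd) : Rd -> C := fun y => L (delta R (y - x)) y.

Lemma opcoef_cons x m L z y :
  opcoef (fun f y => m y * f (y - x) + L f y) z y = m y * (x == z)%:R + opcoef
    L z y.
Proof. by rewrite /opcoef /delta (inj_eq (addrI y)) (inj_eq oppr_inj). Qed.

Lemma Aw_opcoef_expand P L l (X : seq Rd) f y : Aw P L l -> uniq X ->
  (forall x, P x -> x \in X) -> L f y = \sum_(x <- X) opcoef L x y * f (y - x).
Proof.
move=> AL uX PX; elim: AL => [k k0|x m u {}L k k' Px mm mu _ IH kk'].
  by rewrite big1// => x _; rewrite /opcoef mul0r.
under eq_bigr do rewrite (opcoef_cons x m L) mulrDl.
rewrite big_split /= -IH; congr (_ + _).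
rewrite (bigD1_seq x)//=; last exact: PX.
rewrite eqxx mulr1 big1 ?addr0// => z; rewrite eq_sym => /negbTE ->.
by rewrite mulr0 mul0r.
Qed.

Lemma Aw_opcoef_measurable P L l x : Aw P L l -> cmeasurable (opcoef L x).
Proof.
elim=> [k k0|z m u {}L k k' Pz mm mu _ IH kk']; first exact: cmeasurable_cst.
rewrite (_ : opcoef _ x = fun y => m y * (z == x)%:R + opcoef L x y).
  by apply: cmeasurableD => //; apply: cmeasurableM => //;
    exact: cmeasurable_cst.
by apply/funext => y; rewrite (opcoef_cons z m L).
Qed.

(** [g x] adds up the bounds of all atoms at x. It majorizes the x-th coefficient everywhere, and
    its weighted sum stays below [l]: this turns a bound in [Aw] into a bound on the A_w-norm. *)
Lemma Aw_opcoef_bound P L l : Aw P L l -> exists g : Rd -> R,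
  [/\ forall x, 0 <= g x, forall x y, cmod (opcoef L x y) <= g x &
    forall X, uniq X -> \sum_(x <- X) g x * w x <= l].
Proof.
elim=> [k k0|z m u {}L k k' Pz mm mu _ [g [g0 gL gX]] kk'].
  exists (fun _ => 0); split => // [x y|X _]; first by rewrite /opcoef cmod0.
  by rewrite big1// => x _; rewrite mul0r.
have u0 := bound_ge0 mu.
exists (fun x => u * (z == x)%:R + g x); split.
- by move=> x; rewrite addr_ge0// mulr_ge0// ler0n.
- move=> x y; rewrite (opcoef_cons z m L) (le_trans (ler_cmodD _ _))// lerD//.
  rewrite cmodM; case: (z == x); last by rewrite cmod0 !mulr0.
  by rewrite cmod1 !mulr1.
- move=> X uX; under eq_bigr do rewrite mulrDl.
  rewrite big_split/=; apply: le_trans kk'; rewrite lerD ?gX//.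
  have [zX|zX] := boolP (z \in X).
    rewrite (bigD1_seq z)//= eqxx mulr1 big1 ?addr0// => x.
    by rewrite eq_sym => /negbTE ->; rewrite mulr0 mul0r.
  rewrite big_seq big1 ?mulr_ge0// => x xX.
  case: eqP => [zx|]; last by rewrite mulr0 mul0r.
  by move: zX; rewrite zx xX.
Qed.

Lemma Aw_finite_support P L l : Aw P L l ->
  exists X : seq Rd, Aw [set x | x \in X] L l.
Proof.
elim=> [k k0|z m u {}L k k' Pz mm mu _ [X AX] kk'].
  by exists [::]; exact: Aw0.
exists (z :: X); apply: Aw_cons mm mu _ kk'; first exact: mem_head.
by apply: Aw_sub AX => x /= xX; rewrite inE xX orbT.
Qed.

(* Each coefficient is an l^2 inner product with deltas, hence at most u. *)
Lemma Aw_collect P P' L l u (X : seq Rd) : Aw P L l -> uniq X ->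
  (forall x, P x -> x \in X) -> (forall x, x \in X -> P' x) -> 0 <= u ->
  (forall f, finsupp f -> sqnorm (L f) <= u ^+ 2 * sqnorm f) ->
  Aw P' L (u * \sum_(x <- X) w x).
Proof.
move=> AL uX PX XP' u0 Lu.
have cu x y : cmod (opcoef L x y) <= u.
  rewrite -(@ler_pXn2r _ 2) ?nnegrE ?cmod_ge0//.
  apply: le_trans (ler_cmod_sqnorm y (Aw_finsupp AL (finsupp_delta _ _))) _.
  by apply: le_trans (Lu _ (finsupp_delta _ _)) _; rewrite sqnorm_delta mulr1.
apply: (@Aw_ext _ (fun f y => \sum_(x <- X) opcoef L x y * f (y - x))).
  by move=> f y; rewrite -(Aw_opcoef_expand _ _ AL uX PX).
move: XP' => {uX PX}; elim: X => [|x X IH] XP'.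
  rewrite big_nil mulr0; apply: Aw_ext (Aw0 _ (lexx _)) => f y.
  by rewrite big_nil.
apply: (@Aw_ext _ (fun f y => opcoef L x y * f (y - x) +
    \sum_(x <- X) opcoef L x y * f (y - x))); first by move=> f y;
      rewrite big_cons.
apply: Aw_cons (Aw_opcoef_measurable x AL) (cu x) (IH _) _.
- exact/XP'/mem_head.
- by move=> z zX; apply: XP'; rewrite inE zX orbT.
- by rewrite big_cons mulrDr.
Qed.

End band_operators.

(** * The word expansion *)

Section subexponential_growth.
Variables (R : realType) (d : nat).
Local Notation Rd := 'rV[R]_d.
Local Notation C := (complex R).
Local Notation op := ((Rd -> C) -> (Rd -> C)).
Variable w : Rd -> R.
Hypotheses (w0 : w 0 = 1) (w_ge1 : forall x, 1 <= w x)
  (wD : forall x y, w (x + y) <= w x * w y)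
  (w_growth : forall x (q : R), 1 < q ->
    exists2 A, 0 <= A & forall k, w (x *+ k) <= A * q ^+ k).

Let w_ge0 x : 0 <= w x. Proof. exact: le_trans (w_ge1 x). Qed.

(** The sums n_1 x_1 + ... + n_r x_r with 0 <= n_i <= k, where F lists the x_i. By commutativity the
    sum of any k members of F is among these (k + 1)^r values, which is why supports grow only
    polynomially. *)
Fixpoint boxes (F : seq Rd) (k : nat) : seq Rd :=
  if F is x :: F' then [seq x *+ i + s | i <- iota 0 k.+1, s <- boxes F' k]
  else [:: 0].

Lemma boxes_mono F k k' : (k <= k')%N -> {subset boxes F k <= boxes F k'}.
Proof.
move=> kk'; elim: F => [//|x F IH] y.
move=> /allpairsPdep[i [s [ik sF ->]]]; apply/allpairsPdep; exists i, s;
  split => //.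
  by move: ik; rewrite !mem_iota /= !add0n => /leq_trans; apply.
exact: IH.
Qed.

Lemma boxes0 F k : 0 \in boxes F k.
Proof.
elim: F => [|x F IH]; first by rewrite inE.
by apply/allpairsPdep; exists 0%N, 0; rewrite mulr0n addr0.
Qed.

Lemma boxesS F k x s : x \in F -> s \in boxes F k -> x + s \in boxes F k.+1.
Proof.
elim: F s => [//|z F IH] s.
rewrite inE => /orP[/eqP->|xF] /allpairsPdep[i [t [ik tF ->]]].
  apply/allpairsPdep; exists i.+1, t; split.
  - by move: ik; rewrite !mem_iota !add0n.
  - exact: boxes_mono tF.
  - by rewrite mulrS addrA.
apply/allpairsPdep; exists i, (x + t); split.
- by move: ik; rewrite !mem_iota !add0n /= => /ltnW.
- exact: IH.
- by rewrite addrCA.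
Qed.

Definition box_weight F k : R := \sum_(z <- boxes F k) w z.

Lemma box_weight_ge0 F k : 0 <= box_weight F k.
Proof. exact: sumr_ge0. Qed.

(** The growth condition on w concerns one ray at a time; submultiplicativity bounds the weight of a
    box by a product over its rays. *)
Lemma box_weight_growth F (q : R) : 1 < q ->
  exists2 A, 0 <= A & forall k, box_weight F k <= A * q ^+ k.
Proof.
elim: F q => [|x F IH] q q1.
  exists 1; first by []; move=> k.
  by rewrite /box_weight big_seq1 w0 mul1r exprn_ege1// ltW.
(* One factor q' pays for the ray of the new generator, the other for the box of the remaining
   ones. *)
have [q' [q'1 q'q]] : exists q', 1 < q' /\ q' ^+ 2 = q.
  exists (Num.sqrt q); split; last by rewrite sqr_sqrtr// (le_trans ler01)//
    ltW.
  by rewrite -sqrtr1 ltr_sqrt// (lt_trans ltr01).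
have q'0 : 0 < q' by apply: lt_trans q'1.
have [A A0 FA] := IH _ q'1; have [B B0 xB] := w_growth x q'1.
have geo k : \sum_(i <- iota 0 k.+1) q' ^+ i <= q' / (q' - 1) * q' ^+ k.
  rewrite mulrAC -exprS ler_pdivlMr ?subr_gt0// mulrC.
  rewrite (_ : iota 0 k.+1 = index_iota 0 k.+1)// big_mkord -subrX1.
  by rewrite lerBlDr lerDl.
exists (B * (q' / (q' - 1)) * A).
  by rewrite !mulr_ge0// ?invr_ge0 ?subr_ge0 ltW.
move=> k.
rewrite /box_weight (_ : boxes _ _ =
  [seq x *+ i + s | i <- iota 0 k.+1, s <- boxes F k])// big_allpairs_dep.
apply: (@le_trans _ _ (\sum_(i <- iota 0 k.+1) (B * q' ^+ i) * (A * q' ^+ k))).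
  apply: ler_sum => i _; apply: le_trans (_ : w (x *+ i) * box_weight F k <= _).
    by rewrite /box_weight mulr_sumr; apply: ler_sum => s _; exact: wD.
  by apply: ler_pM => //; exact: box_weight_ge0.
rewrite -mulr_suml -mulr_sumr -q'q -exprM mulnC exprM expr2.
rewrite [leRHS](_ : _ = B * (q' / (q' - 1) * q' ^+ k) * (A * q' ^+ k)).
  by rewrite ler_wpM2r ?mulr_ge0 ?exprn_ge0 ?(ltW q'0)// ler_wpM2l.
by ring.
Qed.

Definition l2bound (L : op) (u : R) :=
  forall f, finsupp f -> sqnorm (L f) <= u ^+ 2 * sqnorm f.

Lemma sum_undup_le (T : choiceType) (s : seq T) (g : T -> R) :
  (forall x, 0 <= g x) -> \sum_(x <- undup s) g x <= \sum_(x <- s) g x.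
Proof.
move=> g0; elim: s => [|x s IH] /=; first by rewrite !big_nil.
by case: ifP => _; rewrite !big_cons ?lerD2l// ler_wpDl.
Qed.

Lemma Aw_iter P T l n : (forall x y, P x -> P y -> P (x + y)) -> P 0 ->
  Aw w P T l -> Aw w P (iter n T) (l ^+ n).
Proof.
move=> PD P0 AT; elim: n => [|n IH]; first exact: Aw_id.
rewrite exprS; exact: (Aw_comp w_ge1 wD PD AT IH).
Qed.

Lemma l2bound_comp P L1 L2 l u1 u2 : Aw w P L2 l -> 0 <= u1 ->
  l2bound L1 u1 -> l2bound L2 u2 -> l2bound (L1 \o L2) (u1 * u2).
Proof.
move=> A2 u10 b1 b2 f ff; apply: le_trans (b1 _ (Aw_finsupp A2 ff)) _.
by rewrite exprMn -[leRHS]mulrA; apply: ler_wpM2l; [exact: sqr_ge0|exact: b2].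
Qed.

(* Expanding (b + r)^n into words: a word containing j atoms of r has support
   in a translate of boxes F n, so its A_w-norm is controlled by its l^2-norm,
   in which the powers of b only contribute b's l^2-norm. *)
Lemma word_bound F b lb be r rho : 0 <= be ->
  Aw w [set x | x \in F] b lb -> l2bound b be -> Aw w setT r rho ->
  forall n k x0 D l u, 0 <= u ->
  Aw w [set x | exists2 s, s \in boxes F k & x = x0 + s] D l -> l2bound D u ->
  Aw w setT (iter n (fun f y => b f y + r f y) \o D)
    (w x0 * u * box_weight F (n + k) * (be + rho) ^+ n).
Proof.
move=> be0 Ab bbe Ar; have rho0 := Aw_ge0 w_ge1 Ar.
set T := (fun f y => b f y + r f y).
have AT : Aw w setT T (lb + rho).
  by apply: Aw_add => //; apply: Aw_sub Ab.
have ATn n : Aw w setT (iter n T) ((lb + rho) ^+ n) by exact: Aw_iter.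
elim=> [|n IH] k x0 D l u u0 AD Du.
  rewrite expr0 mulr1 add0n.
  (* The word is complete: its coefficients are at most the l^2 bound u, so u times the weight of
     its support bounds it. Repetitions in the box are dropped because [Aw_collect] asks for a
     duplicate-free support. *)
  pose X := undup [seq x0 + s | s <- boxes F k].
  apply: (@Aw_le _ _ _ _ _ (u * \sum_(x <- X) w x)).
    rewrite [w x0 * u]mulrC -mulrA ler_wpM2l//.
    apply: le_trans (sum_undup_le _ w_ge0) _; rewrite big_map mulr_sumr.
    by apply: ler_sum => s _; exact: wD.
  apply: (Aw_collect AD (undup_uniq _)) => // x [s sF ->].
  by rewrite mem_undup; apply/mapP; exists s.
(* The letter next to D is expanded. A factor b enlarges the box by one step and multiplies the l^2
   bound by be; an atom of r moves the base point x0. *)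
have -> : iter n.+1 T \o D =
    (fun f y => (iter n T \o (b \o D)) f y + (iter n T \o (r \o D)) f y).
  apply/funext => f; rewrite /comp iterSr {2}/T.
  by rewrite -(Aw_linearD _ _ (ATn n)).
set W := box_weight F (n.+1 + k).
have W0 : 0 <= W by exact: box_weight_ge0.
have q0 : 0 <= (be + rho) ^+ n by rewrite exprn_ge0// addr_ge0.
have Ab' : Aw w setT (iter n T \o (b \o D))
    (w x0 * (be * u) * W * (be + rho) ^+ n).
  rewrite /W addSnnS; apply: (IH k.+1 x0 _ (lb * l) (be * u)).
  - exact: mulr_ge0.
  - apply: (Aw_comp w_ge1 wD) _ Ab AD => //= x y xF [s sF ->].
    by exists (x + s); [exact: boxesS|rewrite addrCA].
  - exact: l2bound_comp AD _ _ _.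
(* The induction runs over the atoms of r, while the r inside T has to stay fixed; hence the copy
   r'. *)
suff Ar' r' rho' : Aw w setT r' rho' -> Aw w setT (iter n T \o (r' \o D))
    (w x0 * (rho' * u) * W * (be + rho) ^+ n).
  apply: Aw_le (Aw_add Ab' (Ar' _ _ Ar)).
  by rewrite exprS le_eqVlt; apply/orP; left; apply/eqP; ring.
elim=> [j j0|x m v L j j' _ mm mv AL IHL jj'].
  apply: (@Aw_ext _ _ _ _ (fun _ _ => 0)).
    by move=> f y /=; rewrite (Aw_linear0 (ATn n)).
  by apply: Aw0; rewrite !mulr_ge0.
have v0 : 0 <= v by apply: le_trans (cmod_ge0 _) (mv 0).
pose D' := (fun f y => m y * f (y - x)) \o D.
apply: (@Aw_ext _ _ _ _ (fun f y => (iter n T \o D') f y +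
    (iter n T \o (L \o D)) f y)).
  by move=> f y; rewrite -(congr1 (@^~ y) (Aw_linearD (D' f) (L (D f)) (ATn
    n))).
have AD' : Aw w setT (iter n T \o D')
    (w (x + x0) * (v * u) * W * (be + rho) ^+ n).
  rewrite /W addSnnS; apply: (IH k.+1 (x + x0) D' (v * w x * l)).
  - exact: mulr_ge0.
  - have Am := Aw_atom (P := [set x]) w erefl mm mv.
    apply: (Aw_comp w_ge1 wD) _ Am AD => //= z y -> [s sF ->].
    exists s; last by rewrite addrA.
    by apply: boxes_mono sF.
  - apply: (l2bound_comp AD) => // f ff.
    rewrite -(sqnorm_shift f x); apply: sqnorm_le => //.
    + by apply: finsupp_dom (finsupp_shift x ff) _ => y ->; rewrite mulr0.
    + exact: finsupp_shift.
    + by move=> y; rewrite cmodM ler_wpM2r// cmod_ge0.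
apply: Aw_le (Aw_add AD' IHL).
rewrite -mulrDl ler_wpM2r// -mulrDl ler_wpM2r//.
apply: (@le_trans _ _ (w x0 * u * (v * w x + j))); last first.
  by rewrite [j' * u]mulrC mulrA ler_wpM2l// mulr_ge0.
rewrite mulrDr lerD//; last by rewrite le_eqVlt; apply/orP; left; apply/eqP;
  ring.
apply: (@le_trans _ _ (w x * w x0 * (v * u))).
  by rewrite ler_wpM2r ?mulr_ge0.
by rewrite le_eqVlt; apply/orP; left; apply/eqP; ring.
Qed.

End subexponential_growth.

(** * Contractions and the Neumann series *)

Section inner_product.
Variables (R : realType) (G : zmodType).
Local Notation C := (complex R).
Implicit Types f g : G -> C.

(** The real part is enough: the squared norm of f - c g is expanded for real c only. *)
Definition re_ip f g : R := gsum (fun y => complex.Re (conjc (f y) * g y)).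

Lemma finsupp_re_ip f g : finsupp f ->
  finsupp (fun y => complex.Re (conjc (f y) * g y)).
Proof. by move=> ff; apply: finsupp_dom ff _ => y ->; rewrite conjc0 mul0r. Qed.

Lemma re_ip_sqnorm f : re_ip f f = sqnorm f.
Proof.
congr gsum; apply/funext => y; rewrite sqr_cmod; case: (f y) => a b /=.
by rewrite mulNr opprK -!expr2.
Qed.

Lemma sqnorm_subZ f g (c : R) : finsupp f -> finsupp g ->
  sqnorm (fun y => f y - (real_complex R c) * g y) =
  sqnorm f - 2 * c * re_ip f g + c ^+ 2 * sqnorm g.
Proof.
move=> ff fg; have h1 := finsupp_cmod2 ff; have h2 := finsupp_re_ip g ff.
have h3 := finsupp_cmod2 fg.
have Z (k : R) (h : G -> R) : finsupp h -> finsupp (fun y => k * h y).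
  by move=> fh; apply: finsupp_dom fh _ => y ->; rewrite mulr0.
rewrite /sqnorm /re_ip -mulNr -(gsumZ _ h2) -(gsumZ _ h3).
rewrite -(gsumD h1 (Z _ _ h2)) -gsumD; [|exact: finsuppD (Z _ _ h2)|exact: Z].
congr gsum; apply/funext => y; rewrite !sqr_cmod.
by case: (f y) => a b; case: (g y) => a' b' /=; ring.
Qed.

End inner_product.

Section neumann.
Variables (R : realType) (d : nat).
Local Notation Rd := 'rV[R]_d.
Local Notation C := (complex R).
Local Notation op := ((Rd -> C) -> (Rd -> C)).
Variable w : Rd -> R.
Hypotheses (w0 : w 0 = 1) (w_ge1 : forall x, 1 <= w x)
  (wD : forall x y, w (x + y) <= w x * w y)
  (w_growth : forall x (q : R), 1 < q ->
    exists2 A, 0 <= A & forall k, w (x *+ k) <= A * q ^+ k).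

(** With delta = al^-2 the left side is |e f|^2 - 2 delta |a f|^2 + delta^2 |a' a f|^2, and the last
    term is at most delta |a f|^2 because a' has norm at most al. What remains is |e f|^2 - delta |a
    f|^2, to which the lower bound applies. *)
Lemma contraction (e a a' : op) (al ka : R) : 0 < al ->
  Aw w setT e 1 -> Aw w setT a al -> Aw w setT a' al ->
  (forall f g, finsupp f -> finsupp g -> re_ip f (a' g) = re_ip (a f) g) ->
  (forall f, a (e f) = a f) ->
  (forall f, finsupp f -> ka * sqnorm (e f) <= sqnorm (a f)) ->
  forall f, finsupp f ->
  sqnorm (fun y => e f y - (real_complex R (al ^- 2)) * a' (a f) y) <=
  (1 - al ^- 2 * ka) * sqnorm (e f).
Proof.
move=> al0 Ae Aa Aa' adj ae low f ff.
have fe := Aw_finsupp Ae ff; have fa := Aw_finsupp Aa ff.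
have fa' := Aw_finsupp Aa' fa.
rewrite sqnorm_subZ// adj// ae re_ip_sqnorm.
have de0 : 0 < al ^- 2 by rewrite invr_gt0 exprn_gt0.
have h : (al ^- 2) ^+ 2 * sqnorm (a' (a f)) <= al ^- 2 * sqnorm (a f).
  apply: le_trans (_ : (al ^- 2) ^+ 2 * (al ^+ 2 * sqnorm (a f)) <= _).
    by rewrite ler_wpM2l ?sqr_ge0//; apply: Aw_sqnorm Aa' fa.
  by rewrite mulrA expr2 mulfVK// gt_eqF// exprn_gt0.
have := low _ ff; rewrite -(ler_pM2l de0) => h'.
by move: h h'; set x := sqnorm (e f); set y := sqnorm (a f); set z :=
  sqnorm (a' _); lra.
Qed.

Lemma Aw_bigsum P n (L : nat -> op) (l : nat -> R) :
  (forall i, Aw w P (L i) (l i)) ->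
  Aw w P (fun f y => \sum_(i < n) L i f y) (\sum_(i < n) l i).
Proof.
move=> AL; elim: n => [|n IH].
  rewrite big_ord0; apply: Aw_ext (Aw0 _ _ (lexx _)) => f y.
  by rewrite big_ord0.
rewrite big_ord_recr; apply: Aw_ext (Aw_add IH (AL n)) => f y.
by rewrite big_ord_recr.
Qed.

Lemma Aw_linear_sum P L l n (f : nat -> Rd -> C) : Aw w P L l ->
  L (fun y => \sum_(i < n) f i y) = fun y => \sum_(i < n) L (f i) y.
Proof.
move=> AL; elim: n => [|n IH].
  under eq_fun do rewrite big_ord0.
  by rewrite (Aw_linear0 AL); apply/funext => y; rewrite big_ord0.
under eq_fun do rewrite big_ord_recr.
by rewrite (Aw_linearD _ _ AL) IH; apply/funext => y; rewrite big_ord_recr.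
Qed.

Lemma geometric_small (A th eps : R) : 0 <= A -> 0 <= th -> th < 1 -> 0 < eps ->
  exists N, forall n, (N <= n)%N -> A * th ^+ n <= eps.
Proof.
move=> A0 th0 th1 e0.
have /cvgrPdist_le/(_ _ e0)[N _ HN] : A * th ^+ n @[n --> \oo] --> (0 : R).
  rewrite -[X in _ --> X](mulr0 A); apply: cvgMr.
  by apply: cvg_expr; rewrite ger0_norm.
exists N => n /HN; rewrite sub0r normrN ger0_norm// mulr_ge0// exprn_ge0//.
Qed.

Variables (e : op) (a a' : nat -> op) (al ka : R).
Hypotheses (al0 : 0 < al) (ka0 : 0 < ka) (Ae : Aw w setT e 1)
  (Aa : forall j, Aw w setT (a j) al) (Aa' : forall j, Aw w setT (a' j) al)
  (adj : forall j f g, finsupp f -> finsupp g ->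
    re_ip f (a' j g) = re_ip (a j f) g)
  (ee : forall f, e (e f) = e f) (ae : forall j f, a j (e f) = a j f)
  (low : forall j f, finsupp f -> ka * sqnorm (e f) <= sqnorm (a j f))
  (a_cauchy : forall eps, 0 < eps -> exists J, forall i j, (J <= j <= i)%N ->
    Aw w setT (fun f y => a i f y - a j f y) eps /\
    Aw w setT (fun f y => a' i f y - a' j f y) eps).

Let de := al ^- 2.
Let de0 : 0 < de. Proof. by rewrite invr_gt0 exprn_gt0. Qed.
(** [e] takes the place of the identity: [a j] annihilates f - e f, so it is bounded below only
    modulo the kernel of [e]. *)
Let T j : op := fun f y => e f y - (real_complex R de) * a' j (a j f) y.

Let cmod_de : cmod (real_complex R de) = de.
Proof. by rewrite cmod_real ger0_norm// ltW. Qed.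

Let AT j : Aw w setT (T j) (1 + de * (al * al)).
Proof.
apply: (Aw_sub_op w0 w_ge1 wD Ae).
rewrite -[de in de * _]cmod_de.
apply: (Aw_scale w0 w_ge1 wD _ (L := a' j \o a j)).
exact: (Aw_comp w_ge1 wD _ (Aa' j) (Aa j)).
Qed.

Let T_cauchy eps : 0 < eps -> exists J, forall i j, (J <= j <= i)%N ->
  Aw w setT (fun f y => T i f y - T j f y) eps.
Proof.
move=> eps0; pose eta := eps / (de * (2 * al)).
have c0 : 0 < de * (2 * al) by rewrite !mulr_gt0.
have [J HJ] := a_cauchy (divr_gt0 eps0 c0).
exists J => i j /HJ[H H'].
have A1 := Aw_comp w_ge1 wD (P := setT) (fun _ _ _ _ => I) (Aa' i) H.
have A2 := Aw_comp w_ge1 wD (P := setT) (fun _ _ _ _ => I) H' (Aa j).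
have := Aw_scale w0 w_ge1 wD (- real_complex R de) (Aw_add A1 A2).
rewrite cmodN cmod_de (_ : _ * _ = eps); last first.
  by field; rewrite (gt_eqF al0) (gt_eqF de0).
apply: Aw_ext => f y; rewrite /= /T (Aw_linearB _ _ (Aa' i)); ring.
Qed.

(** The root appears because [contraction] bounds squared norms; the maximum with 0 makes it
    legitimate without comparing [ka] and [al ^+ 2]. *)
Let rho := Num.sqrt (Num.max 0 (1 - de * ka)).

Let rho_ge0 : 0 <= rho. Proof. exact: sqrtr_ge0. Qed.

Let rho_lt1 : rho < 1.
Proof.
rewrite -[ltRHS]sqrtr1 ltr_sqrt// gt_max ltr01 /= ltrBlDr ltrDl.
exact: mulr_gt0.
Qed.

Let T_l2 j : l2bound (T j) rho.
Proof.
move=> f ff; rewrite /rho sqr_sqrtr ?le_max ?lexx//.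
apply: le_trans 
  (contraction al0 Ae (Aa j) (Aa' j) (@adj j) (@ae j) (@low j) ff) _.
have fe := Aw_finsupp Ae ff.
apply: (@le_trans _ _ (Num.max 0 (1 - de * ka) * sqnorm (e f))).
  by rewrite ler_wpM2r ?sqnorm_ge0// le_max lexx orbT.
rewrite ler_wpM2l ?le_max ?lexx//.
by have := Aw_sqnorm w_ge1 Ae ff; rewrite expr1n mul1r.
Qed.

(** The rate is uniform in j because the finitely supported part of the splitting is always [T J],
    with one set of generators; only the small remainder T j - T J depends on j. *)
Let iter_bound : exists J A th, [/\ 0 <= A, 0 <= th, th < 1 &
  forall j n, (J <= j)%N -> Aw w setT (iter n (T j)) (A * th ^+ n)].
Proof.
pose e0 := (1 - rho) / 2.
have e00 : 0 < e0 by rewrite divr_gt0// subr_gt0.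
have [J HJ] := T_cauchy e00.
(* Then q * th0 = (1 + th0) / 2 < 1: the growth of the boxes at rate q leaves a geometric decay. *)
pose th0 := rho + e0; pose q := (1 + th0^-1) / 2.
have th00 : 0 < th0 by rewrite ltr_wpDl.
have th01 : th0 < 1 by have := rho_lt1; rewrite /th0 /e0; lra.
have q1 : 1 < q.
  have : 1 < th0^-1 by rewrite invf_gt1.
  by rewrite /q; lra.
have [F AF] := Aw_finite_support (AT J).
have [A A0 HA] := box_weight_growth w0 w_ge1 wD w_growth F q1.
exists J, A, (q * th0); split => //.
- by rewrite mulr_ge0// ltW// (lt_trans ltr01).
- rewrite /q mulrAC mulrDl mulVf ?gt_eqF// mul1r.
  by rewrite ltr_pdivrMr// mul1r; lra.
move=> j n Jj.
have Aid : Aw w [set x | exists2 s, s \in boxes F 0 & x = 0 + s] id 1.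
  by apply: Aw_id => //; exists 0; [exact: boxes0|rewrite addr0].
have r : Aw w setT (fun f y => T j f y - T J f y) e0 by apply: HJ;
  rewrite leqnn Jj.
have idb : l2bound (id : op) 1 by move=> f ff; rewrite expr1n mul1r.
have := word_bound w0 w_ge1 wD rho_ge0 AF (T_l2 J) r n ler01 Aid idb.
rewrite w0 !mul1r addn0 => H.
apply: Aw_ext (Aw_le _ H); last first.
  rewrite exprMn mulrA ler_wpM2r ?exprn_ge0 ?(ltW th00)//.
move=> f y; rewrite /=; congr (iter n _ f y).
by apply/funext => g; apply/funext => z; rewrite addrC subrK.
Qed.

(** b_j is delta X_j a'_j, where X_j is the sum of T_j^n over n < j. As delta a'_j a_j = e - T_j,
    the product b_j a_j telescopes to e - T_j^j e. Cutting the Neumann series at the index j of the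
    truncation keeps b_j a finite sum of atoms and leaves a single parameter. *)
Lemma approximate_left_inverse : exists (b : nat -> op) (B : R), 0 <= B /\
  exists J0, (forall j, (J0 <= j)%N -> Aw w setT (b j) B) /\
  forall eps, 0 < eps -> exists2 J, (J0 <= J)%N & forall j, (J <= j)%N ->
    (forall i, (j <= i)%N -> Aw w setT (fun f y => b i f y - b j f y) eps) /\
    exists2 E, Aw w setT E eps &
      forall f y, b j (a j f) y = e f y - E f y.
Proof.
have [J0 [A [th [A0 th0 th1 HT]]]] := iter_bound.
pose X j : op := fun f y => \sum_(n < j) iter n (T j) f y.
pose Cx := A / (1 - th).
have Cx0 : 0 <= Cx by rewrite divr_ge0// subr_ge0 ltW.
have AX j : (J0 <= j)%N -> Aw w setT (X j) Cx.
  move=> Jj; apply: Aw_le (Aw_bigsum j (fun n => HT j n Jj)).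
  rewrite -mulr_sumr ler_wpM2l// -[leRHS]mul1r ler_pdivlMr ?subr_gt0//.
  by rewrite mulrC -opprB mulNr -subrX1 opprB lerBlDr lerDl exprn_ge0.
have X_tele j f y : X j f y - X j (T j f) y = f y - iter j (T j) f y.
  rewrite /X -sumrB.
  have {1}-> : f y = iter 0 (T j) f y by [].
  rewrite -[RHS]opprB -(telescope_sumr (fun n => iter n (T j) f y) (leq0n j)).
  rewrite big_mkord -sumrN; apply: eq_bigr => n _.
  by rewrite opprB -iterSr.
have comp L1 L2 l1 l2 : Aw w setT L1 l1 -> Aw w setT L2 l2 ->
    Aw w setT (L1 \o L2) (l1 * l2).
  exact: (Aw_comp w_ge1 wD).
pose b j : op := fun f y => real_complex R de * X j (a' j f) y.
have Ab j : (J0 <= j)%N -> Aw w setT (b j) (de * (Cx * al)).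
  move=> Jj; rewrite -[de in de * _]cmod_de.
  exact: (Aw_scale w0 w_ge1 wD _ (comp _ _ _ _ (AX _ Jj) (Aa' j))).
exists b, (de * (Cx * al)); split; 
  first by exact: mulr_ge0 (ltW de0) (mulr_ge0 Cx0 (ltW al0)).
exists J0; split => // eps eps0.
have E j : (J0 <= j)%N -> forall f y, b j (a j f) y = e f y - (iter j (T j) \o
  e) f y.
  move=> Jj f y; have := X_tele j (e f) y => /= <-.
  rewrite (_ : T j (e f) = fun y => e f y - real_complex R de * a' j (a j f) y).
    rewrite (Aw_linearB _ _ (AX j Jj)) (Aw_linearZ _ _ (AX j Jj)).
    by rewrite subKr.
  by apply/funext => z; rewrite /T ee ae.
(* The resolvent identity X_i - X_j = X_i (T_i - T_j) X_j, with two corrections because the series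
   are cut off. *)
have Xdiff i j : (J0 <= j)%N -> (J0 <= i)%N -> forall f y, X i f y - X j f y =
    X i (iter j (T j) f) y - iter i (T i) (X j f) y +
    X i (fun z => T i (X j f) z - T j (X j f) z) y.
  move=> Jj Ji f y; set g := X j f.
  have TX : (fun z => g z - T j g z) = fun z => f z - iter j (T j) f z.
    apply/funext => z; rewrite -X_tele; congr (_ - _).
    rewrite /g /X (Aw_linear_sum _ _ (AT j)); apply: eq_bigr => n _.
    by rewrite -iterS iterSr.
  have h1 := congr1 (fun h => X i h y) TX; rewrite /= in h1.
  rewrite (Aw_linearB _ _ (AX _ Ji)) (Aw_linearB _ _ (AX _ Ji)) in h1.
  have h2 := X_tele i g y.
  rewrite (Aw_linearB _ _ (AX _ Ji)); move: h1 h2.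
  move: (X i g y) (X i (T j g) y) (X i f y) (X i (iter j (T j) f) y).
  move: (X i (T i g) y) (g y) (iter i (T i) g y) => q1 q2 q3 q4 q5 q6 q7 h1 h2.
  apply/eqP; rewrite -subr_eq0; apply/eqP.
  by rewrite (_ : _ - _ = (q4 - q1 - (q2 - q3)) - (q4 - q5 - (q6 - q7)));
    [rewrite h1 h2 !subrr|ring].
(* eps' * K bounds b_i - b_j: three terms for X_i - X_j composed with a'_i, and one for X_j composed
   with a'_i - a'_j. *)
pose K := de * (Cx * al * (1 + 1 + Cx) + Cx).
have K0 : 0 <= K.
  by apply: mulr_ge0 (ltW de0) (addr_ge0 (mulr_ge0 (mulr_ge0 Cx0 (ltW al0)) _)
    Cx0);
    rewrite !addr_ge0.
have eps'0 : 0 < Num.min eps (eps / (K + 1)).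
  by rewrite lt_min eps0 divr_gt0// ltr_wpDl.
set eps' := Num.min _ _ in eps'0.
have [J1 HJ1] := a_cauchy eps'0.
have [J2 HJ2] := T_cauchy eps'0.
have [J3 HJ3] := geometric_small A0 th0 th1 eps'0.
exists (maxn J0 (maxn J1 (maxn J2 J3))); first exact: leq_maxl.
move=> j; rewrite !geq_max => /and4P[Jj0 Jj1 Jj2 Jj3].
have small k n : (J0 <= k)%N -> (J3 <= n)%N -> Aw w setT (iter n (T k)) eps'.
  by move=> ? ?; apply: Aw_le (HJ3 _ _) (HT _ _ _).
split; last first.
  exists (iter j (T j) \o e); last exact: E.
  apply: Aw_le (comp _ _ _ _ (small _ _ Jj0 Jj3) Ae).
  by rewrite mulr1 ge_min lexx.
move=> i ij.
have [Ji0 Ji3] : (J0 <= i)%N /\ (J3 <= i)%N.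
  by split; [exact: leq_trans ij|exact: leq_trans ij].
have [|_ Ha'] := HJ1 i j; first by rewrite Jj1.
have AX_diff : Aw w setT (fun f y => X i f y - X j f y)
    (Cx * eps' + eps' * Cx + Cx * (eps' * Cx)).
  apply: (Aw_ext (fun f y => esym (Xdiff i j Jj0 Ji0 f y))).
  apply: Aw_add.
    apply: (Aw_sub_op w0 w_ge1 wD).
      exact: (comp _ _ _ _ (AX _ Ji0) (small _ _ Jj0 Jj3)).
    exact: (comp _ _ _ _ (small _ _ Ji0 Ji3) (AX _ Jj0)).
  have AT' : Aw w setT (fun f y => T i f y - T j f y) eps'.
    by apply: HJ2; rewrite Jj2.
  exact: (comp _ _ _ _ (AX _ Ji0) (comp _ _ _ _ AT' (AX _ Jj0))).
have := Aw_scale w0 w_ge1 wD (real_complex R de)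
  (Aw_add (comp _ _ _ _ AX_diff (Aa' i)) (comp _ _ _ _ (AX _ Jj0) Ha')).
rewrite cmod_de => H; apply: Aw_ext (Aw_le _ H) => [f y|].
  by rewrite /b /= (Aw_linearB _ _ (AX _ Jj0)) addrA subrK mulrBr.
rewrite [leLHS](_ : _ = eps' * K); last first.
  have ring_id (x y z t : R) : z * ((y * x + x * y + y * (x * y)) * t + y * x) =
      x * (z * (y * t * (1 + 1 + y) + y)) by ring.
  exact: ring_id.
apply: (@le_trans _ _ (eps / (K + 1) * K)).
  by rewrite ler_wpM2r// ge_min lexx orbT.
rewrite mulrAC ler_pdivrMr ?ltr_wpDl//.
by apply: ler_wpM2l; [exact: ltW|rewrite lerDl].
Qed.

End neumann.

(** * Passing from lower bounds in a solid norm to l^2 *)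

Section slowly_varying.
Variables (R : realType) (G : zmodType).

Definition sum_bounded (phi : G -> R) (Phi : R) :=
  forall Y : seq G, uniq Y -> \sum_(y <- Y) phi y <= Phi.

Lemma geo_sum_le (th : R) n : 0 <= th -> th < 1 ->
  \sum_(i < n) th ^+ i <= (1 - th)^-1.
Proof.
move=> th0 th1; rewrite -[leRHS]mul1r ler_pdivlMr ?subr_gt0//.
by rewrite mulrC -opprB mulNr -subrX1 opprB lerBlDr lerDl exprn_ge0.
Qed.

(* The word-length weight th^|y|, built one generator at a time. *)
Lemma slowly_varying_weight (F : seq G) (th : R) : 0 < th -> th < 1 ->
  exists (phi : G -> R) (Phi : R),
  [/\ forall y, 0 <= phi y, 1 <= phi 0, sum_bounded phi Phi &
    forall x, x \in F -> forall y,
      th * phi y <= phi (y - x) /\ th * phi (y - x) <= phi y].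
Proof.
move=> th0 th1; elim: F => [|x F [phi [Phi [phi0 phi1 sphi Fphi]]]].
  exists (fun y => (y == 0)%:R), 1; split => //.
  - by rewrite eqxx.
  - move=> Y uY; have [Y0|Y0] := boolP (0 \in Y).
      rewrite (bigD1_seq 0)//= eqxx big1 ?addr0// => y /negbTE -> //.
    rewrite big_seq big1// => y yY; case: eqP => // y0.
    by move: Y0; rewrite -y0 yY.
have phiB y : phi y <= Phi by have := sphi [:: y] isT; rewrite big_seq1.
have Phi0 : 0 <= Phi by exact: le_trans (phi0 0) (phiB 0).
(* The new weight is the sup-convolution of the old one with th^|n| along the multiples of x. A
   translation by x changes n by one and costs a factor th; an old generator costs what it did
   before. *)
pose S y := [set th ^+ absz n * phi (y - x *~ n) | n in [set: int]].
have thn n : 0 <= th ^+ n by rewrite exprn_ge0// ltW.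
have S_ub y : has_ubound (S y).
  exists Phi => _ [n _ <-]; apply: le_trans (phiB (y - x *~ n)).
  by rewrite ler_piMl// exprn_ile1// ltW.
have S_sup y : has_sup (S y).
  split => //; exists (th ^+ absz 0 * phi (y - x *~ 0)); exists 0 => //.
have leS n y : th ^+ absz n * phi (y - x *~ n) <= sup (S y).
  by apply: ub_le_sup => //; exists n.
have leS0 y : phi y <= sup (S y).
  by have := leS 0 y; rewrite mulr0z subr0 mul1r.
have ltS y (c : R) : (forall n, th ^+ absz n * phi (y - x *~ n) <= c) ->
    sup (S y) <= c.
  move=> h; apply: ge_sup; first by case: (S_sup y).
  by move=> _ [n _ <-].
(* In the constant, one 2 pays for an almost optimal n in place of the supremum, the other for the
   two signs of n, and (1 - th)^-1 is the geometric series in |n|. *)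
exists (fun y => sup (S y)), (2 * (2 * Phi * (1 - th)^-1)); split.
- by move=> y; apply: le_trans (leS0 y).
- exact: le_trans (leS0 0).
- move=> Y uY.
  have near y : exists n, sup (S y) <= 2 * (th ^+ absz n * phi (y - x *~ n)).
    have [s0|s0] := ltP 0 (sup (S y)).
      have [||_ [n _ <-] h] := @sup_gt _ (S y) (sup (S y) / 2).
      - by case: (S_sup y).
      - by rewrite ltr_pdivrMr// ltr_pMr// ltr1n.
      by exists n; rewrite mulrC -ler_pdivrMr// ltW.
    by exists 0; rewrite (le_trans s0)// !mulr_ge0.
  have {near}[N HN] := choice near.
  pose B := (\max_(y <- Y) absz (N y)).+1.
  have shifted z : \sum_(y <- Y) phi (y + z) <= Phi.
    rewrite -(big_map (fun y => y + z) predT phi) sphi//.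
    by rewrite map_inj_uniq// => a b /addIr.
  apply: (@le_trans _ _ (\sum_(y <- Y) \sum_(k < B)
      2 * (th ^+ k * (phi (y - x *+ k) + phi (y + x *+ k))))).
    rewrite big_seq [leRHS]big_seq; apply: ler_sum => y yY.
    apply: le_trans (HN y) _.
    have NB : (absz (N y) < B)%N.
      by rewrite ltnS; exact: (leq_bigmax_seq (F := fun y => absz (N y))) yY _.
    rewrite (bigD1 (Ordinal NB))//= -[leLHS]addr0 lerD//; last first.
      by apply: sumr_ge0 => k _; rewrite !mulr_ge0// addr_ge0.
    rewrite !ler_wpM2l//; case: (N y) => k; first by rewrite -pmulrn lerDl.
    by rewrite (_ : absz (Negz k) = k.+1)// NegzE mulrNz opprK -pmulrn lerDr.
  rewrite exchange_big /=.
  apply: (@le_trans _ _ (\sum_(k < B) (2 * (2 * Phi)) * th ^+ k)).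
    apply: ler_sum => k _; rewrite -mulr_sumr -mulr_sumr big_split /=.
    rewrite -[leRHS]mulrA ler_wpM2l// mulrC ler_wpM2r//.
    by rewrite mulr_natl mulr2n lerD.
  by rewrite -mulr_sumr [leRHS]mulrA ler_wpM2l ?geo_sum_le// ?mulr_ge0// ltW.
- have step z : z \in F -> forall y (n : int),
  th * (th ^+ absz n * phi (y - x *~ n)) <= sup (S (y - z)) /\
      th * (th ^+ absz n * phi (y - z - x *~ n)) <= sup (S y).
    move=> zF y n; rewrite !(mulrCA th); split.
      apply: le_trans (leS n (y - z)); rewrite ler_wpM2l// addrAC.
      by have [] := Fphi z zF (y - x *~ n).
    apply: le_trans (leS n y); rewrite ler_wpM2l// addrAC.
    by have [] := Fphi z zF (y - x *~ n).
  have thS y c : (forall n, th * (th ^+ absz n * phi (y - x *~ n)) <= c) ->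
      th * sup (S y) <= c.
    move=> h; rewrite mulrC -ler_pdivlMr//; apply: ltS => n.
    by rewrite ler_pdivlMr// mulrC.
  move=> z; rewrite inE => /orP[/eqP->|zF] y; last first.
    by split; apply: thS => n; have [] := step z zF y n.
  have pow (i j : int) : (absz i <= (absz j).+1)%N -> th * th ^+ absz j <=
    th ^+ absz i.
    by move=> ij; rewrite -exprS ler_wiXn2l// ltW.
  split; apply: thS => n; rewrite mulrA.
    apply: le_trans (leS (n - 1) (y - x)).
    rewrite -addrA -opprD -{2}[x]mulr1z -mulrzDr subrKC.
    by rewrite ler_wpM2r// pow//; lia.
  apply: le_trans (leS (n + 1) y).
  rewrite mulrzDr mulr1z opprD addrA addrAC.
  by rewrite ler_wpM2r// pow//; lia.
Qed.

End slowly_varying.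

Section weighted_sums.
Variable R : realType.

(** Cauchy-Schwarz with weights p. In the inductive step the mixed term is controlled by 4 b'^2 Q T
    <= (T + Q b'^2)^2. *)
Lemma sqr_sum_le (I : Type) (s : seq I) (p b : I -> R) : (forall i, 0 <= p i) ->
  (\sum_(i <- s) p i * b i) ^+ 2 <=
  (\sum_(i <- s) p i) * (\sum_(i <- s) p i * b i ^+ 2).
Proof.
move=> p0; elim: s => [|i s IH]; first by rewrite !big_nil expr0n mul0r.
have Q0 : 0 <= \sum_(i <- s) p i by exact: sumr_ge0.
have T0 : 0 <= \sum_(i <- s) p i * b i ^+ 2.
  by apply: sumr_ge0 => j _; rewrite mulr_ge0// sqr_ge0.
rewrite !big_cons; move: IH Q0 T0 (p0 i).
set S := \sum_(i <- s) p i * b i; set Q := \sum_(i <- s) p i.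
set T := \sum_(i <- s) _; move: (p i) (b i) => p' b' IH Q0 T0 p'0.
suff h : 2 * b' * S <= T + Q * b' ^+ 2.
  rewrite -subr_ge0 (_ : _ - _ = p' * (T + Q * b' ^+ 2 - 2 * b' * S) + (Q * T -
    S ^+ 2)).
    by rewrite addr_ge0 ?mulr_ge0 ?subr_ge0.
  ring.
apply: le_trans (ler_norm _) _.
have TQ : 0 <= T + Q * b' ^+ 2 by rewrite addr_ge0// mulr_ge0// sqr_ge0.
rewrite -(@ler_pXn2r _ 2) ?nnegrE//.
rewrite real_normK ?num_real//.
apply: (@le_trans _ _ (4 * b' ^+ 2 * (Q * T))).
  rewrite [leLHS](_ : _ = 4 * b' ^+ 2 * S ^+ 2); last by ring.
  by rewrite ler_wpM2l// mulr_ge0// sqr_ge0.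
rewrite -subr_ge0 (_ : _ - _ = (T - Q * b' ^+ 2) ^+ 2) ?sqr_ge0//.
by ring.
Qed.

(** The extra term [a] joins the sum as the index [None], with weight 1. *)
Lemma sqr_add_sum_le (I : Type) (s : seq I) (p b : I -> R) (a : R) :
  (forall i, 0 <= p i) ->
  (a + \sum_(i <- s) p i * b i) ^+ 2 <=
  (1 + \sum_(i <- s) p i) * (a ^+ 2 + \sum_(i <- s) p i * b i ^+ 2).
Proof.
move=> p0; have := @sqr_sum_le (option I) (None :: map Some s)
  (fun i => if i is Some j then p j else 1) (fun i => if i is Some j then b j
    else a).
by rewrite !big_cons !big_map !mul1r; apply => -[].
Qed.

Variable G : zmodType.

(* Schur's test for the kernel phi (y - k) *)
Lemma schur_weight (phi : G -> R) (Phi : R) (g : G -> R) (Y s : seq G) :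
  (forall y, 0 <= phi y) -> sum_bounded phi Phi -> uniq Y -> uniq s ->
  \sum_(k <- Y) (\sum_(y <- s) phi (y - k) * g y) ^+ 2 <=
  Phi ^+ 2 * \sum_(y <- s) g y ^+ 2.
Proof.
move=> phi0 sphi uY us.
have Phi0 : 0 <= Phi by have := sphi [::] isT; rewrite big_nil.
have s1 k : \sum_(y <- s) phi (y - k) <= Phi.
  rewrite -(big_map (fun y => y - k) predT phi) sphi//.
  by rewrite map_inj_uniq// => a b /addIr.
have s2 y : \sum_(k <- Y) phi (y - k) <= Phi.
  rewrite -(big_map (fun k => y - k) predT phi) sphi//.
  by rewrite map_inj_uniq// => a b /addrI/oppr_inj.
apply: (@le_trans _ _ (\sum_(k <- Y) Phi * \sum_(y <- s) phi (y - k) * g y ^+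
  2)).
  apply: ler_sum => k _; apply: le_trans (sqr_sum_le _ _ _) _ => //.
  by rewrite ler_wpM2r// sumr_ge0// => y _; rewrite mulr_ge0// sqr_ge0.
rewrite -mulr_sumr exchange_big expr2 -mulrA ler_wpM2l//= mulr_sumr.
apply: ler_sum => y _; rewrite -mulr_suml.
by apply: ler_wpM2r; [exact: sqr_ge0|exact: s2].
Qed.

End weighted_sums.

(** * Localization of a lower bound and summation of squares *)

Section lower_bound_transfer.
Variables (R : realType) (G : zmodType).
Local Notation C := (complex R).

(** The axioms concern nonnegative functions because [nu] is applied to moduli only. The last two
    squeeze it between the sup norm and the l^1 norm, with constant 1; after localization this is
    enough to compare it with l^2. *)
Record solid_norm (nu : (G -> R) -> R) := SolidNorm {
  solid_le : forall f g, finsupp f -> finsupp g ->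
    (forall y, 0 <= f y <= g y) -> nu f <= nu g ;
  solidD : forall f g, finsupp f -> finsupp g -> (forall y, 0 <= f y) ->
    (forall y, 0 <= g y) -> nu (fun y => f y + g y) <= nu f + nu g ;
  solidZ : forall (c : R) f, finsupp f -> (forall y, 0 <= f y) -> 0 <= c ->
    nu (fun y => c * f y) <= c * nu f ;
  solid_shift : forall x f, finsupp f -> (forall y, 0 <= f y) ->
    nu (fun y => f (y - x)) <= nu f ;
  solid_ge : forall k f, finsupp f -> (forall y, 0 <= f y) -> f k <= nu f ;
  solid_le_sum : forall f, finsupp f -> (forall y, 0 <= f y) -> nu f <= gsum f
}.

Lemma solid_sum nu (I : Type) (s : seq I) (f : I -> G -> R) : solid_norm nu ->
  (forall i, finsupp (f i)) -> (forall i y, 0 <= f i y) ->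
  nu (fun y => \sum_(i <- s) f i y) <= \sum_(i <- s) nu (f i).
Proof.
move=> hnu ff f0; elim: s => [|i s IH].
  rewrite big_nil; under eq_fun do rewrite big_nil.
  apply: le_trans (solid_le_sum hnu _ _) _ => //; first exact: finsupp0.
  by rewrite (@gsumE _ _ [::])// big_nil.
rewrite big_cons; under eq_fun do rewrite big_cons.
apply: le_trans (solidD hnu _ _ _ _) _ => //.
- exact: finsupp_sum.
- by move=> y; exact: sumr_ge0.
- by rewrite lerD2l.
Qed.

Definition trunc (m : G -> G -> C) (F : seq G) (f : G -> C) : G -> C :=
  fun y => \sum_(x <- F) m x y * f (y - x).

Lemma finsupp_trunc m F f : finsupp f -> finsupp (trunc m F f).
Proof.
move=> ff; apply: finsupp_sum => x; apply: finsupp_dom (finsupp_shift x ff) _.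
by move=> y ->; rewrite mulr0.
Qed.

Variables (F D : seq G) (u : G -> R) (K eta Phi : R) (phi : G -> R).
Hypotheses (u0 : forall x, 0 <= u x) (K0 : 0 < K) (eta0 : 0 <= eta)
  (phi0 : forall y, 0 <= phi y) (phi1 : 1 <= phi 0) (sphi : sum_bounded phi Phi)
  (Fphi : forall x, x \in F -> forall y,
    `|phi (y - x) - phi y| <= eta * phi (y - x))
  (FK : K * (eta * \sum_(x <- F) u x) <= 4^-1)
  (DK : K * \sum_(x <- D) u x <= 4^-1).
Variables (m : G -> G -> C) (nu : (G -> R) -> R) (v : G -> C).
Hypotheses (mu : forall x y, cmod (m x y) <= u x) (hnu : solid_norm nu)
  (fv : finsupp v)
  (low : forall v' : G -> C, (forall y, v y = 0 -> v' y = 0) ->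
    nu (@cmod R \o v') <= K * nu (@cmod R \o trunc m (F ++ D) v')).

Let A := trunc m (F ++ D).
Let local_norm (f : G -> C) k := nu (fun y => phi (y - k) * cmod (f y)).
Let P := local_norm v.

Let fsM (f : G -> C) (g : G -> R) : finsupp f ->
  finsupp (fun y => g y * cmod (f y)).
Proof. by move=> ff; apply: finsupp_dom ff _ => y ->; rewrite cmod0 mulr0. Qed.

Let fsMs (f : G -> C) (g : G -> R) x :
  finsupp f -> finsupp (fun y => g y * cmod (f (y - x))).
Proof. by move=> /(finsupp_shift x); exact: fsM. Qed.

Let local_ge0 f k y : 0 <= phi (y - k) * cmod (f y).
Proof. by rewrite mulr_ge0// cmod_ge0. Qed.

Lemma local_norm_ge f k : finsupp f -> cmod (f k) <= local_norm f k.
Proof.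
move=> ff; apply: le_trans (solid_ge hnu k (fsM _ ff) (local_ge0 f k)).
by rewrite subrr ler_peMl// cmod_ge0.
Qed.

(** By [solid_le_sum] the local norm at k is at most the sum of phi (y - k) |f y|, so Schur's test
    applies. Together with [local_norm_ge] this makes the sum of the squared local norms equivalent
    to the squared l^2 norm, whatever [nu] is. *)
Lemma local_norm_sum f Y : finsupp f -> uniq Y ->
  \sum_(k <- Y) local_norm f k ^+ 2 <= Phi ^+ 2 * sqnorm f.
Proof.
move=> ff uY; have [s us fs] := finsupp_uniq ff.
rewrite /sqnorm (gsumE us); last by move=> y ys; rewrite fs// cmod0 expr0n.
apply: le_trans (schur_weight _ phi0 sphi uY us).
apply: ler_sum => k _; rewrite ler_pXn2r ?nnegrE//.
- apply: le_trans (solid_le_sum hnu (fsM _ ff) (local_ge0 f k)) _.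
  by rewrite (gsumE us)// => y ys; rewrite fs// cmod0 mulr0.
- by apply: le_trans (local_norm_ge k ff); exact: cmod_ge0.
- by apply: sumr_ge0 => y _; exact: local_ge0.
Qed.

(** The lower bound is tested on phi (. - k) v. Commuting the cutoff with the translation by x costs
    a factor eta when x is in F. For x in D nothing is known about phi, but the coefficients are
    small and the cost is P k + P (k - x). By [FK] and [DK] the terms in P k amount to at most P k /
    2 and are absorbed, which doubles K. Thanks to D, phi need not be adapted to the whole
    truncation. *)
Lemma local_recursion k :
  P k <= 2 * K * local_norm (A v) k + \sum_(x <- D) 2 * K * u x * P (k - x).
Proof.
pose v' y := (real_complex R (phi (y - k))) * v y.
have cphi (r : R) (z : C) : 0 <= r -> cmod (real_complex R r * z) = r * cmod z.
  by move=> r0; rewrite cmodM cmod_real ger0_norm.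
have v'E : (@cmod R \o v') = fun y => phi (y - k) * cmod (v y).
  by apply/funext => y; rewrite /v' /= cphi.
have H : P k <= K * nu (@cmod R \o A v').
  by rewrite /P /local_norm -v'E; apply: low => y v0; rewrite /v' v0 mulr0.
have fAv : finsupp (A v) by exact: finsupp_trunc.
pose q x y := phi (y - x - k) * cmod (v (y - x)).
have q0 x y : 0 <= q x y by exact: local_ge0.
have fq x : finsupp (q x) by exact: (finsupp_shift x (fsM (fun y => phi (y -
  k)) fv)).
have qP x : nu (q x) <= P k.
  exact: (solid_shift hnu x (fsM (fun y => phi (y - k)) fv) (local_ge0 v k)).
pose r x y := phi (y - k) * cmod (v (y - x)).
have r0 x y : 0 <= r x y by rewrite mulr_ge0// cmod_ge0.
have fr x : finsupp (r x) by exact: fsMs.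
have rP x : nu (r x) <= P (k - x).
  have := solid_shift hnu x (fsM (fun y => phi (y - (k - x))) fv) (local_ge0 v
    (k - x)).
  rewrite (_ : (fun y => _) = r x)//; apply/funext => y.
  by rewrite /r opprB addrA subrK.
have pt y : 0 <= cmod (A v' y) <= phi (y - k) * cmod (A v y) +
    (\sum_(x <- F) (u x * eta) * q x y + \sum_(x <- D) u x * (q x y + r x y)).
  rewrite cmod_ge0 /=.
  rewrite (_ : A v' y = real_complex R (phi (y - k)) * A v y +
      \sum_(x <- F ++ D) m x y * (real_complex R (phi (y - x - k) - phi (y -
        k)) * v (y - x))).
    apply: le_trans (ler_cmodD _ _) _; rewrite cphi// lerD2l.
    apply: le_trans (ler_cmod_sum _ _) _; rewrite big_cat/= lerD//.
      rewrite !big_seq; apply: ler_sum => x xF;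
        rewrite cmodM cmodM cmod_real -mulrA.
      rewrite ler_pM ?cmod_ge0 ?mulr_ge0 ?cmod_ge0//.
      rewrite mulrA ler_wpM2r ?cmod_ge0// addrAC; exact: Fphi.
    apply: ler_sum => x _; rewrite cmodM cmodM cmod_real.
    rewrite ler_pM ?cmod_ge0 ?mulr_ge0 ?cmod_ge0// -mulrDl ler_wpM2r
      ?cmod_ge0//.
    by apply: le_trans (ler_normB _ _) _; rewrite !ger0_norm.
  rewrite /A /trunc mulr_sumr -big_split; apply: eq_bigr => x _ /=.
  by rewrite /v' rmorphB; ring.
have fA : finsupp (@cmod R \o A v').
  have fv' : finsupp v' by apply: finsupp_dom fv _ => y; rewrite /v' => ->;
    rewrite mulr0.
  by apply: finsupp_dom (finsupp_trunc m (F ++ D) fv') _ => y;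
    rewrite /A /= => ->; rewrite cmod0.
have fqF x : finsupp (fun y => u x * eta * q x y).
  by apply: finsupp_dom (fq x) _ => y ->; rewrite mulr0.
have fqr x : finsupp (fun y => q x y + r x y) by exact: finsuppD.
have fqD x : finsupp (fun y => u x * (q x y + r x y)).
  by apply: finsupp_dom (fqr x) _ => y ->; rewrite mulr0.
have qr0 x y : 0 <= q x y + r x y by rewrite addr_ge0.
have qF0 x y : 0 <= u x * eta * q x y.
  exact: mulr_ge0 (mulr_ge0 (u0 x) eta0) (q0 x y).
have qD0 x y : 0 <= u x * (q x y + r x y) by exact: mulr_ge0 (u0 x) (qr0 x y).
have nuA : nu (@cmod R \o A v') <= local_norm (A v) k +
    (\sum_(x <- F) u x * eta * P k + \sum_(x <- D) u x * (P k + P (k - x))).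
  apply: le_trans (solid_le hnu fA _ pt) _.
    by apply: finsuppD; [exact: fsM|apply: finsuppD; exact: finsupp_sum].
  apply: le_trans (solidD hnu _ _ _ _) _.
  - exact: fsM.
  - by apply: finsuppD; exact: finsupp_sum.
  - by move=> y; exact: local_ge0.
  - by move=> y; rewrite addr_ge0// sumr_ge0.
  rewrite lerD2l; apply: le_trans (solidD hnu _ _ _ _) _.
  - exact: finsupp_sum.
  - exact: finsupp_sum.
  - by move=> y; rewrite sumr_ge0.
  - by move=> y; rewrite sumr_ge0.
  apply: lerD.
    apply: le_trans (solid_sum _ hnu fqF qF0) _; apply: ler_sum => x _.
    apply: le_trans (solidZ hnu (fq x) (q0 x) _) _; first by rewrite mulr_ge0.
    by rewrite ler_wpM2l// mulr_ge0.
  apply: le_trans (solid_sum _ hnu fqD qD0) _; apply: ler_sum => x _.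
  apply: le_trans (solidZ hnu (fqr x) (qr0 x) (u0 x)) _.
  rewrite ler_wpM2l//; apply: le_trans (solidD hnu (fq x) (fr x) (q0 x) (r0 x))
    _.
  exact: lerD.
have P0 : 0 <= P k by apply: le_trans (local_norm_ge k fv); exact: cmod_ge0.
have : P k <= K * (local_norm (A v) k +
    (\sum_(x <- F) u x * eta * P k + \sum_(x <- D) u x * (P k + P (k - x)))).
  by apply: le_trans H _; rewrite ler_wpM2l// ltW.
have -> : \sum_(x <- F) u x * eta * P k = eta * (\sum_(x <- F) u x) * P k.
  by rewrite -!mulr_suml [eta * _]mulrC.
have -> : \sum_(x <- D) u x * (P k + P (k - x)) =
    (\sum_(x <- D) u x) * P k + \sum_(x <- D) u x * P (k - x).
  by under eq_bigr do rewrite mulrDr; rewrite big_split /= mulr_suml.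
have -> : \sum_(x <- D) 2 * K * u x * P (k - x) =
    2 * K * \sum_(x <- D) u x * P (k - x).
  by rewrite mulr_sumr; apply: eq_bigr => x _; rewrite !mulrA.
move: FK DK; set s1 := \sum_(x <- F) u x; set s2 := \sum_(x <- D) u x.
set s3 := \sum_(x <- D) _; set h := local_norm _ _ => h1 h2 h3.
have h4 := ler_wpM2r P0 h1; have h5 := ler_wpM2r P0 h2.
move: h3 h4 h5; rewrite !mulrDr.
rewrite (_ : K * (eta * s1 * P k) = K * (eta * s1) * P k); last by ring.
by rewrite (_ : K * (s2 * P k) = K * s2 * P k); [lra|ring].
Qed.

(** After squaring and summing over k, the shifted terms P (k - x) reproduce the same sum with a
    factor (1 + th) th <= 3 / 4 and are absorbed. Hence 24 = (3 / 2) * 4 / (1 - 3 / 4). *)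
Lemma sqnorm_lower_bound : sqnorm v <= 24 * K ^+ 2 * Phi ^+ 2 * sqnorm (A v).
Proof.
have fAv : finsupp (A v) by exact: finsupp_trunc.
(* The sum over all k is a supremum over finite families Y. It is finite by [local_norm_sum], so it
   may be subtracted, and a translate of Y is again such a family. *)
pose S (Y : seq G) := \sum_(k <- Y) P k ^+ 2.
pose E := [set S Y | Y in [set Y | uniq Y]].
have E_ub : has_ubound E.
  by exists (Phi ^+ 2 * sqnorm v) => _ [Y uY <-]; exact: local_norm_sum.
have leE Y : uniq Y -> S Y <= sup E.
  by move=> uY; apply: ub_le_sup => //; exists Y.
have vE : sqnorm v <= sup E.
  have [s us fs] := finsupp_uniq fv.
  rewrite /sqnorm (gsumE us); last by move=> y ys; rewrite fs// cmod0 expr0n.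
  apply: le_trans (leE _ us); apply: ler_sum => y _.
  rewrite ler_pXn2r ?nnegrE ?cmod_ge0//; first exact: local_norm_ge.
  by apply: le_trans (local_norm_ge y fv); exact: cmod_ge0.
set N := Phi ^+ 2 * sqnorm (A v).
have sup0 : 0 <= sup E by apply: le_trans (leE [::] isT); rewrite /S big_nil.
pose th := \sum_(x <- D) 2 * K * u x.
have th0 : 0 <= th by apply: sumr_ge0 => x _; rewrite !mulr_ge0// ltW.
have th2 : th <= 2^-1.
  by have := DK; rewrite /th -mulr_sumr -mulrA; lra.
have SY Y : uniq Y -> S Y <= (1 + th) * (4 * K ^+ 2 * N + th * sup E).
  move=> uY.
  apply: (@le_trans _ _ (\sum_(k <- Y) (1 + th) * (4 * K ^+ 2 * local_norm (A
    v) k ^+ 2 +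
      \sum_(x <- D) 2 * K * u x * P (k - x) ^+ 2))).
    apply: ler_sum => k _.
    have h0 : 0 <= local_norm (A v) k.
      by apply: le_trans (local_norm_ge k fAv); exact: cmod_ge0.
    have P0 k' : 0 <= P k' by apply: le_trans (local_norm_ge k' fv);
      exact: cmod_ge0.
    have Ku0 x : 0 <= 2 * K * u x by rewrite !mulr_ge0// ltW.
    rewrite (_ : 4 * K ^+ 2 * _ = (2 * K * local_norm (A v) k) ^+ 2);
      last by ring.
    apply: le_trans (sqr_add_sum_le _ _ _ Ku0).
    rewrite ler_pXn2r ?nnegrE//; first exact: local_recursion.
    apply: addr_ge0; first by apply: mulr_ge0 => //; rewrite mulr_ge0// ltW.
    by apply: sumr_ge0 => x _; exact: mulr_ge0.
  rewrite -mulr_sumr ler_wpM2l ?addr_ge0// big_split lerD//=.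
    rewrite -mulr_sumr; apply: ler_wpM2l; last exact: local_norm_sum.
    by rewrite mulr_ge0// sqr_ge0.
  rewrite exchange_big/= mulr_suml; apply: ler_sum => x _.
  rewrite -mulr_sumr; apply: ler_wpM2l; first by rewrite !mulr_ge0// ltW.
  rewrite -(big_map (fun k => k - x) predT (fun k => P k ^+ 2)); apply: leE.
  by rewrite map_inj_uniq// => a b /addIr.
have : sup E <= (1 + th) * (4 * K ^+ 2 * N + th * sup E).
  apply: ge_sup; first by exists (S [::]); exists [::].
  by move=> _ [Y uY <-]; exact: SY.
have N0 : 0 <= K ^+ 2 * N 
  by exact: mulr_ge0 (sqr_ge0 _) (mulr_ge0 (sqr_ge0 _) (sqnorm_ge0 fAv)).
move=> h; apply: le_trans vE _.
rewrite -mulrA -/N -mulrA; set X := K ^+ 2 * N in N0 *.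
move: h; rewrite -[4 * _ * _]mulrA -/X => h.
have h1 : (1 + th) * (4 * X + th * sup E) <= 3 / 2 * (4 * X + 2^-1 * sup E).
  have a1 : 1 + th <= 3 / 2 by lra.
  have b0 : 0 <= 4 * X + th * sup E by apply: addr_ge0; apply: mulr_ge0.
  have b1 := ler_wpM2r sup0 th2.
  apply: le_trans (ler_wpM2r b0 a1) _; lra.
by move: (le_trans h h1); lra.
Qed.

End lower_bound_transfer.

(** * Lebesgue measure and L^p norms on R^d *)

Section translation_invariance.
Variable R : realType.

Lemma lebesgue_measure_shift (c : R) (A : set (measurableTypeR R)) :
  measurable A -> lebesgue_measure ((fun t : R => t - c) @^-1` A) =
    lebesgue_measure A.
Proof.
move=> mA.
pose phi : measurableTypeR R -> measurableTypeR R := fun t : R => t - c.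
have mphi : measurable_fun [set: measurableTypeR R] phi.
  by apply: measurable_funB => //; exact: measurable_id.
pose phim : {mfun measurableTypeR R >-> measurableTypeR R} :=
  HB.pack phi (isMeasurableFun.Build _ _ _ _ _ mphi).
apply/esym.
apply: (lebesgue_measure_unique (mu := pushforward lebesgue_measure phim)) =>
  // X.
move=> [[a b] _ <-] /=; rewrite /pushforward.
rewrite (_ : _ @^-1` _ = `]a + c, b + c]%classic); last first.
  by apply/seteqP; split => t /=; rewrite !in_itv/= /phi ltrBrDr lerBlDr.
rewrite !lebesgue_measure_itv/= !lte_fin ltrD2r.
by case: ifP => // _; rewrite -!EFinB; congr EFin; ring.
Qed.

Lemma ge0_integral_shift (c : R) (g : measurableTypeR R -> \bar R) :
  measurable_fun setT g -> (forall t, 0 <= g t)%E ->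
  (\int[lebesgue_measure]_t g (t - c)%R = \int[lebesgue_measure]_t g t)%E.
Proof.
move=> mg g0.
pose phi : measurableTypeR R -> measurableTypeR R := fun t : R => t - c.
have mphi : measurable_fun [set: measurableTypeR R] phi.
  by apply: measurable_funB => //; exact: measurable_id.
have := @ge0_integral_pushforward _ _ _ _ _ phi mphi lebesgue_measure setT g
  measurableT mg (fun y _ => g0 y).
rewrite preimage_setT => <-.
by apply: eq_measure_integral => A mA _; exact: lebesgue_measure_shift.
Qed.

(** Induction on the dimension: the first coordinate of x shifts the outer integral, the others
    shift the slices. *)
Lemma lebesgue_rV_shift d (x : 'rV[R]_d) (A : set 'rV[R]_d) : measurable A ->
  lebesgue_rV d ((fun y => y - x) @^-1` A) = lebesgue_rV d A.
Proof.
elim: d x A => [|d IH] x A mA.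
  congr (lebesgue_rV _ _); rewrite (_ : (fun y => _) = id) ?preimage_id//.
  by apply/funext => y; apply/rowP => -[].
have mAc : measurable (@cons_rV R d @^-1` A).
  by rewrite -[X in measurable X]setTI; exact: measurable_cons_rV.
rewrite /= /cons_measure /pushforward /product_measure1.
pose x0 : R := x ord0 ord0; pose x' := rsubmx (x : 'rV[R]_(1 + d)).
have consB (t : R) v : cons_rV ((t : measurableTypeR R),
  v) - x = cons_rV ((t - x0 : measurableTypeR R), v - x').
  have c0 (s : R) u : cons_rV ((s : measurableTypeR R), u) ord0 ord0 = s.
    by have [] := cons_rVK ((s : measurableTypeR R), u).
  have cS (s : R) (u : 'rV_d) k :
      cons_rV ((s : measurableTypeR R), u) ord0 (rshift 1 k) = u ord0 k.
    have [_] := cons_rVK ((s : measurableTypeR R), u).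
    by move=> /(congr1 (fun r : 'rV__ => r ord0 k)); rewrite mxE.
  apply/rowP => i; rewrite mxE.
  case: (splitP (i : 'I_(1 + d))) => [j ij|k ik].
    have -> : i = ord0 by apply: val_inj; rewrite /= ij ord1.
    by rewrite c0 mxE c0.
  have -> : i = rshift 1 k by exact: val_inj.
  by rewrite cS mxE cS !mxE.
pose g : measurableTypeR R -> \bar R :=
  lebesgue_rV d \o xsection (@cons_rV R d @^-1` A).
transitivity (\int[lebesgue_measure]_t g ((t : R) - x0)%R)%E; last first.
  apply: ge0_integral_shift; first exact: measurable_fun_xsection.
  by move=> t; exact: measure_ge0.
rewrite /g.
apply: eq_integral => t _ /=.
rewrite -[RHS](IH x'); last by apply: measurable_xsection.
congr (lebesgue_rV _ _); apply/seteqP; split => v /=;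
  by rewrite /xsection /= !inE /= consB.
Qed.

End translation_invariance.

Section Lp_norm_theory.
Variables (R : realType) (d : nat) (p : \bar R).
Hypothesis p1 : (1 <= p)%E.
Local Notation Rd := 'rV[R]_d.
Local Notation C := (complex R).
Local Notation mu := (@lebesgue_rV R d).
Implicit Types f g : Rd -> C.

Lemma ae_shift (P : Rd -> Prop) (x : Rd) :
  {ae mu, forall y, P y} -> {ae mu, forall y, P (y - x)}.
Proof.
move=> [N [mN N0 PN]]; exists ((fun y => y - x) @^-1` N); split.
- by rewrite -[X in measurable X]setTI; exact: measurable_translation.
- by rewrite lebesgue_rV_shift.
- by move=> y /= nPy; exact: PN.
Qed.

Lemma Lp_norm_ge0 f : (0 <= Lp_norm p f)%E.
Proof. exact: Lnorm_ge0. Qed.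

Lemma measurable_abse_poweR (h : Rd -> R) (r : R) : measurable_fun setT h ->
  measurable_fun setT (fun y => `|(EFin \o h) y| `^ r)%E.
Proof.
move=> mh; apply: (measurableT_comp (measurable_poweR _)).
by apply: measurableT_comp => //; exact/measurable_EFinP.
Qed.

Lemma le_Lnorm (h k : Rd -> R) :
  measurable_fun setT h -> measurable_fun setT k ->
  {ae mu, forall y, `|h y| <= `|k y|} ->
  ('N[mu]_p[EFin \o h] <= 'N[mu]_p[EFin \o k])%E.
Proof.
move=> mh mk hk; rewrite unlock /Lnorm; case: p p1 => [r|//|//].
  rewrite lee_fin => r1; have r0 : 0 < r by apply: lt_le_trans r1.
  apply: gt0_ler_poweR; rewrite ?invr_ge0 ?(ltW r0)//.
  - by rewrite in_itv/= leey andbT integral_ge0// => y _;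
    rewrite lee_fin powR_ge0.
  - by rewrite in_itv/= leey andbT integral_ge0// => y _;
    rewrite lee_fin powR_ge0.
  apply: ae_ge0_le_integral => //.
  - by move=> y _; exact: poweR_ge0.
  - exact: measurable_abse_poweR.
  - by move=> y _; exact: poweR_ge0.
  - exact: measurable_abse_poweR.
  apply: filterS hk => y hky _ /=; rewrite lee_fin.
  by apply: ge0_ler_powR; rewrite ?nnegrE ?(ltW r0).
case: ifP => // _ _; apply: le_ess_sup.
by apply: filterS hk => y; rewrite /= lee_fin.
Qed.

Lemma LnormZ_le (h : Rd -> R) (c : R) : measurable_fun setT h -> 0 <= c ->
  ('N[mu]_p[EFin \o (fun y => c * h y)%R] <= c%:E * 'N[mu]_p[EFin \o h])%E.
Proof.
move=> mh c0; rewrite unlock /Lnorm; case: p p1 => [r|//|//].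
  rewrite lee_fin => r1; have r0 : 0 < r by apply: lt_le_trans r1.
  have -> : (\int[mu]_y (`|(EFin \o (fun y => c * h y)%R) y| `^ r) =
      (c `^ r)%R%:E * \int[mu]_y (`|(EFin \o h) y| `^ r))%E.
    rewrite -ge0_integralZl_EFin//; last 3 first.
    - by move=> y _; exact: poweR_ge0.
    - exact: measurable_abse_poweR.
    - exact: powR_ge0.
    apply: eq_integral => y _ /=.
    by rewrite normrM (ger0_norm c0) powRM// EFinM.
  rewrite poweRM; last 2 first.
  - by rewrite lee_fin powR_ge0.
  - by apply: integral_ge0 => y _; exact: poweR_ge0.
  by rewrite poweR_EFin -powRrM mulfV ?gt_eqF// powRr1.
case: ifP => muT _; last by rewrite mule0.
rewrite (_ : abse \o _ = cst c%:E \* (abse \o (EFin \o h)))%E.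
  by rewrite ess_supZl// lt_neqAle eq_sym.
by apply/funext => y; rewrite /= normrM (ger0_norm c0) EFinM.
Qed.

Lemma Lnorm_shift (h : Rd -> R) (x : Rd) : measurable_fun setT h ->
  ('N[mu]_p[EFin \o (fun y => h (y - x)%R)] = 'N[mu]_p[EFin \o h])%E.
Proof.
move=> mh; rewrite unlock /Lnorm; case: p p1 => [r|//|//].
  move=> _; congr (_ `^ _)%E.
  have := @ge0_integral_pushforward _ _ _ _ _ (fun y : Rd => y - x)
    (measurable_translation x) mu setT (fun y => `|(EFin \o h) y| `^ r)%E
    measurableT (measurable_abse_poweR r mh) (fun y _ => poweR_ge0 _ _).
  rewrite preimage_setT => <-.
  apply: eq_measure_integral => [|mt A mA _];
    first exact: measurable_translation.
  exact: lebesgue_rV_shift.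
move=> _; case: ifP => // _.
apply/eqP; rewrite eq_le; apply/andP; split; apply/ess_supP.
  exact: (ae_shift x (ess_sup_ge mu (abse \o (EFin \o h)))).
have := ae_shift (- x) (ess_sup_ge mu (abse \o (EFin \o (fun y => h (y - x))))).
by apply: filterS => y; rewrite /= opprK addrK.
Qed.

Lemma le_Lp_norm f g (c : R) : 0 <= c -> cmeasurable f -> cmeasurable g ->
  {ae mu, forall y, cmod (f y) <= c * cmod (g y)} ->
  (Lp_norm p f <= c%:E * Lp_norm p g)%E.
Proof.
move=> c0 mf mg fg; apply: le_trans (LnormZ_le (measurable_cmod mg) c0).
apply: le_Lnorm; first exact: measurable_cmod.
  by apply: measurable_funM => //; exact: measurable_cmod.
apply: filterS fg => y fgy.
by rewrite !ger0_norm ?cmod_ge0 ?mulr_ge0 ?cmod_ge0.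
Qed.

Lemma Lp_norm_shift f x : cmeasurable f ->
  Lp_norm p (fun y => f (y - x)) = Lp_norm p f.
Proof. by move=> mf; apply: Lnorm_shift; exact: measurable_cmod. Qed.

Lemma Lp_normD f g : cmeasurable f -> cmeasurable g ->
  (Lp_norm p (fun y => (f y + g y)%R) <= Lp_norm p f + Lp_norm p g)%E.
Proof.
move=> mf mg; have mf' := measurable_cmod mf; have mg' := measurable_cmod mg.
apply: le_trans (eminkowski mu mf' mg' p1); apply: le_Lnorm.
- by apply: measurable_cmod; exact: cmeasurableD.
- exact: measurable_funD.
apply: nearW => y /=; rewrite !ger0_norm ?cmod_ge0 ?addr_ge0 ?cmod_ge0//.
exact: ler_cmodD.
Qed.

Lemma Lp_norm0 : Lp_norm p (fun _ : Rd => 0 : C) = 0%E.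
Proof.
rewrite /Lp_norm (_ : EFin \o _ = cst 0%E); last first.
  by apply/funext => y; rewrite /= cmod0.
by rewrite Lnorm0// gt_eqF// (lt_le_trans _ p1).
Qed.

Lemma eq_Lp_norm f g : cmeasurable f -> cmeasurable g -> f = g %[ae mu] ->
  Lp_norm p f = Lp_norm p g.
Proof.
move=> mf mg fg; apply/eqP; rewrite eq_le.
rewrite -[leRHS]mul1e -[X in _ && (_ <= X)%E]mul1e !le_Lp_norm//;
  by apply: filterS fg => y ->; rewrite ?mul1r.
Qed.

Lemma in_LpD f g : in_Lp p f -> in_Lp p g -> in_Lp p (fun y => f y + g y).
Proof.
move=> [mf fy] [mg gy]; split; first exact: cmeasurableD.
by apply: le_lt_trans (Lp_normD mf mg) _; exact: lte_add_pinfty.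
Qed.

Lemma in_LpZ (c : C) f : in_Lp p f -> in_Lp p (fun y => c * f y).
Proof.
move=> [mf fy]; have mcf : cmeasurable (fun y => c * f y).
  by apply: cmeasurableM => //; exact: cmeasurable_cst.
split => //; apply: le_lt_trans (le_Lp_norm (cmod_ge0 c) mcf mf _) _.
  by apply: nearW => y; rewrite cmodM.
by rewrite lte_mul_pinfty ?lee_fin ?cmod_ge0.
Qed.

Variable w : Rd -> R.
Hypothesis w_ge1 : forall x, 1 <= w x.

(** The counterpart of [Aw_sqnorm]: the same atoms with the same bound [l] act on L^p, so bounds in
    [Aw] that were obtained through l^2 are available here. *)
Lemma Aw_Lp P L l f : Aw w P L l -> in_Lp p f ->
  in_Lp p (L f) /\ (Lp_norm p (L f) <= l%:E * Lp_norm p f)%E.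
Proof.
move=> AL [mf fy].
suff [mLf Lfl] : cmeasurable (L f) /\ (Lp_norm p (L f) <= l%:E * Lp_norm p f)%E.
  split => //; split => //; apply: le_lt_trans Lfl _.
  by rewrite lte_mul_pinfty// lee_fin (Aw_ge0 w_ge1 AL).
elim: AL => [k k0|x m u {}L k k' Px mm mu' AL [IHm IH] kk'].
  by split; [exact: cmeasurable_cst|rewrite Lp_norm0 mule_ge0// Lp_norm_ge0].
have mx : cmeasurable (fun y => f (y - x)) by exact: cmeasurable_shift.
have mmx : cmeasurable (fun y => m y * f (y - x)) by exact: cmeasurableM.
have u0 : 0 <= u by apply: le_trans (cmod_ge0 _) (mu' 0).
split; first exact: cmeasurableD.
apply: le_trans (Lp_normD mmx IHm) _.
apply: (@le_trans _ _ (u%:E * Lp_norm p f + k%:E * Lp_norm p f)%E).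
  apply: leeD => //; rewrite -(Lp_norm_shift x mf); apply: le_Lp_norm => //.
  by apply: nearW => y; rewrite cmodM ler_wpM2r// cmod_ge0.
rewrite -ge0_muleDl ?lee_fin ?(Aw_ge0 w_ge1 AL)//.
apply: lee_wpmul2r; first exact: Lp_norm_ge0.
by rewrite lee_fin; apply: le_trans kk'; rewrite lerD2r ler_peMr.
Qed.

End Lp_norm_theory.

(** * From L^p to the orbits of a countable group *)

Section essential_points.
Variables (R : realType) (d : nat).
Local Notation Rd := 'rV[R]_d.
Local Notation mu := (@lebesgue_rV R d).

Lemma measurable_close (I : Type) (g : I -> Rd -> R) (c e : I ->
  R) (s : seq I) :
  (forall i, measurable_fun setT (g i)) ->
  measurable [set y | List.Forall (fun i => `|g i y - c i| < e i) s].
Proof.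
move=> mg; elim: s => [|i s IH].
  by rewrite (_ : mkset _ = setT)//; apply/seteqP; split => // y _ /=;
    constructor.
rewrite (_ : mkset _ = (fun y => `|g i y - c i|) @^-1` `]-oo, e i[ `&`
    [set y | List.Forall (fun i => `|g i y - c i| < e i) s]).
  apply: measurableI => //; rewrite -[X in measurable X]setTI.
  have mh : measurable_fun setT (fun y => `|g i y - c i|).
    by apply: measurableT_comp => //; exact: measurable_funB.
  by apply: mh => //; exact: measurable_itv.
apply/seteqP; split => y /=; rewrite in_itv/=.
  by move=> h; inversion h.
by move=> [? ?]; constructor.
Qed.

Lemma ForallP (T : eqType) (P : T -> Prop) (s : seq T) :
  List.Forall P s <-> forall x, x \in s -> P x.
Proof.
elim: s => [|x s IH]; first by split => // _; constructor.
split => [h y|h].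
  by inversion h as [|? ? Px Ps]; rewrite inE => /orP[/eqP->//|];
    exact: (IH.1 Ps).
by constructor; [exact/h/mem_head|apply: IH.2 => y ys; apply: h;
  rewrite inE ys orbT].
Qed.

Definition close_set (I : Type) (g : I -> Rd ->
  R) (y : Rd) (s : seq I) (e : R) :
    set Rd := [set y' | List.Forall (fun i => `|g i y' - g i y| < e) s].

(* Z is the union of the preimages of rational boxes that have measure 0. *)
Lemma ess_points (I : countType) (g : I -> Rd -> R) :
  (forall i, measurable_fun setT (g i)) ->
  exists Z : set Rd, [/\ measurable Z, mu Z = 0%E &
    forall y, ~ Z y -> forall (s : seq I) (e : R), 0 < e ->
      measurable (close_set g y s e) /\ (0 < mu (close_set g y s e))%E].
Proof.
move=> mg.
pose B (t : seq (I * rat) * rat) : set Rd :=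
  [set y | List.Forall (fun iq => `|g iq.1 y - ratr iq.2| < ratr t.2) t.1].
have mB t : measurable (B t).
  exact: (@measurable_close _ (fun iq : I * rat => g iq.1) (fun iq => ratr iq.2)
    (fun=> ratr t.2) t.1 (fun iq => mg iq.1)).
pose Z n : set Rd := if (choice.unpickle n : option (seq (I * rat) * rat)) is
  Some t then
  (if mu (B t) == 0%E then B t else set0) else set0.
have mZ n : measurable (Z n) by rewrite /Z; case: choice.unpickle => // t;
  case: ifP.
have Z0 n : mu (Z n) = 0%E.
  rewrite /Z; case: choice.unpickle => [t|]; last exact: measure0.
  by case: eqP => // _; exact: measure0.
exists (\bigcup_n Z n); split.
- exact: bigcup_measurable.
- apply/negligibleP; first exact: bigcup_measurable.
  by apply: negligible_bigcup => n; apply/negligibleP; [exact: mZ|exact: Z0].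
move=> y nZy s e e0.
have mD : measurable (close_set g y s e).
  exact: (@measurable_close _ g (fun i => g i y) (fun=> e) s mg).
split => //.
(* As q < e / 2, a rational box of radius q containing y lies in the e-neighbourhood of y. *)
have [q] := rat_in_itvoo (divr_gt0 e0 (ltr0n R 2)).
rewrite in_itv/= => /andP[q0 qe].
have near i : exists r : rat, `|g i y - ratr r| < ratr q.
  have lt : g i y - ratr q < g i y + ratr q by rewrite ltrD2l gtrN.
  have [r] := rat_in_itvoo lt; rewrite in_itv/= => /andP[r1 r2].
  by exists r; rewrite distrC ltr_distl r1 r2.
have {near}[r rP] := choice near.
pose t : seq (I * rat) * rat := ([seq (i, r i) | i <- s], q).
have By : B t y by apply/ForallP => _ /mapP[i _ ->].
have Bt0 : mu (B t) != 0%E.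
  apply/eqP => B0; apply: nZy; exists (choice.pickle t) => //.
  by rewrite /Z choice.pickleK B0 eqxx.
apply: (@lt_le_trans _ _ (mu (B t))); first by rewrite lt0e Bt0 measure_ge0.
apply: le_measure; rewrite ?inE//.
move=> z /ForallP Bz; apply/ForallP => i si.
have := Bz (i, r i); rewrite map_f// => /(_ isT) /= h.
apply: le_lt_trans (ler_distD (ratr (r i)) _ _) _.
have h2 : `|ratr (r i) - g i y| < ratr q by rewrite distrC.
apply: lt_trans (ltrD h h2) _.
by rewrite [ltRHS](splitr e) ltrD.
Qed.

(** The indicator of a test set has to lie in L^p and be nonzero there. *)
Lemma finite_positive_subset (E : set Rd) : measurable E -> (0 < mu E)%E ->
  exists E', [/\ measurable E', E' `<=` E, (0 < mu E')%E & (mu E' < +oo)%E].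
Proof.
move=> mE E0; have /sigma_finiteP[F [FT ndF Foo]] := sigma_finiteT mu.
have mEF n : measurable (E `&` F n) by apply: measurableI => //; case: (Foo n).
suff [n n0] : exists n, mu (E `&` F n) != 0%E.
  exists (E `&` F n); split => //; first by rewrite lt0e n0 measure_ge0.
  apply: le_lt_trans (_ : mu (F n) < +oo)%E; last by case: (Foo n).
  by apply: le_measure; rewrite ?inE//; case: (Foo n).
apply: contrapT => /forallNP h.
suff : mu E = 0%E by move=> E00; move: E0; rewrite E00 ltxx.
apply/negligibleP => //; rewrite -(setIT E) FT setI_bigcupr.
apply: negligible_bigcup => n; apply/negligibleP; first exact: mEF.
by apply/eqP/negPn/negP; exact: h.
Qed.

End essential_points.

(** * Step functions over the translates of one set *)

Section step_functions.
Variables (R : realType) (d : nat) (p : \bar R).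
Hypothesis p1 : (1 <= p)%E.
Local Notation Rd := 'rV[R]_d.
Local Notation C := (complex R).
Local Notation mu := (@lebesgue_rV R d).
Variable E : set Rd.
Hypotheses (mE : measurable E) (E_gt0 : (0 < mu E)%E) (E_fin : (mu E < +oo)%E).

Let measurable_1E : measurable_fun setT (\1_E : Rd -> R).
Proof. exact: measurable_indic. Qed.

Definition indic_norm : R := fine 'N[mu]_p[EFin \o (\1_E : Rd -> R)]%E.

Lemma Lnorm_indic_lty : ('N[mu]_p[EFin \o (\1_E : Rd -> R)] < +oo)%E.
Proof.
rewrite unlock /Lnorm; case: p p1 => [r|_|//].
  rewrite lee_fin => r1; have r0 : r != 0 by rewrite gt_eqF// (lt_le_trans _
    r1).
  apply: poweR_lty; rewrite (_ : integral _ _ _ = mu E)//.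
  rewrite -[in RHS](setIT E) -integral_indic//; apply: eq_integral => y _ /=.
  rewrite indicE; case: (y \in E); first by rewrite normr1 powR1.
  by rewrite normr0 powR0.
case: ifP => // _; apply: (@le_lt_trans _ _ 1%E); last exact: ltry.
apply/ess_supP; apply: nearW => y /=; rewrite lee_fin indicE.
by case: (y \in E); rewrite ?normr1 ?normr0.
Qed.

Lemma indic_normE : 'N[mu]_p[EFin \o (\1_E : Rd -> R)]%E = indic_norm%:E.
Proof. by rewrite /indic_norm fineK// ge0_fin_numE ?Lnorm_ge0//
  Lnorm_indic_lty. Qed.

Lemma indic_norm_gt0 : 0 < indic_norm.
Proof.
rewrite -lte_fin -indic_normE lt0e Lnorm_ge0 andbT; apply/eqP => N0.
have m1 : measurable_fun setT (EFin \o (\1_E : Rd ->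
  R)) by exact/measurable_EFinP.
have := Lnorm_eq0_eq0 m1 (lt_le_trans lte01 p1) N0.
move=> [N [mN muN NE]]; move: E_gt0; rewrite (subset_measure0 mE mN) ?ltxx//.
move=> y Ey; apply: NE => /= /(_ I)/eqP.
by rewrite indicE mem_set// eqe oner_eq0.
Qed.

Definition step (h : Rd -> R) (z : Rd) : R :=
  gsum (fun y => h y * (\1_E (z - y) : R)).

Lemma stepE (h : Rd -> R) s : uniq s -> (forall y, y \notin s -> h y = 0) ->
  step h = fun z => \sum_(y <- s) h y * (\1_E (z - y) : R).
Proof.
move=> us sh; apply/funext => z; rewrite /step (gsumE us)// => y /sh ->.
by rewrite mul0r.
Qed.

Lemma finsupp_step (h : Rd -> R) z : finsupp h ->
  finsupp (fun y => h y * (\1_E (z - y) : R)).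
Proof. by move=> fh; apply: finsupp_dom fh _ => y ->; rewrite mul0r. Qed.

Lemma measurable_indic_shift x :
  measurable_fun setT (fun z : Rd => (\1_E (z - x) : R)).
Proof. by apply: (measurableT_comp measurable_1E);
  exact: measurable_translation. Qed.

Lemma measurable_step h : finsupp h -> measurable_fun setT (step h).
Proof.
move=> /finsupp_uniq[s us sh]; rewrite (stepE us sh).
apply: measurable_sum => y; apply: measurable_funM => //.
exact: measurable_indic_shift.
Qed.

Lemma step_ge0 h z : finsupp h -> (forall y, 0 <= h y) -> 0 <= step h z.
Proof.
by move=> fh h0; apply: gsum_ge0 => [|y];
  [exact: finsupp_step|rewrite mulr_ge0].
Qed.

Lemma Lnorm_step_le h : finsupp h -> (forall y, 0 <= h y) ->
  ('N[mu]_p[EFin \o step h] <= (gsum h * indic_norm)%:E)%E.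
Proof.
move=> /finsupp_uniq[s us sh] h0; rewrite (stepE us sh) (gsumE us sh).
move=> {us sh}; elim: s => [|y s IH].
  rewrite big_nil mul0r.
  rewrite (_ : EFin \o _ = cst 0%E); last first.
    by apply/funext => z /=; rewrite big_nil.
  have p0 : p != 0%E by rewrite gt_eqF// (lt_le_trans _ p1).
  by rewrite (Lnorm0 mu p0) lexx.
rewrite big_cons mulrDl EFinD.
rewrite (_ : (fun z => _) = (fun z => h y * (\1_E (z - y) : R)) \+
    (fun z => \sum_(x <- s) h x * (\1_E (z - x) : R))); last first.
  by apply/funext => z; rewrite big_cons.
apply: le_trans (eminkowski mu _ _ p1) _.
- by apply: measurable_funM => //; exact: measurable_indic_shift.
- apply: measurable_sum => x; apply: measurable_funM => //.
  exact: measurable_indic_shift.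
apply: leeD => //.
apply: le_trans (LnormZ_le p1 (measurable_indic_shift y) (h0 y)) _.
by rewrite (Lnorm_shift p1 y measurable_1E) indic_normE EFinM.
Qed.

(** Dividing by the norm of 1_E gives a single translate norm 1, as the comparisons with the sup
    norm and the l^1 norm require. *)
Definition step_norm (h : Rd -> R) : R :=
  fine 'N[mu]_p[EFin \o step h]%E / indic_norm.

Lemma Lnorm_stepE h : finsupp h -> (forall y, 0 <= h y) ->
  'N[mu]_p[EFin \o step h]%E = (step_norm h * indic_norm)%:E.
Proof.
move=> fh h0; rewrite /step_norm divfK ?gt_eqF ?indic_norm_gt0//.
rewrite fineK// ge0_fin_numE ?Lnorm_ge0//.
by apply: le_lt_trans (Lnorm_step_le fh h0) _; exact: ltry.
Qed.

Lemma solid_step_norm : solid_norm step_norm.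
Proof.
have c0 := indic_norm_gt0.
have le_norm h k : finsupp h -> (forall y, 0 <= h y) -> finsupp k ->
    (forall y, 0 <= k y) -> (forall z, step h z <= step k z) ->
    step_norm h <= step_norm k.
  move=> fh h0 fk k0 hk.
  rewrite -(ler_pM2r c0) -lee_fin -!Lnorm_stepE//; apply: le_Lnorm => //.
  - exact: measurable_step.
  - exact: measurable_step.
  - by apply: nearW => z; rewrite !ger0_norm// step_ge0.
split.
- move=> f g ff fg fgle.
  have f0 y : 0 <= f y by have /andP[] := fgle y.
  have g0 y : 0 <= g y by have /andP[/le_trans] := fgle y; apply.
  apply: le_norm => // z; apply: ler_gsum; try exact: finsupp_step.
  by move=> y; rewrite ler_wpM2r//; have /andP[] := fgle y.
- move=> f g ff fg f0 g0.
  have ffg := finsuppD ff fg.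
  rewrite -(ler_pM2r c0) mulrDl -lee_fin EFinD -!Lnorm_stepE//; last first.
    by move=> y; rewrite addr_ge0.
  rewrite (_ : step _ = step f \+ step g).
    by apply: eminkowski => //; exact: measurable_step.
  apply/funext => z /=; rewrite /step -gsumD; try exact: finsupp_step.
  by congr gsum; apply/funext => y; rewrite mulrDl.
- move=> c f ff f0 cc0.
  have fcf : finsupp (fun y => c * f y).
    by apply: finsupp_dom ff _ => y ->; rewrite mulr0.
  rewrite -(ler_pM2r c0) -[leRHS]mulrA -lee_fin [X in (_ <=
    X)%E]EFinM -!Lnorm_stepE//; last first.
    by move=> y; rewrite mulr_ge0.
  rewrite (_ : step _ = fun z => c * step f z).
    by apply: LnormZ_le => //; exact: measurable_step.
  apply/funext => z /=; rewrite /step -gsumZ; last exact: finsupp_step.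
  by congr gsum; apply/funext => y; rewrite mulrA.
- move=> x f ff f0; have fs := finsupp_shift x ff.
  rewrite -(ler_pM2r c0) -lee_fin -!Lnorm_stepE//.
  rewrite (_ : step _ = fun z => step f (z - x)).
    by rewrite (Lnorm_shift p1)//; exact: measurable_step.
  apply/funext => z; rewrite /step -[RHS](gsum_shift _ x).
  by congr gsum; apply/funext => y; rewrite opprB addrA subrK.
(* The single term f k 1_(E + k) is dominated by the whole sum, all of whose terms are
   nonnegative. *)
- move=> k f ff f0; have [fk0|fk0] := leP (f k) 0.
    apply: le_trans fk0 _; rewrite /step_norm divr_ge0 ?(ltW c0)//.
    by apply: fine_ge0; exact: Lnorm_ge0.
  rewrite -[leLHS]mulr1 -ler_pdivlMl// -(ler_pM2r c0) mul1r -[leRHS]mulrA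
    -lee_fin -indic_normE EFinM.
  rewrite -Lnorm_stepE// -(Lnorm_shift p1 k measurable_1E).
  apply: le_trans (LnormZ_le p1 (measurable_step ff) _); last first.
    by rewrite invr_ge0 ltW.
  apply: le_Lnorm => //.
  + exact: measurable_indic_shift.
  + by apply: measurable_funM => //; exact: measurable_step.
  apply: nearW => z; rewrite !ger0_norm ?mulr_ge0 ?invr_ge0 ?(ltW fk0)
    ?step_ge0//.
  rewrite ler_pdivlMl//; apply: (gsum_ge1 (g :=
    fun y => f y * (\1_E (z - y) : R))).
    exact: finsupp_step.
  by move=> y; rewrite mulr_ge0.
- move=> f ff f0; rewrite -(ler_pM2r c0) -lee_fin -Lnorm_stepE//.
  exact: Lnorm_step_le.
Qed.

End step_functions.

(** * From L^p to one orbit of the group *)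

Section transfer.
Variables (R : realType) (d : nat) (p : \bar R).
Hypothesis p1 : (1 <= p)%E.
Local Notation Rd := 'rV[R]_d.
Local Notation C := (complex R).
Local Notation mu := (@lebesgue_rV R d).

(** Applied to the differences of the points of S: if E lies within r / 2 of y in every coordinate,
    its translates E + s with s in S are disjoint. *)
Lemma separation (T : seq Rd) : exists2 r : R, 0 < r &
  forall t, t \in T -> t != 0 -> exists i, r <= `|t ord0 i|.
Proof.
elim: T => [|t T [r r0 IH]]; first by exists 1.
have [->|t0] := eqVneq t 0.
  by exists r => // s; rewrite inE => /orP[/eqP->|]; [rewrite eqxx|exact: IH].
have [i ti] : exists i, t ord0 i != 0.
  by apply/existsP; move: t0; apply: contraNT => /existsPn h;
    apply/eqP/rowP => i; rewrite mxE; apply/eqP/negPn; exact: h.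
exists (Num.min r `|t ord0 i|); first by rewrite lt_min r0 normr_gt0.
move=> s; rewrite inE => /orP[/eqP-> _|sT s0].
  by exists i; rewrite ge_min lexx orbT.
by have [j sj] := IH _ sT s0; exists j; rewrite ge_min sj.
Qed.

Lemma cmeasurable_sum (I : Type) (s : seq I) (f : I -> Rd -> C) :
  (forall i, cmeasurable (f i)) -> cmeasurable (fun y => \sum_(i <- s) f i y).
Proof.
move=> mf; elim: s => [|i s IH].
  rewrite (_ : (fun y => _) = fun=> 0); first exact: cmeasurable_cst.
  by apply/funext => y; rewrite big_nil.
rewrite (_ : (fun y => _) = fun y => f i y + \sum_(j <- s) f j y).
  exact: cmeasurableD.
by apply/funext => y; rewrite big_cons.
Qed.

Definition cstep (E : set Rd) (v : Rd -> C) (z : Rd) : C :=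
  gsum (fun y => v y * real_complex R (\1_E (z - y))).

Variables (m : Rd -> Rd -> C) (F S : seq Rd) (K : R) (y : Rd) (Gam : set Rd).
Hypotheses (mm : forall x, cmeasurable (m x)) (K0 : 0 < K)
  (low : forall f, in_Lp p f ->
    (Lp_norm p f <= K%:E * Lp_norm p (trunc m F f))%E)
  (FGam : forall x, x \in F -> Gam x) (SGam : forall x, x \in S -> Gam x)
  (GamD : forall x x', Gam x -> Gam x' -> Gam (x + x'))
  (close : forall (S' : seq Rd) (r e : R), (forall x, x \in S' -> Gam x) ->
    0 < r -> 0 < e -> exists E : set Rd, [/\ measurable E, (0 < mu E)%E,
      (mu E < +oo)%E &
      forall y', E y' -> (forall i, `|y' ord0 i - y ord0 i| < r) /\
        forall x t, x \in F -> t \in S' -> cmod (m x (y' + t) - m x (y + t)) <=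
          e]).

(** The test function is f = sum of v(s) 1_(E + s). On E + s each coefficient is within e of its
    value at y + s, so the image of f is the step function of the matrix image of v, up to e times
    the translates of |v|. The norm [nu] depends on y, F and S; the constant 2 K does not. *)
Lemma transfer_lower_bound : exists2 nu, solid_norm nu &
  forall v : Rd -> C, (forall z, z \notin S -> v z = 0) ->
  nu (@cmod R \o v) <=
  (2 * K) * nu (@cmod R \o trunc (fun x t => m x (y + t)) F v).
Proof.
(* Closeness is needed at the points carrying v and at those reached by its image. *)
pose S' := S ++ [seq s + x | s <- S, x <- F].
have S'Gam x : x \in S' -> Gam x.
  rewrite mem_cat => /orP[/SGam//|/allpairsP[[s t] /= [sS tF ->]]].
  by apply: GamD; [exact: SGam|exact: FGam].
have [r r0 sep] := separation [seq s - t | s <- S, t <- S].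
(* Makes K * e * size F at most 1 / 2, so that absorbing the error costs a factor 2. *)
pose e := (2 * K * (size F).+1%:R)^-1.
have e0 : 0 < e by rewrite invr_gt0 !mulr_gt0.
have [E [mE E0 Efin closeE]] := close S'Gam (divr_gt0 r0 (ltr0n R 2)) e0.
have hnu := solid_step_norm p1 mE E0 Efin.
have c0 := indic_norm_gt0 p1 mE E0 Efin.
exists (step_norm p E) => // v vS.
have fv : finsupp v by exists S.
have fcv : finsupp (@cmod R \o v).
  by apply: finsupp_dom fv _ => z /= ->; rewrite cmod0.
have cv0 z : 0 <= (@cmod R \o v) z by exact: cmod_ge0.
set f := cstep E v.
(* By disjointness at most one term is nonzero at z, so the modulus passes inside the sum. For the
   image of f an inequality will do. *)
have fE z : cmod (f z) = step E (@cmod R \o v) z.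
  have [[t [tS tE]]|none] := pselect (exists t, t \in S /\ E (z - t)).
    have out s : s \notin [:: t] -> v s = 0 \/ \1_E (z - s) = 0 :> R.
      rewrite mem_seq1 => st; have [sS|/vS] := boolP (s \in S); last by left.
      right; rewrite indicE; case: (boolP (z - s \in E)) => //.
      rewrite inE => sE; exfalso.
      have st0 : s - t != 0 by rewrite subr_eq0.
      have [|i] := sep _ _ st0; first by apply/allpairsP; exists (s, t).
      have [h1 _] := closeE _ tE; have [h2 _] := closeE _ sE.
      have := h1 i; have := h2 i; rewrite !mxE distrC => h3 h4.
      rewrite leNgt => /negP; apply.
      rewrite (_ : s ord0 i - t ord0 i = (y ord0 i - (z ord0 i - s ord0 i)) +
        ((z ord0 i - t ord0 i) - y ord0 i)); last by ring.
      by rewrite (le_lt_trans (ler_normD _ _))// [ltRHS]splitr ltrD.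
    rewrite /f /cstep /step !(@gsumE _ _ [:: t])// ?big_seq1.
    - by rewrite cmodM cmod_real ger0_norm.
    - by move=> s /out[/= ->|->]; rewrite ?cmod0 ?mul0r ?mulr0.
    - by move=> s /out[->|->]; rewrite ?mul0r// rmorph0 mulr0.
  have out s : v s = 0 \/ \1_E (z - s) = 0 :> R.
    have [sS|/vS] := boolP (s \in S); last by left.
    right; rewrite indicE; case: (boolP (z - s \in E)) => //.
    by rewrite inE => sE; exfalso; apply: none; exists s.
  rewrite /f /cstep /step !(@gsumE _ _ [::])// ?big_nil ?cmod0//.
  - by move=> s _; have /= [->|->] := out s; rewrite ?cmod0 ?mul0r ?mulr0.
  - by move=> s _; have [->|->] := out s; rewrite ?mul0r// rmorph0 mulr0.
have mf : cmeasurable f.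
  have [s us sv] := finsupp_uniq fv.
  rewrite (_ : f = fun z => \sum_(t <- s) v t * real_complex R (\1_E (z - t))).
    apply: cmeasurable_sum => t; apply: cmeasurableM;
      first exact: cmeasurable_cst.
    by split => /=; [exact: measurable_indic_shift|exact: measurable_cst].
  apply/funext => z; rewrite /f /cstep (gsumE us)// => t /sv ->.
  by rewrite mul0r.
have Nf : Lp_norm p f = (step_norm p E (@cmod R \o v) * indic_norm p E)%:E.
  rewrite -Lnorm_stepE//; congr (Lnorm _ _ _).
  by apply/funext => z /=; rewrite fE.
have inf : in_Lp p f by split => //; rewrite Nf ltry.
set A := trunc (fun x t => m x (y + t)) F v.
have fA : finsupp A by exact: finsupp_trunc.
have fcA : finsupp (@cmod R \o A).
  by apply: finsupp_dom fA _ => z /= ->; rewrite cmod0.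
have cA0 z : 0 <= (@cmod R \o A) z by exact: cmod_ge0.
pose q x z := (@cmod R \o v) (z - x).
have fq x : finsupp (q x) by exact: (finsupp_shift x fcv).
have q0 x z : 0 <= q x z by exact: cmod_ge0.
pose h z := e * \sum_(x <- F) q x z.
have fsq : finsupp (fun z => \sum_(x <- F) q x z) by exact: finsupp_sum.
have sq0 z : 0 <= \sum_(x <- F) q x z by exact: sumr_ge0.
have fh : finsupp h by apply: finsupp_dom fsq _ => z; rewrite /h => ->;
  rewrite mulr0.
have h0 z : 0 <= h z by rewrite mulr_ge0// ltW.
pose g z := (@cmod R \o A) z + h z.
have fg : finsupp g by exact: finsuppD.
have g0 z : 0 <= g z by rewrite addr_ge0.
have pt z : cmod (trunc m F f z) <= step E g z.
  pose k x s := m x z * (v (s - x) * real_complex R (\1_E (z - s))).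
  have fk x : finsupp (k x).
    by apply: finsupp_dom (finsupp_shift x fv) _ => s; rewrite /k => ->;
      rewrite mul0r mulr0.
  have -> : trunc m F f z = gsum (fun s => \sum_(x <- F) k x s).
    rewrite gsum_sum//; apply: eq_bigr => x _; rewrite /k gsumZ; last first.
      by apply: finsupp_dom (finsupp_shift x fv) _ => s ->; rewrite mul0r.
    congr (_ * _); rewrite /f /cstep -[LHS](gsum_shift _ x).
    by congr gsum; apply/funext => s; rewrite opprB addrA subrK.
  apply: le_trans (ler_cmod_gsum (finsupp_sum _ fk)) _.
  apply: ler_gsum.
  - by apply: finsupp_dom (finsupp_sum F fk) _ => s ->; rewrite cmod0.
  - exact: finsupp_step.
  move=> s; rewrite /k.
  have [sE|sE] := boolP (z - s \in E); last first.
    rewrite indicE (negbTE sE) mulr0 big1 ?cmod0// => x _.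
    by rewrite rmorph0 !mulr0.
  rewrite indicE sE mulr1.
  have [sS'|sS'] := boolP (s \in S'); last first.
    rewrite big_seq big1 ?cmod0// => x xF; rewrite vS ?mul0r ?mulr0//.
    apply: contra sS' => sx; rewrite mem_cat; apply/orP; right.
    by apply/allpairsP; exists (s - x, x); split => //=; rewrite subrK.
  move: sE; rewrite inE => sE; have [_ cl] := closeE _ sE.
  rewrite (_ : \sum_(x <- F) _ = A s +
      \sum_(x <- F) (m x z - m x (y + s)) * v (s - x)); last first.
    rewrite /A /trunc -big_split; apply: eq_bigr => x _ /=.
    by rewrite rmorph1; ring.
  apply: le_trans (ler_cmodD _ _) _; rewrite /g lerD2l.
  apply: le_trans (ler_cmod_sum _ _) _; rewrite /h mulr_sumr !big_seq.
  apply: ler_sum => x xF; rewrite cmodM ler_wpM2r ?cmod_ge0//.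
  by have := cl x s xF sS'; rewrite subrK.
have mtf : cmeasurable (trunc m F f).
  apply: cmeasurable_sum => x; apply: cmeasurableM => //;
    exact: cmeasurable_shift.
have Naf : (Lp_norm p (trunc m F f) <= (step_norm p E g * indic_norm p E)%:E)%E.
  rewrite -Lnorm_stepE//; apply: le_Lnorm => //.
  - exact: measurable_cmod.
  - exact: measurable_step.
  - by apply: nearW => z /=; rewrite !ger0_norm ?cmod_ge0 ?step_ge0//;
    exact: pt.
have : (Lp_norm p f <= K%:E * (step_norm p E g * indic_norm p E)%:E)%E.
  by apply: le_trans (low inf) _; rewrite lee_pmul2l.
rewrite Nf -EFinM lee_fin mulrA ler_pM2r// => H.
have qle x : step_norm p E (q x) <= step_norm p E (@cmod R \o v).
  exact: solid_shift.
have hle : step_norm p E h <= e * ((size F)%:R * step_norm p E (@cmod R \o v)).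
  apply: le_trans (solidZ hnu fsq sq0 (ltW e0)) _.
  rewrite ler_pM2l//; apply: le_trans (solid_sum _ hnu fq q0) _.
  apply: le_trans (ler_sum _ (fun x _ => qle x)) _.
  by rewrite big_const_seq count_predT iter_addr_0 mulr_natl.
have gle := solidD hnu fcA fh cA0 h0.
have v0 : 0 <= step_norm p E (@cmod R \o v).
  by apply: le_trans (solid_ge hnu 0 fcv cv0); exact: cv0.
have eK : K * (e * (size F)%:R) <= 2^-1.
  have n0 : 0 < (size F).+1%:R :> R by [].
  rewrite /e (_ : K * _ = (size F)%:R / (2 * (size F).+1%:R)); last first.
    by field; rewrite !gt_eqF.
  by rewrite ler_pdivrMr ?mulr_gt0// mulKf// ler_nat.
have h2 := ler_wpM2r v0 eK.
have h1 := le_trans H (ler_wpM2l (ltW K0) (le_trans gle (lerD (lexx _) hle))).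
move: h1 h2; set V := step_norm p E (@cmod R \o v).
set Y := step_norm p E (@cmod R \o A).
rewrite (_ : K * (Y + _) = K * Y + K * (e * (size F)%:R) * V); last by ring.
by lra.
Qed.

End transfer.

(** * Truncations of the series *)

Section admissible_weights.
Variables (R : realType) (d : nat) (w : 'rV[R]_d -> R).

Lemma admissible_ge1 : weight w -> admissible w -> forall x, 1 <= w x.
Proof.
move=> [_ wpos wN] [w0 wD _] x; rewrite leNgt; apply/negP => wx.
have := wD x (- x); rewrite subrr w0 wN.
by rewrite leNgt => /negP; apply; rewrite mulr_ilt1 ?ltW.
Qed.

Lemma admissible_growth : weight w -> admissible w -> forall x (q : R), 1 < q ->
  exists2 A, 0 <= A & forall k, w (x *+ k) <= A * q ^+ k.
Proof.
move=> [_ wpos wN] [w0 wD wlim] x q q1.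
have w_ge0 y : 0 <= w y by exact: ltW.
have q0 : 0 <= q by apply: le_trans (ltW q1).
have /cvgrPdist_le/(_ _ (_ : 0 < q - 1))[|J _ HJ] := wlim x.
  by rewrite subr_gt0.
(* From J on the k-th root is at most q; the finitely many earlier weights are absorbed in the
   constant. *)
exists (1 + \sum_(i < J) w (x *+ i)); first by rewrite addr_ge0// sumr_ge0.
move=> k; have [kJ|Jk] := ltnP k J.
  apply: (@le_trans _ _ (w (x *+ k))) => //.
  apply: (@le_trans _ _ (1 + \sum_(i < J) w (x *+ i))); last first.
    by rewrite ler_peMr ?addr_ge0 ?sumr_ge0// exprn_ege1// ltW.
  by rewrite (bigD1 (Ordinal kJ))//= addrCA lerDl addr_ge0// sumr_ge0.
apply: (@le_trans _ _ (q ^+ k)); last first.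
  by rewrite ler_peMl ?exprn_ge0// lerDl sumr_ge0.
(* At k = 0 the exponent [k%:R^-1] is 0 and the limit says nothing about w. *)
case: k Jk => [|k] Jk; first by rewrite mulr0n w0.
have := HJ _ Jk; rewrite scaler_nat; set a := w _ => h.
have a0 : 0 <= a by exact: w_ge0.
have aq : a `^ k.+1%:R^-1 <= q.
  rewrite -[leLHS](addrK 1) -[leRHS](subrK 1) addrAC lerD2r.
  by apply: le_trans (ler_norm _) _; rewrite distrC.
have -> : a = (a `^ k.+1%:R^-1) ^+ k.+1.
  by rewrite -powR_mulrn ?powR_ge0// -powRrM mulVf// powRr1.
by rewrite ler_pXn2r// nnegrE ?powR_ge0.
Qed.

End admissible_weights.

Section Linfty.
Variables (R : realType) (d : nat).
Local Notation Rd := 'rV[R]_d.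
Local Notation C := (complex R).
Local Notation mu := (@lebesgue_rV R d).

Lemma Linfty_ae (f : Rd -> C) : in_Lp +oo f ->
  {ae mu, forall y, cmod (f y) <= fine (Lp_norm +oo f)}.
Proof.
move=> [mf]; rewrite /Lp_norm unlock /Lnorm; case: ifPn => [_ fy|mu0 _].
  apply: filterS (ess_sup_ge mu (abse \o (EFin \o (@cmod R \o f)))) => y.
  case: (ess_sup _ _) fy => [r _|//|_] /=; last by rewrite leeNy_eq.
  by rewrite lee_fin ger0_norm ?cmod_ge0.
(* In this branch the norm is 0 by convention, as the whole space is null; then any property holds
   almost everywhere. *)
exists setT; split => //.
by apply/eqP; rewrite eq_le measure_ge0 andbT leNgt.
Qed.

Lemma Linfty_le (f : Rd -> C) (c : R) : 0 <= c -> (forall y, cmod (f y) <= c) ->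
  (Lp_norm +oo f <= c%:E)%E.
Proof.
move=> c0 fc; rewrite /Lp_norm unlock /Lnorm; case: ifP => _;
  last by rewrite lee_fin.
apply/ess_supP; apply: nearW => y /=.
by rewrite lee_fin ger0_norm ?cmod_ge0.
Qed.

End Linfty.

Section exhaustion.
Variables (R : realType) (T : choiceType) (a : T -> R).
Hypotheses (a0 : forall x, 0 <= a x)
  (a_sum : (\esum_(x in [set: T]) (a x)%:E < +oo)%E).

Lemma sum_le_esum (D : seq T) : uniq D ->
  \sum_(x <- D) a x <= fine (\esum_(x in [set: T]) (a x)%:E).
Proof.
move=> uD; rewrite -lee_fin fineK; last first.
  by rewrite ge0_fin_numE// esum_ge0// => x _; rewrite lee_fin.
apply: esum_ge; exists [set` D]; first by split => //; exact: finite_seq.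
by rewrite -fsbig_seq// sumEFin.
Qed.

Lemma small_tail (e : R) : 0 < e -> exists2 F, uniq F &
  forall D, uniq D -> (forall x, x \in D -> x \notin F) -> \sum_(x <- D) a x <=
    e.
Proof.
move=> e0; pose S := [set \sum_(x <- F) a x | F in [set F | uniq F]].
have S_sup : has_sup S.
  split; first by exists (\sum_(x <- [::]) a x); exists [::].
  by exists (fine (\esum_(x in [set: T]) (a x)%:E)) => _ [F uF <-];
    exact: sum_le_esum.
have [_ [F uF <-] h] := sup_adherent e0 S_sup.
exists F => // D uD DF.
have : \sum_(x <- F ++ D) a x <= sup S.
  apply: sup_upper_bound => //; exists (F ++ D) => //=.
  rewrite cat_uniq uF uD andbT /=; apply/hasPn => x xD; exact: DF.
by rewrite big_cat/=; move: h; lra.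
Qed.

(** Every list is a literal prefix of the later ones, so that truncations split along [++] without
    reordering. *)
Lemma exhaustion : exists F : nat -> seq T,
  [/\ forall j, uniq (F j),
    forall i j, (j <= i)%N -> exists D, F i = F j ++ D &
    forall e, 0 < e -> exists J, forall j, (J <= j)%N -> forall D, uniq D ->
      (forall x, x \in D -> x \notin F j) -> \sum_(x <- D) a x <= e].
Proof.
have pos j : 0 < j.+1%:R^-1 :> R by rewrite invr_gt0.
have {pos} : forall j : nat, exists F, uniq F /\ forall D, uniq D ->
    (forall x, x \in D -> x \notin F) -> \sum_(x <- D) a x <= j.+1%:R^-1.
  by move=> j; have [F uF HF] := small_tail (pos j); exists F.
move=> /choice[G HG].
pose F := fix F j := if j is j'.+1 then F j' ++ [seq x <- G j'.+1 | x \notin F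
  j']
  else G 0%N.
have GF j : {subset G j <= F j}.
  case: j => [|j] x //= xG; rewrite mem_cat mem_filter xG andbT.
  by case: (x \in F j).
exists F; split.
- elim=> [|j IH] /=; first by case: (HG 0%N).
  rewrite cat_uniq IH filter_uniq ?(HG j.+1).1// andbT /=.
  by apply/hasPn => x; rewrite mem_filter => /andP[].
- move=> i j; elim: i => [|i IH].
    by rewrite leqn0 => /eqP ->; exists [::]; rewrite cats0.
  rewrite leq_eqVlt => /orP[/eqP->|]; first by exists [::]; rewrite cats0.
  rewrite ltnS => /IH[D FD]; exists (D ++ [seq x <- G i.+1 | x \notin F i]).
  by rewrite /= FD catA.
- move=> e e0; have [J HJ] := ltr_add_invr e0; exists J => j Jj D uD DF.
  apply: le_trans ((HG j).2 D uD _) _.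
    by move=> x /DF; apply: contra; exact: GF.
  rewrite add0r in HJ; apply: le_trans (ltW HJ).
  by rewrite lef_pV2 ?posrE// ler_nat.
Qed.

End exhaustion.

Section truncations.
Variables (R : realType) (d : nat).
Local Notation Rd := 'rV[R]_d.
Local Notation C := (complex R).
Variables (w : Rd -> R) (m : Rd -> Rd -> C) (u : Rd -> R).
Hypotheses (wN : forall x, w (- x) = w x) (mm : forall x, cmeasurable (m x))
  (mu : forall x y, cmod (m x y) <= u x).

(** The adjoint of m_x T_x is T_(-x) followed on the right by multiplication with conj m_x, an atom
    with coefficient conj m_x (. + x). As w is even, it has the same A_w bound. *)
Definition trunc_adj (F : seq Rd) (g : Rd -> C) : Rd -> C :=
  fun y => \sum_(x <- F) conjc (m x (y + x)) * g (y + x).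

Lemma Aw_trunc F : Aw w setT (trunc m F) (\sum_(x <- F) u x * w x).
Proof.
elim: F => [|x F IH].
  apply: Aw_ext (Aw0 _ _ _) => [f y|]; last by rewrite big_nil.
  by rewrite /trunc big_nil.
apply: Aw_ext (Aw_cons (x := x) _ (mm x) (mu x) IH _) => [f y|//|].
  by rewrite /trunc big_cons.
by rewrite big_cons.
Qed.

Lemma Aw_trunc_adj F : Aw w setT (trunc_adj F) (\sum_(x <- F) u x * w x).
Proof.
elim: F => [|x F IH].
  apply: Aw_ext (Aw0 _ _ _) => [f y|]; last by rewrite big_nil.
  by rewrite /trunc_adj big_nil.
have mx : cmeasurable (fun y => conjc (m x (y - - x))).
  by apply: cmeasurable_conj; exact: cmeasurable_shift.
have mux y : cmod (conjc (m x (y - - x))) <= u x by rewrite cmodJ.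
apply: Aw_ext (Aw_cons (x := - x) _ mx mux IH _) => [f y|//|].
  by rewrite /trunc_adj big_cons opprK.
by rewrite big_cons wN.
Qed.

Lemma trunc_adjP F f g : finsupp f -> finsupp g ->
  re_ip f (trunc_adj F g) = re_ip (trunc m F f) g.
Proof.
move=> ff fg; pose h x z := complex.Re (conjc (m x z * f (z - x)) * g z).
have fh x : finsupp (h x).
  by apply: finsupp_dom fg _ => z; rewrite /h => ->; rewrite mulr0.
transitivity (\sum_(x <- F) gsum (h x)).
  have fh' x : finsupp (fun y => h x (y - - x)) by exact: finsupp_shift.
  rewrite -[RHS](eq_bigr _ (fun x _ => gsum_shift (h x) (- x))) -gsum_sum//.
  congr gsum; apply/funext => y; rewrite /trunc_adj mulr_sumr raddf_sum.
  apply: eq_bigr => x _; rewrite /h opprK addrK rmorphM /=.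
  by rewrite mulrA [conjc (f y) * _]mulrC.
rewrite -gsum_sum//; congr gsum; apply/funext => z.
by rewrite /trunc rmorph_sum mulr_suml raddf_sum.
Qed.

Lemma trunc_cat F D f y : trunc m (F ++ D) f y = trunc m F f y + trunc m D f y.
Proof. by rewrite /trunc big_cat. Qed.

Lemma trunc_adj_cat F D f y :
  trunc_adj (F ++ D) f y = trunc_adj F f y + trunc_adj D f y.
Proof. by rewrite /trunc_adj big_cat. Qed.

End truncations.

(** * The countable group of translations and its exceptional null set *)

Section good_points.
Variables (R : realType) (d : nat).
Local Notation Rd := 'rV[R]_d.
Local Notation C := (complex R).
Local Notation mu := (@lebesgue_rV R d).
Variable F : nat -> seq Rd.

(** Past the end of a list the value is the default 0, which adds nothing to the group generated. *)
Let gen (jk : nat * nat) : Rd := nth 0 (F jk.1) jk.2.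

(** Signed words, coded in a countable type: the codes enumerate the subgroup, so null sets indexed
    by it can be united. *)
Definition comb (l : seq (bool * (nat * nat))) : Rd :=
  \sum_(t <- l) (if t.1 then - gen t.2 else gen t.2).

Definition subgroup_gen : set Rd := range comb.

Lemma subgroup_gen0 : subgroup_gen 0.
Proof. by exists [::] => //; rewrite /comb big_nil. Qed.

Lemma subgroup_genD x y : subgroup_gen x -> subgroup_gen y ->
  subgroup_gen (x + y).
Proof.
by move=> [l _ <-] [l' _ <-]; exists (l ++ l') => //; rewrite /comb big_cat.
Qed.

Lemma subgroup_genN x : subgroup_gen x -> subgroup_gen (- x).
Proof.
move=> [l _ <-]; exists [seq (~~ t.1, t.2) | t <- l] => //.
rewrite /comb big_map -sumrN; apply: eq_bigr => -[[] jk] _ //=.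
by rewrite opprK.
Qed.

Lemma subgroup_genB x y : subgroup_gen x -> subgroup_gen y ->
  subgroup_gen (x - y).
Proof. by move=> Gx /subgroup_genN; exact: subgroup_genD. Qed.

Lemma mem_subgroup_gen j x : x \in F j -> subgroup_gen x.
Proof.
move=> xF; exists [:: (false, (j, index x (F j)))] => //.
by rewrite /comb big_seq1 /gen nth_index.
Qed.

Variables (m : Rd -> Rd -> C) (u : Rd -> R).
Hypotheses (mm : forall x, cmeasurable (m x))
  (mu_ae : forall x, {ae mu, forall y, cmod (m x y) <= u x}).

(** Essential points are taken for the coordinates and for the real and imaginary parts of all m_x
    (. + t), with x a generator and t in the group. This family is countable and controls the
    coefficients along the whole orbit of y. Uniting the translates of the null set makes it
    invariant, so an orbit lies inside Z or outside it. E avoids Z because the coefficients will be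
    altered there. *)
Lemma good_points : exists Z : set Rd, [/\ measurable Z, mu Z = 0%E,
    forall y x, subgroup_gen x -> Z (y + x) -> Z y,
    forall y, ~ Z y -> forall j x, x \in F j -> cmod (m x y) <= u x &
    forall y, ~ Z y -> forall j (S : seq Rd) (r e : R),
      (forall x, x \in S -> subgroup_gen x) -> 0 < r -> 0 < e ->
      exists E : set Rd, [/\ measurable E, (0 < mu E)%E, (mu E < +oo)%E,
        forall y', E y' -> ~ Z y' &
        forall y', E y' -> (forall i, `|y' ord0 i - y ord0 i| < r) /\
          forall x t, x \in F j -> t \in S ->
            cmod (m x (y' + t) - m x (y + t)) <= e]].
Proof.
pose part (b : bool) (z : C) := if b then complex.Re z else complex.Im z.
pose g (i : 'I_d + (nat * nat) * seq (bool * (nat * nat)) * bool) (y : Rd) : R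
  :=
  match i with
  | inl i => y ord0 i
  | inr (jk, l, b) => part b (m (gen jk) (y + comb l))
  end.
have mg i : measurable_fun setT (g i).
  case: i => [i|[[jk l] b]] /=; first exact: measurable_coord_rV.
  have := cmeasurable_shift (- comb l) (mm (gen jk)).
  by move=> []; rewrite opprK; case: b.
have [Z1 [mZ1 Z10 HZ1]] := ess_points mg.
have bad jk : exists N, [/\ measurable N, mu N = 0%E &
    forall y, ~ N y -> cmod (m (gen jk) y) <= u (gen jk)].
  have [N [mN N0 HN]] := mu_ae (gen jk); exists N; split => // y nNy.
  by apply: contrapT => h; apply: nNy; apply: HN.
have {bad}[N HN] := choice bad.
pose Z2 := \bigcup_n (if choice.unpickle n is Some jk then N jk else set0).
have mU (J : countType) (A : J -> set Rd) : (forall j, measurable (A j) /\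
  mu (A j) = 0%E) ->
    measurable (\bigcup_n (if choice.unpickle n is Some j then A j else set0))
      /\
    mu (\bigcup_n (if choice.unpickle n is Some j then A j else set0)) = 0%E.
  move=> HA; set B := fun n => _.
  have HB n : measurable (B n) /\ mu (B n) = 0%E.
    by rewrite /B; case: choice.unpickle => //; split => //; exact: measure0.
  have mB : measurable (\bigcup_n B n).
    by apply: bigcup_measurable => n _; case: (HB n).
  split => //; apply/negligibleP => //; apply: negligible_bigcup => n.
  by apply/negligibleP; case: (HB n).
have [mZ2 Z20] : measurable Z2 /\ mu Z2 = 0%E.
  by apply: mU => jk; case: (HN jk).
pose Z3 := Z1 `|` Z2.
have mZ3 : measurable Z3 by exact: measurableU.
have Z30 : mu Z3 = 0%E.
  apply/negligibleP => //; apply: negligibleU; exact/negligibleP.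
pose A l := (fun y => y - - comb l) @^-1` Z3.
have HA l : measurable (A l) /\ mu (A l) = 0%E.
  split; last by rewrite /A lebesgue_rV_shift.
  by rewrite -[X in measurable X]setTI; exact: measurable_translation.
pose Z := \bigcup_n (if choice.unpickle n is Some l then A l else set0).
have [mZ Z0] : measurable Z /\ mu Z = 0%E by exact: (mU _ A HA).
have ZE y : Z y <-> exists l, Z3 (y + comb l).
  split=> [[n _]|[l ly]].
    by case: choice.unpickle => // l; rewrite /A /= opprK => ?; exists l.
  by exists (choice.pickle l) => //; rewrite choice.pickleK /A /= opprK.
have ZZ3 y : ~ Z y -> ~ Z3 y.
  move=> nZ Z3y; apply: nZ; apply/ZE; exists [::].
  by rewrite /comb big_nil addr0.
exists Z; split => //.
- move=> y x [l _ <-] /ZE[l' h]; apply/ZE; exists (l ++ l').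
  by rewrite /comb big_cat addrA.
- move=> y /ZZ3 nZ j x xF.
  have -> : x = gen (j, index x (F j)) by rewrite /gen nth_index.
  case: (HN (j, index x (F j))) => _ _; apply => Ny; apply: nZ; right.
  by exists (choice.pickle (j, index x (F j))) => //; rewrite choice.pickleK.
move=> y nZy j S r e SG r0 e0.
have : forall t, exists l, subgroup_gen t -> comb l = t.
  move=> t; have [[l _ <-]|nt] := pselect (subgroup_gen t); first by exists l.
  by exists [::].
move=> /choice[L HL].
pose s := [seq inl i | i <- enum 'I_d] ++
  [seq inr kt | kt <- [seq (j, kt.1, L kt.2, b) |
    kt <- [seq (k, t) | k <- iota 0 (size (F j)), t <- S], b <- [:: true;
      false]]] :
  seq ('I_d + (nat * nat) * seq (bool * (nat * nat)) * bool).
(* The real and the imaginary part may each contribute e / 2. *)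
pose e1 := Num.min r (e / 2).
have e10 : 0 < e1 by rewrite lt_min r0 divr_gt0.
have nZ1 : ~ Z1 y by move=> Z1y; apply: (ZZ3 _ nZy); left.
have [mc c0] := HZ1 _ nZ1 s _ e10.
have mcZ : measurable (close_set g y s e1 `\` Z) by exact: measurableD.
have cZ0 : (0 < mu (close_set g y s e1 `\` Z))%E.
  rewrite lt0e measure_ge0 andbT; apply/eqP => h.
  suff : mu (close_set g y s e1) = 0%E by move=> h'; move: c0; rewrite h' ltxx.
  apply/negligibleP => //; apply: (@negligibleS _ _ _ _ ((close_set g y s e1
    `\` Z) `|` Z)).
    by move=> z cz; have [Zz|nZz] := pselect (Z z); [right|left].
  by apply: negligibleU; exact/negligibleP.
have [E [mE Ec E0 Efin]] := finite_positive_subset mcZ cZ0.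
exists E; split => // y' /Ec[]// /ForallP cy' _; split.
  move=> i; have := cy' (inl i) _; rewrite mem_cat map_f ?mem_enum// => /(_
    isT)/=.
  by move=> /lt_le_trans; apply; rewrite ge_min lexx.
move=> x t xF tS; have tE := HL _ (SG _ tS).
have h b : `|part b (m x (y' + t)) - part b (m x (y + t))| < e / 2.
  have := cy' (inr (j, index x (F j), L t, b)) _; rewrite mem_cat map_f ?orbT.
    by move=> /(_ isT)/=; rewrite tE /gen nth_index// => /lt_le_trans; apply;
      rewrite ge_min lexx orbT.
  apply/allpairsP; exists ((index x (F j), t), b); split => //=.
    by apply/allpairsP; exists (index x (F j), t); split => //=;
      rewrite mem_iota add0n index_mem.
  by case: b; rewrite !inE.
apply: le_trans (ler_cmod_ReIm _) _; rewrite !raddfB/=.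
by rewrite [leRHS]splitr lerD// ltW//; [exact: (h true)|exact: (h false)].
Qed.

End good_points.

(** * The sum of the series compared with its truncations *)

Section series.
Variables (R : realType) (d : nat) (p : \bar R).
Hypothesis p1 : (1 <= p)%E.
Local Notation Rd := 'rV[R]_d.
Local Notation C := (complex R).
Local Notation mu := (@lebesgue_rV R d).
Variables (m : Rd -> Rd -> C) (u : Rd -> R).
Hypotheses (mm : forall x, cmeasurable (m x)) (u0 : forall x, 0 <= u x)
  (mu_ae : forall x, {ae mu, forall y, cmod (m x y) <= u x}).

Lemma cmeasurable_trunc F f : cmeasurable f -> cmeasurable (trunc m F f).
Proof.
move=> mf; apply: cmeasurable_sum => x; apply: cmeasurableM => //.
exact: cmeasurable_shift.
Qed.

Lemma Lp_norm_trunc F f : cmeasurable f ->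
  (Lp_norm p (trunc m F f) <= (\sum_(x <- F) u x)%:E * Lp_norm p f)%E.
Proof.
move=> mf; elim: F => [|x F IH].
  rewrite big_nil mul0e (_ : trunc m [::] f = fun=> 0) ?Lp_norm0//.
  by apply/funext => y; rewrite /trunc big_nil.
rewrite (_ : trunc m (x :: F) f = fun y => m x y * f (y - x) + trunc m F f y);
  last first.
  by apply/funext => y; rewrite /trunc big_cons.
have mx : cmeasurable (fun y => f (y - x)) by exact: cmeasurable_shift.
have mmx : cmeasurable (fun y => m x y * f (y - x)) by exact: cmeasurableM.
apply: le_trans (Lp_normD p1 mmx (cmeasurable_trunc F mf)) _.
rewrite big_cons EFinD ge0_muleDl ?lee_fin ?sumr_ge0//.
apply: leeD => //; rewrite -(Lp_norm_shift p1 x mf); apply: le_Lp_norm => //.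
by apply: filterS (mu_ae x) => y h; rewrite cmodM ler_wpM2r// cmod_ge0.
Qed.

Variables (M : bounded_op d p).
Hypothesis hM : is_op_series m M.

(** The index set demanded by unconditional convergence is enlarged by F. The partial sum then
    splits into [trunc m F f] and translations outside F, to which the tail bound applies. *)
Lemma series_tail (F : seq Rd) (tau : R) f : uniq F -> 0 <= tau ->
  (forall D, uniq D -> (forall x, x \in D -> x \notin F) ->
    \sum_(x <- D) u x <= tau) ->
  in_Lp p f ->
  (Lp_norm p (fun y => M f y - trunc m F f y)%R <= tau%:E * Lp_norm p f)%E.
Proof.
move=> uF tau0 HD inf; have [mf fy] := inf.
have [mMf _] := op_in_Lp M inf.
apply/lee_addgt0Pr => e e0.
have [F0 HF0] := hM inf e0.
pose F' := (F0 `|` [fset x in F])%fset.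
have := HF0 F' (fsubsetUl _ _); set D := [seq x <- F' | x \notin F].
have pF : perm_eq F' (F ++ D).
  apply: uniq_perm; first exact: fset_uniq.
    rewrite cat_uniq uF filter_uniq ?fset_uniq// andbT/=.
    by apply/hasPn => x; rewrite mem_filter => /andP[].
  move=> x; rewrite mem_cat mem_filter !inE.
  by case: (x \in F); rewrite ?orbT ?orbF.
have PE : partial_op m F' f = fun y => trunc m F f y + trunc m D f y.
  by apply/funext => y; rewrite /partial_op (perm_big _ pF) big_cat.
rewrite PE => h.
rewrite (_ : (fun y => _) = fun y => (M f y - (trunc m F f y + trunc m D f y)) +
    trunc m D f y); last by apply/funext => y; ring.
have mN (g : Rd -> C) : cmeasurable g -> cmeasurable (fun y => - g y).
  move=> mg; rewrite (_ : (fun y => _) = fun y => -1 * g y).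
    by apply: cmeasurableM => //; exact: cmeasurable_cst.
  by apply/funext => y; rewrite mulN1r.
apply: le_trans (Lp_normD p1 _ _) _.
- apply: cmeasurableD => //; apply: mN; apply: cmeasurableD;
  exact: cmeasurable_trunc.
- exact: cmeasurable_trunc.
rewrite addeC; apply: leeD => //.
apply: le_trans (Lp_norm_trunc D mf) _.
apply: lee_wpmul2r; first exact: Lp_norm_ge0.
rewrite lee_fin; apply: HD; first by rewrite filter_uniq// fset_uniq.
by move=> x; rewrite mem_filter => /andP[].
Qed.

(** M differs from its truncation by at most tau on L^p, and K * tau <= 1 / 2 lets this be absorbed.
    The truncations with m and m' agree almost everywhere, so L^p does not see the change. *)
Lemma trunc_lower_bound (F : seq Rd) (tau K : R) (m' : Rd -> Rd -> C) :
  uniq F -> 0 <= tau ->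
  (forall D, uniq D -> (forall x, x \in D -> x \notin F) ->
    \sum_(x <- D) u x <= tau) ->
  0 < K -> K * tau <= 2^-1 ->
  (forall f, in_Lp p f -> (Lp_norm p f <= K%:E * Lp_norm p (M f))%E) ->
  (forall x, cmeasurable (m' x)) ->
  (forall f, trunc m' F f = trunc m F f %[ae mu]) ->
  forall f, in_Lp p f ->
  (Lp_norm p f <= (2 * K)%:E * Lp_norm p (trunc m' F f))%E.
Proof.
move=> uF tau0 HD K0 Ktau low mm' mm'E f inf; have [mf fy] := inf.
have [mMf _] := op_in_Lp M inf.
have mt := cmeasurable_trunc F mf.
have -> : Lp_norm p (trunc m' F f) = Lp_norm p (trunc m F f).
  apply: eq_Lp_norm => //; apply: cmeasurable_sum => x.
  by apply: cmeasurableM => //; exact: cmeasurable_shift.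
have md : cmeasurable (fun y => M f y - trunc m F f y).
  rewrite (_ : (fun y => _) = fun y => M f y + -1 * trunc m F f y).
    by apply: cmeasurableD => //; apply: cmeasurableM => //;
      exact: cmeasurable_cst.
  by apply/funext => y; rewrite mulN1r.
have : (Lp_norm p (M f) <= tau%:E * Lp_norm p f + Lp_norm p (trunc m F f))%E.
  rewrite [X in Lp_norm p X](_ : _ =
      fun y => (M f y - trunc m F f y) + trunc m F f y); last first.
    by apply/funext => y; rewrite subrK.
  apply: le_trans (Lp_normD p1 md mt) _; apply: leeD => //.
  exact: series_tail.
have := low _ inf.
have ty : (Lp_norm p (trunc m F f) < +oo)%E.
  apply: le_lt_trans (Lp_norm_trunc F mf) _.
  by rewrite lte_mul_pinfty ?lee_fin ?sumr_ge0.
have [_ My] := op_in_Lp M inf.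
move: fy ty My (Lp_norm_ge0 p f) (Lp_norm_ge0 p (trunc m F f)) (Lp_norm_ge0 p
  (M f)).
case: (Lp_norm p f) => [a| |]//; case: (Lp_norm p (trunc m F f)) => [b| |]//.
case: (Lp_norm p (M f)) => [c| |]// _ _ _; rewrite -!EFinM -EFinD !lee_fin.
move=> a0 b0 c0 h1 h2.
have h3 := ler_wpM2l (ltW K0) h2; have h4 := ler_wpM2r a0 Ktau.
by move: h1 h3 h4; rewrite mulrDr [K * (tau * a)]mulrA -[2 * K * b]mulrA; lra.
Qed.

End series.

(** * Gluing the orbits together *)

Section cosets.
Variables (R : realType) (G : zmodType).
Local Notation C := (complex R).

Lemma sqnorm_split (f g : G -> C) : finsupp f -> finsupp g ->
  (forall y, f y = 0 \/ g y = 0) -> sqnorm (fun y => f y + g y) = sqnorm f +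
    sqnorm g.
Proof.
move=> ff fg fg0; rewrite /sqnorm -gsumD; try exact: finsupp_cmod2.
congr gsum; apply/funext => y.
by case: (fg0 y) => ->; rewrite ?add0r ?addr0 cmod0 expr0n ?add0r ?addr0.
Qed.

Variables (Gam Om : set G) (m : G -> G -> C) (F : seq G) (c : R).
Hypotheses (Gam0 : Gam 0) (GamB : forall x y, Gam x -> Gam y -> Gam (x - y))
  (OmGam : forall y x, Gam x -> Om (y + x) -> Om y)
  (FGam : forall x, x \in F -> Gam x) (c0 : 0 <= c)
  (low : forall y, Om y -> forall v : G -> C, finsupp v ->
    (forall t, ~ Gam t -> v t = 0) ->
    c * sqnorm v <= sqnorm (trunc (fun x t => m x (y + t)) F v)).

Definition restrict (f : G -> C) : G -> C := fun y => (`[< Om y >])%:R * f y.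

Lemma finsupp_restrict f : finsupp f -> finsupp (restrict f).
Proof. by move=> ff; apply: finsupp_dom ff _ => y; rewrite /restrict => ->;
  rewrite mulr0. Qed.

(** The truncation moves points only within cosets of Gam, so the squared norms on both sides add up
    over cosets. Om is a union of cosets: outside it the restriction of f is 0, inside it [low]
    applies after recentring at y0. *)
Lemma coset_extension f : finsupp f -> c * sqnorm (restrict f) <=
  sqnorm (trunc m F f).
Proof.
move=> [s]; elim: s f => [|y0 s IH] f fs.
  have -> : f = fun=> 0 by apply/funext => y; exact: fs.
  rewrite (_ : restrict _ = fun=> 0).
    rewrite [sqnorm _]/sqnorm (@gsumE _ _ [::])// => [|y _];
      last by rewrite cmod0 expr0n.
    by rewrite big_nil mulr0; apply: sqnorm_ge0; apply: finsupp_trunc;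
      exact: finsupp0.
  by apply/funext => y; rewrite /restrict mulr0.
pose f1 y := if `[< Gam (y - y0) >] then f y else 0.
pose f2 y := if `[< Gam (y - y0) >] then 0 else f y.
have ff : finsupp f by exists (y0 :: s).
have ff1 : finsupp f1.
  by apply: finsupp_dom ff _ => y; rewrite /f1 => ->; rewrite if_same.
have f2s y : y \notin s -> f2 y = 0.
  rewrite /f2 => ys; have [->|yy0] := eqVneq y y0;
    first by rewrite subrr asboolT.
  by case: ifP => // _; apply: fs; rewrite inE negb_or yy0.
have ff2 : finsupp f2 by exists s.
have fE : f = fun y => f1 y + f2 y.
  by apply/funext => y; rewrite /f1 /f2; case: ifP; rewrite ?addr0 ?add0r.
have eE : restrict f = fun y => restrict f1 y + restrict f2 y.
  by apply/funext => y; rewrite /restrict {1}fE mulrDr.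
have aE : trunc m F f = fun y => trunc m F f1 y + trunc m F f2 y.
  apply/funext => y; rewrite /trunc -big_split; apply: eq_bigr => x _ /=.
  by rewrite {1}fE mulrDr.
have e12 y : restrict f1 y = 0 \/ restrict f2 y = 0.
  by rewrite /restrict /f1 /f2; case: ifP => _; [right|left]; rewrite mulr0.
have a12 y : trunc m F f1 y = 0 \/ trunc m F f2 y = 0.
  rewrite /trunc; have [Gy|Gy] := pselect (Gam (y - y0)); [right|left];
    rewrite big_seq big1// => x xF; rewrite /f1 /f2.
    by rewrite asboolT ?mulr0// addrAC; apply: GamB => //; exact: FGam.
  rewrite asboolF ?mulr0// => Gyx; apply: Gy.
  have := GamB Gyx (GamB Gam0 (FGam xF)).
  by rewrite sub0r opprK addrAC subrK.
rewrite eE aE (sqnorm_split (finsupp_restrict ff1) (finsupp_restrict ff2) e12).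
rewrite (sqnorm_split (finsupp_trunc m F ff1) (finsupp_trunc m F ff2) a12).
rewrite mulrDr; apply: lerD; last exact: IH.
have [Oy0|nOy0] := pselect (Om y0); last first.
  rewrite (_ : restrict f1 = fun=> 0).
    rewrite [sqnorm _]/sqnorm (@gsumE _ _ [::])// => [|y _];
      last by rewrite cmod0 expr0n.
    by rewrite big_nil mulr0; apply: sqnorm_ge0; exact: finsupp_trunc.
  apply/funext => y; rewrite /restrict; case: asboolP => [Oy|_];
    last by rewrite mul0r.
  rewrite /f1; case: asboolP => [Gy|_]; last by rewrite mulr0.
  by exfalso; apply: nOy0; apply: (OmGam Gy); rewrite addrC subrK.
pose v t := f1 (t - - y0).
have fv : finsupp v by exact: finsupp_shift.
have v0 t : ~ Gam t -> v t = 0.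
  by rewrite /v /f1 opprK addrK => nGt; rewrite asboolF.
have := low Oy0 fv v0; rewrite [sqnorm v](sqnorm_shift f1 (- y0)) => h.
rewrite -(sqnorm_shift (trunc m F f1) (- y0)).
rewrite (_ : (fun y => _) = trunc (fun x t => m x (y0 + t)) F v); last first.
  apply/funext => t; rewrite /trunc; apply: eq_bigr => x _.
  by rewrite /v opprK [t + y0]addrC [t - x + y0]addrC addrA.
apply: le_trans h; apply: ler_wpM2l => //.
rewrite -[leRHS]mul1r -(expr1n R 2); apply: sqnorm_le => //.
  exact: finsupp_restrict.
move=> y; rewrite /restrict cmodM mul1r; case: asboolP => _.
  by rewrite cmod1 mul1r.
by rewrite cmod0 mul0r cmod_ge0.
Qed.

End cosets.

(** * Lower bounds uniform in the truncation *)

Section bounded_below.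
Variables (R : realType) (d : nat) (p : \bar R).
Hypothesis p1 : (1 <= p)%E.
Local Notation Rd := 'rV[R]_d.
Local Notation C := (complex R).
Local Notation mu := (@lebesgue_rV R d).
Variables (m : Rd -> Rd -> C) (u : Rd -> R) (F : nat -> seq Rd).
Hypotheses (mm : forall x, cmeasurable (m x)) (u0 : forall x, 0 <= u x)
  (mu_ae : forall x, {ae mu, forall y, cmod (m x y) <= u x})
  (uF : forall j, uniq (F j))
  (Fcat : forall i j, (j <= i)%N -> exists D, F i = F j ++ D)
  (Ftail : forall e, 0 < e -> exists J, forall j, (J <= j)%N -> forall D,
    uniq D ->
    (forall x, x \in D -> x \notin F j) -> \sum_(x <- D) u x <= e).
Variables (M : bounded_op d p) (K : R).
Hypotheses (hM : is_op_series m M) (K0 : 0 < K)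
  (low : forall f, in_Lp p f -> (Lp_norm p f <= K%:E * Lp_norm p (M f))%E).
Variables (Z : set Rd) (m' : Rd -> Rd -> C).
Hypotheses (mZ : measurable Z) (Z0 : mu Z = 0%E)
  (ZGam : forall y x, subgroup_gen F x -> Z (y + x) -> Z y)
  (Zclose : forall y, ~ Z y -> forall j (S : seq Rd) (r e : R),
      (forall x, x \in S -> subgroup_gen F x) -> 0 < r -> 0 < e ->
      exists E : set Rd, [/\ measurable E, (0 < mu E)%E, (mu E < +oo)%E,
        forall y', E y' -> ~ Z y' &
        forall y', E y' -> (forall i, `|y' ord0 i - y ord0 i| < r) /\
          forall x t, x \in F j -> t \in S ->
            cmod (m x (y' + t) - m x (y + t)) <= e])
  (mm' : forall x, cmeasurable (m' x)) (m'u : forall x y, cmod (m' x y) <= u x)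
  (m'E : forall j x y, x \in F j -> ~ Z y -> m' x y = m x y).

(** Uniformity comes from the order of the choices: J, then eta and phi for [F J] alone, and only
    then j. The translations of [F j] beyond [F J] form the set D of small coefficients, so [ka]
    depends neither on j nor on the orbit. *)
Lemma truncations_bounded_below : exists2 ka, 0 < ka & exists J, forall j,
  (J <= j)%N -> forall f, finsupp f ->
  ka * sqnorm (restrict (~` Z) f) <= sqnorm (trunc m' (F j) f).
Proof.
have pos1 : 0 < (2 * K)^-1 by rewrite invr_gt0 mulr_gt0.
have [J1 HJ1] := Ftail pos1.
(* One factor 2 is lost in [trunc_lower_bound], the other in [transfer_lower_bound]. *)
pose K2 := 2 * (2 * K).
have K20 : 0 < K2 by rewrite !mulr_gt0.
have pos2 : 0 < (4 * K2)^-1 by rewrite invr_gt0 mulr_gt0.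
have [J2 HJ2] := Ftail pos2.
pose J := maxn J1 J2.
pose U := \sum_(x <- F J) u x.
have U0 : 0 <= U by exact: sumr_ge0.
pose eta := (4 * K2 * (U + 1))^-1.
have eta0 : 0 < eta by rewrite invr_gt0 !mulr_gt0// ltr_wpDl.
(* For this th, the two ratio bounds between phi y and phi (y - x) yield the additive bound
   [Fphi']. *)
pose th := (1 + eta)^-1.
have th0 : 0 < th by rewrite invr_gt0 addr_gt0.
have th1 : th < 1 by rewrite invf_lt1 ?addr_gt0// ltrDl.
have [phi [Phi [phi0 phi1 sphi Fphi]]] := slowly_varying_weight (F J) th0 th1.
have thK : (1 + eta) * th = 1 by rewrite mulfV// gt_eqF// addr_gt0.
have Fphi' x : x \in F J -> forall y, `|phi (y - x) - phi y| <=
  eta * phi (y - x).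
  move=> xF y; have [h1 h2] := Fphi x xF y.
  have e1 : 0 <= 1 + eta by rewrite addr_ge0// ltW.
  have h3 := ler_wpM2l e1 h1; rewrite mulrA thK mul1r mulrDl mul1r in h3.
  have h4 := ler_wpM2l e1 h2; rewrite mulrA thK mul1r mulrDl mul1r in h4.
  have pe : 0 <= eta * phi (y - x) by rewrite mulr_ge0// ltW.
  rewrite ler_norml; apply/andP; split; first by lra.
  have [h|/ltW h] := leP (phi (y - x)) (phi y); first by lra.
  by have := ler_wpM2l (ltW eta0) h; lra.
pose Ck := 24 * K2 ^+ 2 * Phi ^+ 2.
have Ck0 : 0 < Ck + 1.
  by rewrite ltr_wpDl//; apply: mulr_ge0 (mulr_ge0 _ (sqr_ge0 _)) (sqr_ge0 _).
exists (Ck + 1)^-1; first by rewrite invr_gt0.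
exists J => j Jj f ff.
have [J1j J2J] : (J1 <= j)%N /\ (J2 <= J)%N.
  by split; [apply: leq_trans Jj; exact: leq_maxl|exact: leq_maxr].
have FGam x : x \in F j -> subgroup_gen F x by exact: mem_subgroup_gen.
apply: (coset_extension (Gam := subgroup_gen F)) => //.
- exact: subgroup_gen0.
- exact: subgroup_genB.
- by move=> y x Gx nZ Zy; apply: nZ; apply: (ZGam (x := - x));
    [exact: subgroup_genN|rewrite addrK].
- by rewrite invr_ge0 ltW.
move=> y nZy v fv vGam.
have [s us sv] := finsupp_uniq fv.
pose S := [seq x <- s | v x != 0].
have SGam x : x \in S -> subgroup_gen F x.
  rewrite mem_filter => /andP[vx _]; apply: contrapT => /vGam vx0.
  by move: vx; rewrite vx0 eqxx.
have Sv x : x \notin S -> v x = 0.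
  rewrite mem_filter negb_and negbK => /orP[/eqP//|]; exact: sv.
have lowj : forall f, in_Lp p f ->
    (Lp_norm p f <= (2 * K)%:E * Lp_norm p (trunc m' (F j) f))%E.
  have tau0 : 0 <= (2 * K)^-1 by rewrite invr_ge0 mulr_ge0// ltW.
  apply: (trunc_lower_bound p1 mm u0 mu_ae hM (uF j) tau0 (HJ1 j J1j) K0) => //.
    by rewrite invfM mulrCA mulfV ?gt_eqF// mulr1.
  move=> g; exists Z; split => // z /= h; apply: contrapT => nZz; apply: h => _.
  rewrite /trunc !big_seq; apply: eq_bigr => x xF; by rewrite (m'E xF nZz).
have close' (S' : seq Rd) (r e : R) : (forall x, x \in S' ->
  subgroup_gen F x) ->
    0 < r -> 0 < e -> exists E : set Rd, [/\ measurable E, (0 < mu E)%E,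
      (mu E < +oo)%E & forall y', E y' -> (forall i,
        `|y' ord0 i - y ord0 i| < r) /\
        forall x t, x \in F j -> t \in S' ->
          cmod (m' x (y' + t) - m' x (y + t)) <= e].
  move=> S'Gam r0 e0; have [E [mE E0 Efin EZ HE]] := Zclose nZy j S'Gam r0 e0.
  exists E; split => // y' Ey'; have [h1 h2] := HE _ Ey';
    split => // x t xF tS'.
  have nZ z : ~ Z z -> ~ Z (z + t).
    by move=> nZz Zzt; apply: nZz; apply: ZGam Zzt; exact: S'Gam.
  by rewrite !(m'E xF)//; [exact: h2|exact: nZ|apply: nZ; exact: EZ].
have K'0 : 0 < 2 * K by rewrite mulr_gt0.
have [nu hnu nulow] := transfer_lower_bound p1 mm' K'0 lowj FGam SGam
  (@subgroup_genD _ _ F) close'.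
have [D FD] := Fcat Jj.
have DK : K2 * \sum_(x <- D) u x <= 4^-1.
  have uFD : uniq (F J ++ D) by rewrite -FD.
  move: uFD; rewrite cat_uniq => /and3P[_ /hasPn DF uD].
  apply: le_trans (ler_wpM2l (ltW K20) (HJ2 _ J2J _ uD DF)) _.
  by rewrite invfM mulrCA mulfV ?gt_eqF// mulr1.
have FK : K2 * (eta * U) <= 4^-1.
  rewrite /eta (_ : K2 * _ = 4^-1 * (U / (U + 1))); last first.
    by field; rewrite !gt_eqF// ltr_wpDl.
  by rewrite ler_piMr// ler_pdivrMr ?ltr_wpDl// mul1r lerDl.
have := sqnorm_lower_bound u0 K20 (ltW eta0) phi0 phi1 sphi Fphi' FK DK
  (m := fun x t => m' x (y + t)) (nu := nu) (v := v) _ hnu fv _.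
rewrite -FD => /(_ _ _) h.
rewrite mulrC ler_pdivrMr//.
apply: le_trans (h _ _) _ => //.
  move=> v' v'0; apply: nulow => z /Sv; exact: v'0.
rewrite -/Ck mulrC ler_wpM2l//; last by rewrite lerDl.
by apply: sqnorm_ge0; exact: finsupp_trunc.
Qed.

End bounded_below.

(** * The inverse *)

Section limit.
Variables (R : realType) (d : nat).
Local Notation Rd := 'rV[R]_d.
Local Notation C := (complex R).
Local Notation op := ((Rd -> C) -> (Rd -> C)).
Variable w : Rd -> R.
Hypothesis w_ge1 : forall x, 1 <= w x.

Lemma real_cauchy_limit (r : nat -> R) :
  (forall e, 0 < e -> exists J, forall i j, (J <= j <= i)%N -> `|r i - r j| <=
    e) ->
  cvgn r.
Proof.
move=> h; apply: R_complete; apply: cauchy_exP => e e0.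
have [J HJ] := h _ (divr_gt0 e0 (ltr0n R 2)).
exists (r J); exists J => // i /= Ji; rewrite /ball /= distrC.
apply: le_lt_trans (HJ i J _) _; first by rewrite leqnn.
by rewrite ltr_pdivrMr// ltr_pMr// ltr1n.
Qed.

Lemma limit_dist (r : nat -> R) (a e : R) J : cvgn r ->
  (forall i, (J <= i)%N -> `|r i - a| <= e) -> `|limn r - a| <= e.
Proof.
move=> cr h; apply/ler_addgt0Pr => eta eta0.
have /cvgrPdist_le/(_ _ eta0)[J' _ HJ'] := cr.
have h1 := HJ' (maxn J J') (leq_maxr _ _); have h2 :=
  h (maxn J J') (leq_maxl _ _).
rewrite (_ : limn r - a = (r (maxn J J') - a) + (limn r - r (maxn J J')));
  last by ring.
by rewrite (le_trans (ler_normD _ _))// lerD.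
Qed.

Variables (b : nat -> op) (J0 : nat) (B : R).
Hypotheses (Ab : forall j, (J0 <= j)%N -> Aw w setT (b j) B)
  (b_cauchy : forall e, 0 < e -> exists2 J, (J0 <= J)%N &
    forall j, (J <= j)%N -> forall i, (j <= i)%N ->
      Aw w setT (fun f y => b i f y - b j f y) e).

Lemma Aw_limit : exists n : Rd -> Rd -> C, (forall x, cmeasurable (n x)) /\
  forall e, 0 < e -> exists2 J, (J0 <= J)%N & forall j, (J <= j)%N ->
  forall X, uniq X -> exists g : Rd -> R, [/\ forall x, 0 <= g x,
    forall x y, cmod (n x y - opcoef (b j) x y) <=
      g x & \sum_(x <- X) g x * w x <= e].
Proof.
have unif e : 0 < e -> exists2 J, (J0 <= J)%N & forall i j, (J <= j <= i)%N ->
    forall x y, cmod (opcoef (b i) x y - opcoef (b j) x y) <= e.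
  move=> /b_cauchy[J J0J HJ]; exists J => // i j /andP[Jj ji] x y.
  have [g [g0 gb gX]] := Aw_opcoef_bound w_ge1 (HJ j Jj i ji).
  apply: le_trans (gb x y) _; have := gX [:: x] isT; rewrite big_seq1.
  by apply: le_trans; rewrite ler_peMr.
have cRe x y : cvgn (fun j => complex.Re (opcoef (b j) x y)).
  apply: real_cauchy_limit => e /unif[J _ HJ]; exists J => i j ij.
  rewrite -raddfB; apply: le_trans (ler_cmod_Re _) _; exact: HJ.
have cIm x y : cvgn (fun j => complex.Im (opcoef (b j) x y)).
  apply: real_cauchy_limit => e /unif[J _ HJ]; exists J => i j ij.
  rewrite -raddfB; apply: le_trans (ler_cmod_Im _) _; exact: HJ.
pose n x y : C := Complex (limn (fun j => complex.Re (opcoef (b j) x y)))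
  (limn (fun j => complex.Im (opcoef (b j) x y))).
(* Coefficients are known to be measurable from J0 on, hence the shifted sequence. *)
have mcf j x : cmeasurable (opcoef (b (J0 + j)%N) x).
  by apply: Aw_opcoef_measurable (Ab _); exact: leq_addr.
have shift_cvg (r : nat -> R) : cvgn r -> r (J0 + j)%N @[j --> \oo] --> limn r.
  move=> cr; have := cr; rewrite -(cvg_shiftn J0).
  by under eq_fun do rewrite addnC.
exists n; split.
  move=> x; split => /=.
    apply: (@measurable_fun_cvg _ _ _ _ (fun j y => complex.Re (opcoef (b (J0 +
      j)%N) x y))).
      by move=> j; case: (mcf j x).
    by move=> y _; exact: shift_cvg (cRe x y).
  apply: (@measurable_fun_cvg _ _ _ _ (fun j y => complex.Im (opcoef (b (J0 +
    j)%N) x y))).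
    by move=> j; case: (mcf j x).
  by move=> y _; exact: shift_cvg (cIm x y).
have nb e : 0 < e -> exists J, forall i, (J <= i)%N ->
    forall x y, cmod (n x y - opcoef (b i) x y) <= e + e.
  move=> /unif[J _ HJ]; exists J => i Ji x y.
  apply: le_trans (ler_cmod_ReIm _) _; rewrite !raddfB /=; apply: lerD.
    apply: (limit_dist (cRe x y) (J := i)) => k ik.
    by rewrite -raddfB; apply: le_trans (ler_cmod_Re _) _; apply: HJ;
      rewrite Ji.
  apply: (limit_dist (cIm x y) (J := i)) => k ik.
  by rewrite -raddfB; apply: le_trans (ler_cmod_Im _) _; apply: HJ; rewrite Ji.
move=> e e0; have e20 : 0 < e / 2 by rewrite divr_gt0.
have [J J0J HJ] := b_cauchy e20; exists J => // j Jj X uX.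
pose W := \sum_(x <- X) w x.
have W0 : 0 <= W by apply: sumr_ge0 => x _; apply: le_trans (w_ge1 x).
(* The limit is within 2 eta of b i, one eta for each of the real and imaginary parts, and 2 eta W
   <= e / 2. *)
pose eta := e / (4 * (W + 1)).
have W1 : 0 < W + 1 by rewrite ltr_wpDl.
have eta0 : 0 < eta by rewrite divr_gt0// mulr_gt0.
have [J' HJ'] := nb _ eta0.
pose i := maxn j J'.
have [g [g0 gb gX]] := Aw_opcoef_bound w_ge1 (HJ j Jj i (leq_maxl _ _)).
exists (fun x => g x + (eta + eta)); split.
- by move=> x; rewrite !addr_ge0// ltW.
- move=> x y; rewrite (_ : n x y - _ = (opcoef (b i) x y - opcoef (b j) x y) +
    (n x y - opcoef (b i) x y)); last by ring.
  apply: le_trans (ler_cmodD _ _) _; apply: lerD; first exact: gb.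
  by apply: HJ'; exact: leq_maxr.
under eq_bigr do rewrite mulrDl.
rewrite big_split /= -mulr_sumr -/W [leRHS]splitr; apply: lerD; first exact: gX.
rewrite /eta (_ : _ * W = e / 2 * (W / (W + 1))); last by field; rewrite gt_eqF.
by rewrite ler_piMr ?(ltW e20)// ler_pdivrMr// mul1r lerDl.
Qed.

End limit.

Lemma Aw_partial_op (R : realType) (d : nat) (w : 'rV[R]_d -> R) P L l
    (F : {fset 'rV[R]_d}) f : Aw w P L l -> (forall x, P x -> x \in F) ->
  L f = partial_op (opcoef L) F f.
Proof.
by move=> AL PF; apply/funext => y; rewrite (Aw_opcoef_expand _ _ AL (fset_uniq
  F)).
Qed.

Theorem theorem4 (R : realType) (d : nat) (w : 'rV[R]_d -> R)
    (hw : weight w) (hadm : admissible w)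
    (p : \bar R) (hp : (1 <= p)%E)
    (m : 'rV[R]_d -> 'rV[R]_d -> complex R) (hm : in_Aw w m)
    (M : bounded_op d p) (hM : is_op_series m M)
    (N : bounded_op d p) (hN : is_inverse M N) :
  exists n : 'rV[R]_d -> 'rV[R]_d -> complex R,
    in_Aw w n /\ is_op_series n N.
Proof.
have w_ge1 := admissible_ge1 hw hadm; have w_growth :=
  admissible_growth hw hadm.
have [_ _ wN] := hw; have [w0 wD _] := hadm; have [hm1 hm2] := hm.
have w_ge0 x : 0 <= w x by apply: le_trans (w_ge1 x).
pose u x := fine (Lp_norm +oo (m x)).
have u0 x : 0 <= u x by apply: fine_ge0; exact: Lnorm_ge0.
have mm x : cmeasurable (m x) by case: (hm1 x).
have mu_ae x := Linfty_ae (hm1 x).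
have uw0 x : 0 <= u x * w x by exact: mulr_ge0.
have hsum : (\esum_(x in [set: 'rV[R]_d]) (u x * w x)%:E < +oo)%E.
  rewrite (eq_esum (b := fun x => (Lp_norm +oo (m x) * (w x)%:E)%E))// => x _.
  rewrite EFinM fineK// ge0_fin_numE ?Lnorm_ge0//; by case: (hm1 x).
have [F [uF Fcat Ftailw]] := exhaustion uw0 hsum.
have Ftail e : 0 < e -> exists J, forall j, (J <= j)%N -> forall D, uniq D ->
    (forall x, x \in D -> x \notin F j) -> \sum_(x <- D) u x <= e.
  move=> /Ftailw[J HJ]; exists J => j Jj D uD DF.
  apply: le_trans (HJ j Jj D uD DF); apply: ler_sum => x _.
  by rewrite ler_peMr.
have [Z [mZ Z0 ZGam Zu Zclose]] := good_points F mm mu_ae.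
(* With the coefficients set to 0 on Z, the bound by [u x] holds at every point, as the discrete
   group requires. *)
pose m' x y : complex R := if `[< ~ Z y /\ exists j,
  x \in F j >] then m x y else 0.
have mchi : cmeasurable (fun y : 'rV[R]_d => (`[< (~` Z) y >])%:R : complex R).
  rewrite (_ : (fun y => _) = fun y => real_complex R (\1_(~` Z) y)).
    split => /=; last exact: measurable_cst.
    by apply: measurable_indic; exact: measurableC.
  apply/funext => y; rewrite indicE; case: asboolP => h.
    by rewrite mem_set// rmorph1.
  by rewrite memNset// rmorph0.
have mm' x : cmeasurable (m' x).
  have [xF|xF] := pselect (exists j, x \in F j).
    rewrite (_ : m' x = fun y => (`[< (~` Z) y >])%:R * m x y).
      exact: cmeasurableM.
    apply/funext => y; rewrite /m'; case: asboolP => [[nZ _]|h].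
      by rewrite asboolT// mul1r.
    by rewrite asboolF ?mul0r// => nZ; apply: h.
  rewrite (_ : m' x = fun=> 0); first exact: cmeasurable_cst.
  by apply/funext => y; rewrite /m' asboolF// => -[].
have m'u x y : cmod (m' x y) <= u x.
  rewrite /m'; case: asboolP => [[nZ [j xF]]|_]; first exact: (Zu _ nZ j).
  by rewrite cmod0.
have m'E j x y : x \in F j -> ~ Z y -> m' x y = m x y.
  by move=> xF nZ; rewrite /m' asboolT//; split => //; exists j.
have m'0 x y : Z y -> m' x y = 0.
  by move=> Zy; rewrite /m' asboolF// => -[].
have [K0 HK0] := op_bounded N; pose K := Num.max K0 1.
have K_gt0 : 0 < K by rewrite lt_max ltr01 orbT.
have Nle f : in_Lp p f -> (Lp_norm p (N f) <= K%:E * Lp_norm p f)%E.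
  move=> inf; apply: le_trans (HK0 f inf) _.
  apply: lee_wpmul2r; first exact: Lp_norm_ge0.
  by rewrite lee_fin le_max lexx.
(* This half uses that N is a left inverse: f = N (M f) almost everywhere, and N is bounded. *)
have low f : in_Lp p f -> (Lp_norm p f <= K%:E * Lp_norm p (M f))%E.
  move=> inf; have inM := op_in_Lp M inf; have inN := op_in_Lp N inM.
  have [_ NM] := hN f inf.
  by rewrite -(eq_Lp_norm hp inN.1 inf.1 NM); exact: Nle.
have [ka ka0 [J HJ]] := truncations_bounded_below hp mm u0 mu_ae uF Fcat Ftail
  hM K_gt0 low mZ Z0 ZGam Zclose mm' m'u m'E.
pose al := fine (\esum_(x in [set: 'rV[R]_d]) (u x * w x)%:E)%E + 1.
have al0 : 0 < al.
  rewrite ltr_wpDl//; apply: fine_ge0; apply: esum_ge0 => x _.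
  by rewrite lee_fin.
have sumF j : \sum_(x <- F j) u x * w x <= al.
  by apply: le_trans (sum_le_esum uw0 hsum (uF j)) _; rewrite lerDl.
pose e := restrict (~` Z) (R := R).
have Ae : Aw w setT e 1.
  have h y : cmod ((`[< (~` Z) y >])%:R : complex R) <= 1.
    by case: asboolP => _; rewrite ?cmod1 ?cmod0.
  have := Aw_atom w (P := setT) (x := 0) I mchi h; rewrite w0 mulr1.
  by apply: Aw_ext => f y; rewrite /e /restrict subr0.
have ee f : e (e f) = e f.
  by apply/funext => y; rewrite /e /restrict; case: asboolP;
    rewrite ?mul1r ?mul0r.
(* The indices start at J, from where the lower bound holds. *)
pose a j := trunc m' (F (J + j)%N); pose a' j := trunc_adj m' (F (J + j)%N).
have ae j f : a j (e f) = a j f.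
  apply/funext => y; rewrite /a /trunc !big_seq; apply: eq_bigr => x xF.
  (* On Z the coefficients vanish; off Z the point y - x is off Z as well, by invariance. *)
  have [Zy|nZy] := pselect (Z y); first by rewrite m'0 ?mul0r.
  rewrite /e /restrict asboolT ?mul1r// => Zyx; apply: nZy.
  by apply: ZGam Zyx; apply: subgroup_genN; exact: mem_subgroup_gen xF.
have Aa j : Aw w setT (a j) al by exact: Aw_le (sumF _) (Aw_trunc w mm' m'u _).
have Aa' j : Aw w setT (a' j) al.
  exact: Aw_le (sumF _) (Aw_trunc_adj wN mm' m'u _).
have adj j f g : finsupp f -> finsupp g -> re_ip f (a' j g) = re_ip (a j f) g.
  exact: trunc_adjP.
have a_low j f : finsupp f -> ka * sqnorm (e f) <= sqnorm (a j f).
  by apply: HJ; exact: leq_addr.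
have a_cauchy eps : 0 < eps -> exists J, forall i j, (J <= j <= i)%N ->
    Aw w setT (fun f y => a i f y - a j f y) eps /\
    Aw w setT (fun f y => a' i f y - a' j f y) eps.
  move=> /Ftailw[J1 HJ1]; exists J1 => i j /andP[J1j ji].
  have JJ : (J1 <= J + j)%N by apply: leq_trans J1j (leq_addl _ _).
  have [D FD] : exists D, F (J + i)%N = F (J + j)%N ++ D by apply: Fcat;
    rewrite leq_add2l.
  have := uF (J + i)%N; rewrite FD cat_uniq => /and3P[_ /hasPn DF uD].
  have sD := HJ1 _ JJ D uD DF.
  split.
    apply: Aw_ext (Aw_le sD (Aw_trunc w mm' m'u D)) => f y.
    by rewrite /a FD trunc_cat addrC addKr.
  apply: Aw_ext (Aw_le sD (Aw_trunc_adj wN mm' m'u D)) => f y.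
  by rewrite /a' FD trunc_adj_cat addrC addKr.
have [b [B [B0 [J0 [Ab b_lim]]]]] := approximate_left_inverse w0 w_ge1 wD
  w_growth
  al0 ka0 Ae Aa Aa' adj ee ae a_low a_cauchy.
have b_cauchy eps : 0 < eps -> exists2 J, (J0 <= J)%N &
    forall j, (J <= j)%N -> forall i, (j <= i)%N ->
      Aw w setT (fun f y => b i f y - b j f y) eps.
  by move=> /b_lim[J1 J01 HJ1]; exists J1 => // j /HJ1[].
have [n [mn n_lim]] := Aw_limit w_ge1 Ab b_cauchy.
exists n; split.
  have [J1 J01 HJ1] := n_lim _ ltr01.
  have [g' [g'0 g'b g'X]] := Aw_opcoef_bound w_ge1 (Ab _ J01).
  (* The A_w-norm is a supremum over finite sets X. Each is compared with [b J1] through its own g,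
     with the common bound 1 + B. *)
  have nX X : uniq X -> exists g, [/\ forall x, 0 <= g x,
      forall x, (Lp_norm +oo (n x) <= (g x)%:E)%E & \sum_(x <- X) g x * w x <=
        1 + B].
    move=> uX; have [g [g0 gb gX]] := HJ1 J1 (leqnn _) X uX.
    exists (fun x => g x + g' x); split.
    - by move=> x; rewrite addr_ge0.
    - move=> x; apply: Linfty_le => [|y]; first by rewrite addr_ge0.
      rewrite -[n x y](subrK (opcoef (b J1) x y)).
      by apply: le_trans (ler_cmodD _ _) _; exact: lerD.
    - under eq_bigr do rewrite mulrDl.
      by rewrite big_split/= lerD// g'X.
  split.
    move=> x; split => //; have [g [_ gn _]] := nX [::] isT.
    by apply: le_lt_trans (gn x) _; exact: ltry.
  apply: (@le_lt_trans _ _ (1 + B)%:E); last exact: ltry.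
  apply: ge_ereal_sup => _ [A [finA _] <-].
  rewrite fsbig_finite//=; have [g [g0 gn gX]] := nX _ (fset_uniq (fset_set A)).
  apply: (@le_trans _ _ (\sum_(x <- fset_set A) (g x * w x)%:E)%E).
    apply: lee_sum => x _; rewrite EFinM; apply: lee_wpmul2r => //.
    by rewrite lee_fin.
  by rewrite sumEFin lee_fin.
move=> f inf eps eps0; pose h := N f.
have inh : in_Lp p h := op_in_Lp N inf.
have [Mh _] := hN f inf.
have normE (g : 'rV[R]_d -> complex R) : in_Lp p g ->
  Lp_norm p g = (fine (Lp_norm p g))%:E.
  by move=> [_ gy]; rewrite fineK// ge0_fin_numE ?Lp_norm_ge0.
set nf := fine (Lp_norm p f); set nh := fine (Lp_norm p h).
have nf0 : 0 <= nf by apply: fine_ge0; exact: Lp_norm_ge0.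
have nh0 : 0 <= nh by apply: fine_ge0; exact: Lp_norm_ge0.
pose S := nh + B * nh + nf.
have S0 : 0 <= S by rewrite !addr_ge0// mulr_ge0.
pose de := eps / (S + 1).
have de0 : 0 < de by rewrite divr_gt0// ltr_wpDl.
have [J1 J01 HJ1] := b_lim _ de0; have [J2 J02 HJ2] := n_lim _ de0.
have [J3 HJ3] := Ftail _ de0.
pose j := maxn J1 (maxn J2 J3).
have J1j : (J1 <= j)%N by exact: leq_maxl.
have J2j : (J2 <= j)%N by rewrite /j leq_max leq_maxl orbT.
have J3j : (J3 <= J + j)%N.
  by apply: leq_trans (leq_addl _ _); rewrite /j !leq_max leqnn !orbT.
have Abj := Ab j (leq_trans J01 J1j).
have [X AX] := Aw_finite_support Abj.
(* Since F' contains the support of [b j], the partial sum with the coefficients of [b j] is exactly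
   [b j f]. *)
exists [fset x in X]%fset => F' XF'.
have [g [g0 gb gX]] := HJ2 j J2j F' (fset_uniq F').
have bE : b j f = partial_op (opcoef (b j)) F' f.
  apply: Aw_partial_op AX _ => x /= xX; apply: (fsubsetP XF').
  by rewrite !inE.
have [_ [E AE bjE]] := HJ1 j J1j.
have in_a : in_Lp p (a j h) by case: (Aw_Lp hp w_ge1 (Aa j) inh).
have inB (g1 g2 : 'rV[R]_d -> complex R) : in_Lp p g1 -> in_Lp p g2 ->
  in_Lp p (fun y => g1 y - g2 y).
  move=> in1 in2; have := in_LpD hp in1 (in_LpZ hp (-1) in2).
  by under [X in in_Lp p X -> _]eq_fun do rewrite mulN1r.
(* The error is t1 + t2 + t3: the defect of [b j] as a left inverse at h, the truncation error of M
   at h (as M h = f almost everywhere), and the replacement of the coefficients of [b j] by n. *)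
pose t1 y := h y - b j (a j h) y.
pose t2 := b j (fun y => a j h y - f y).
pose t3 := trunc (fun x y => opcoef (b j) x y - n x y) F' f.
have in_t1 : in_Lp p t1.
  by apply: inB => //; case: (Aw_Lp hp w_ge1 Abj in_a).
have [in_t2 t2B] := Aw_Lp hp w_ge1 Abj (inB _ _ in_a inf).
have mcfn x : cmeasurable (fun y => opcoef (b j) x y - n x y).
  rewrite (_ : (fun y => _) = fun y => opcoef (b j) x y + -1 * n x y).
    apply: cmeasurableD; first exact: Aw_opcoef_measurable Abj.
    by apply: cmeasurableM => //; exact: cmeasurable_cst.
  by apply/funext => y; rewrite mulN1r.
have mt3 : cmeasurable t3 by apply: cmeasurable_trunc => //; case: inf.
have nt1 : (Lp_norm p t1 <= (de * nh)%:E)%E.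
  have [inE EB] := Aw_Lp hp w_ge1 AE inh.
  rewrite EFinM -(normE _ inh); apply: le_trans EB.
  rewrite (eq_Lp_norm hp in_t1.1 inE.1)//.
  exists Z; split => // y /= hy; apply: contrapT => nZy; apply: hy => _.
  by rewrite /t1 bjE /e /restrict asboolT// mul1r opprB addrCA subrr addr0.
have nt2 : (Lp_norm p t2 <= (B * (de * nh))%:E)%E.
  apply: le_trans t2B _; rewrite EFinM; apply: lee_wpmul2l;
    first by rewrite lee_fin.
  rewrite EFinM -(normE _ inh).
  have [mMh _] := op_in_Lp M inh.
  have mt : cmeasurable (trunc m (F (J + j)%N) h).
    by apply: cmeasurable_trunc => //; case: inh.
  apply: le_trans (series_tail hp mm u0 mu_ae hM (uF _) (ltW de0) (HJ3 _ J3j)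
    inh).
  rewrite -[leRHS]mul1e; apply: le_Lp_norm => //.
  - by case: (inB _ _ in_a inf).
  - rewrite (_ : (fun y => _) = fun y => M h y + -1 * trunc m (F (J + j)%N) h
    y).
      apply: cmeasurableD => //; apply: cmeasurableM => //;
        exact: cmeasurable_cst.
    by apply/funext => y; rewrite mulN1r.
  have aeZ : {ae @lebesgue_rV R d, forall y, ~ Z y}.
    by exists Z; split => // y /= /contrapT.
  apply: filterS2 Mh aeZ => y My nZy; rewrite mul1r.
  rewrite My// (_ : a j h y = trunc m (F (J + j)%N) h y) -?[X in _ <=
    cmod X]opprB ?cmodN//.
  by rewrite /a /trunc !big_seq; apply: eq_bigr => x xF;
    rewrite (m'E _ _ _ xF nZy).
have nt3 : (Lp_norm p t3 <= (de * nf)%:E)%E.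
  rewrite EFinM -(normE _ inf).
  have gae x : {ae @lebesgue_rV R d, forall y,
    cmod (opcoef (b j) x y - n x y) <= g x}.
    by apply: nearW => y; rewrite -opprB cmodN.
  apply: le_trans (Lp_norm_trunc hp mcfn g0 gae F' inf.1) _.
  apply: lee_wpmul2r; first exact: Lp_norm_ge0.
  by rewrite lee_fin; apply: le_trans gX; apply: ler_sum => x _;
    rewrite ler_peMr.
rewrite (_ : (_ \- _) = fun y => (t1 y + t2 y) + t3 y); last first.
  apply/funext => y; rewrite /t1 /t2 (Aw_linearB _ _ Abj) bE /t3 /trunc.
  under [X in _ = _ + X]eq_bigr do rewrite mulrBl.
  by rewrite sumrB /= -/h /partial_op /translation; ring.
have mt12 : cmeasurable (fun y => t1 y + t2 y).
  by apply: cmeasurableD; [case: in_t1|case: in_t2].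
apply: le_trans (Lp_normD hp mt12 mt3) _.
apply: (@le_trans _ _ ((de * nh)%:E + (B * (de * nh))%:E + (de * nf)%:E)%E).
  apply: leeD => //; apply: le_trans (Lp_normD hp in_t1.1 in_t2.1) _.
  exact: leeD.
rewrite -!EFinD lee_fin (_ : _ + _ = eps * (S / (S + 1))); last first.
  by rewrite /de /S; field; rewrite gt_eqF// ltr_wpDl.
rewrite ler_piMr ?(ltW eps0)// ler_pdivrMr ?ltr_wpDl// mul1r lerDl//.
Qed.
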